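(* Let $w^0\in\mathrm{Gr}^{\mathcal L}_{\mathcal H_+}(\mathcal H,\omega)$ be such that $\tau_{w^0}(\mathbf t'):=\mathcal T_{\mathfrak{sp}}(\tau_{w^0}(\mathbf t))\neq0$. Then for every $\mathbf n'\in\mathbf B$ the ring homomorphism $\mathcal S\to(S^\times_{\mathbf y})^{-1}\mathbb C[[\mathbf y,\mathbf t']]$, $\pi_\lambda\mapsto h^{\mathbf n',\lambda}_{w^0}$, annihilates $\mathcal I^{\mathcal L}$, and so induces a homomorphism of commutative algebras $$\Psi^{\mathbf n'}_{w^0}:\mathcal S/\mathcal I^{\mathcal L}\to(S^\times_{\mathbf y})^{-1}\mathbb C[[\mathbf y,\mathbf t']],\qquad\pi_\lambda\mapsto h^{\mathbf n',\lambda}_{w^0}.$$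
   Context: Partitions and Frobenius notation: a partition $\lambda$ of Frobenius rank $r$ is written $\lambda=(a_1,\dots,a_r\mid b_1,\dots,b_r)$ with $a_1>\dots>a_r\ge 0$, $b_1>\dots>b_r\ge 0$, $a_i=\lambda_i-i$, $b_i=\lambda'_i-i$. Let $\mathcal S=\mathbb C[\pi_\lambda]$ be the polynomial ring in indeterminates $\pi_\lambda$ indexed by all partitions. Plücker relations: for integers $0<k<N$ and a $k$-tuple $L$ of integers in $\{-k,\dots,N-k-1\}$ set $\tilde\pi_L:=\mathrm{sgn}(L)\pi_{\lambda(L)}$, where $\mathrm{sgn}(L)$ is the sign of the permutation sorting $L$ increasingly ($0$ if $L$ has a repeated entry) and $\lambda(L)$ has parts $\lambda_i=L'_{k-i+1}+i$ for the increasing rearrangement $L'_1<\dots<L'_k$. For a $(k-1)$-tuple $I$ and $(k+1)$-tuple $J$ in that range, $p_{I,J}:=\sum_{j=1}^{k+1}(-1)^j\tilde\pi_{I_1,\dots,I_{k-1},J_j}\tilde\pi_{J_1,\dots,\widehat{J_j},\dots,J_{k+1}}$; $\mathcal I$ is the ideal generated by all $p_{I,J}$. Lagrange relations: for $k\ge1$ let $\mathcal H_{k,2k}$ have basis $e_{-k},\dots,e_{k-1}$ and symplectic form $\omega(e_i,e_j)=-\omega(e_j,e_i)=(-1)^i\delta_{i,-j-1}$; for $\lambda\subset k^k$ let $|\lambda\rangle=e_{L_k}\wedge\dots\wedge e_{L_1}$ with $L$ the increasing tuple with $\lambda(L)=\lambda$; the Lagrange relations for $k$ are the coefficients (linear forms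 in the $\pi_\lambda$) of $\iota_\omega(\sum_{\lambda\subset k^k}\pi_\lambda|\lambda\rangle)\in\Lambda^{k-2}\mathcal H_{k,2k}$, where $\iota_\omega(v_1\wedge\dots\wedge v_k)=\sum_{a<b}(-1)^{a+b}\omega(v_a,v_b)v_1\wedge\cdots\widehat{v_a}\cdots\widehat{v_b}\cdots\wedge v_k$. $\mathcal I^{\mathcal L}$ is the ideal generated by $\mathcal I$ and all Lagrange relations ($k\ge2$). A point $w^0\in\mathrm{Gr}^{\mathcal L}_{\mathcal H_+}(\mathcal H,\omega)$ is a family $(\pi_\lambda(w^0))_\lambda$ of complex numbers, not all zero, annihilated by $\mathcal I^{\mathcal L}$; its KP $\tau$-function is $\tau_{w^0}(\mathbf t)=\sum_\lambda\pi_\lambda(w^0)s_\lambda(\mathbf t)\in\mathbb C[[\mathbf t]]$ ($s_\lambda$ the Schur function in $t_i=p_i/i$). Known property (may be used): $\tau_{w^0}(t_1,t_2,t_3,\dots)=\tau_{w^0}(t_1,-t_2,t_3,-t_4,\dots)$. Evaluations: $\mathbb C[[\mathbf x,\mathbf t]]$ is the formal power series ring in $x_i$ ($i\in\mathbb Z$), $t_j$ ($j\ge1$), localized at the $x_i-x_j$ ($i\ne j$); $\mathbf A$ the group of finitely supported integer sequences $(n_i)_{i\in\mathbb Z}$, $\boldsymbol\alpha_i$ its unit vectors; $H^{\mathbf n}_w:=\prod_{i<j}(x_i-x_j)^{n_in_j}\tau_w(\mathbf t+\sum_in_i[x_i])$, where $t_j\mapsto t_j+\sum_in_ix_i^j/j$;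 $H^{\mathbf n,\lambda}_w:=H_w^{\mathbf n+\sum_i\boldsymbol\alpha_{a_i}-\sum_i\boldsymbol\alpha_{-b_i-1}}$. $\mathbb C[[\mathbf y,\mathbf t']]$ is the formal power series ring in $y_i$ ($i\ge1$) and $t_1,t_3,\dots$, $(S^\times_{\mathbf y})^{-1}\mathbb C[[\mathbf y,\mathbf t']]$ its localization at the multiplicative set generated by $y_i-y_j$ ($i\ne j$) and $y_i+y_j$. $\mathcal T_{\mathfrak{sp}}$ is the ring homomorphism given by $t_j\mapsto t_j$ ($j$ odd), $t_j\mapsto0$ ($j$ even), $x_i\mapsto y_{i+1}$ ($i\ge0$), $x_i\mapsto-y_{-i}$ ($i<0$). $h^{\mathbf n,\lambda}_{w^0}:=\mathcal T_{\mathfrak{sp}}(H^{\mathbf n,\lambda}_{w^0})$. $\mathbf B\subset\mathbf A$ is the sublattice of $\mathbf n$ with $n_{i-1}=-n_{-i}$ for all $i\ge1$, generated by $\boldsymbol\beta_i:=\boldsymbol\alpha_{i-1}-\boldsymbol\alpha_{-i}$, $i\ge1$. *)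

(* Defs.v *)
From mathcomp Require Import all_boot all_order all_algebra all_fingroup complex.
From mathcomp Require Import Rstruct.
Set Implicit Arguments. Unset Strict Implicit. Unset Printing Implicit Defensive.
Import Order.TTheory GRing.Theory Num.Theory.
Local Open Scope ring_scope.

Definition C : fieldType := (Rdefinitions.R)[i].

Definition is_partition (l : seq nat) : bool :=
  sorted geq l && all (fun x => (0 < x)%N) l.

Fixpoint parts_aux (fuel m d : nat) : seq (seq nat) :=
  if d == 0%N then [:: [::]] else
  match fuel with
  | 0 => [::]
  | fuel'.+1 =>
      flatten [seq [seq p :: r | r <- parts_aux fuel' p (d - p)]
              | p <- iota 1 (minn m d)]
  end.

Definition partsn (d : nat) : seq (seq nat) := parts_aux d d d.

Definition box (k : nat) : seq (seq nat) :=
  [seq l <- flatten [seq partsn d | d <- iota 0 (k * k).+1]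
   | (size l <= k)%N && all (fun x => x <= k)%N l].

Definition sgnL (L : seq int) : int :=
  if uniq L then
    (-1) ^+ (\sum_(a < size L) \sum_(b < size L)
               ((a < b)%N && (nth (0 : int) L b < nth (0 : int) L a)%R : nat))%N
  else 0.

Definition lamL (L : seq int) : seq nat :=
  let k := size L in
  let L' := sort (fun a b : int => a <= b) L in
  [seq x <- [seq absz (nth 0 L' (k - i) + (i%:Z)) | i <- iota 1 k] | (0 < x)%N].

Definition rem_at (T : Type) (j : nat) (s : seq T) : seq T :=
  take j s ++ drop j.+1 s.

(* The Plucker relation p_{I,J} as a list of terms
   (sign, lambda, mu) meaning  sign * pi_lambda * pi_mu.
   Position j (0-based) corresponds to j+1 in the paper. *)
Definition plucker_terms (I J : seq int) : seq (int * seq nat * seq nat) :=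
  [seq (let L1 := rcons I (nth 0 J j) in
        let L2 := rem_at j J in
        ((-1) ^+ j.+1 * sgnL L1 * sgnL L2, lamL L1, lamL L2))
  | j <- iota 0 (size J)].

Definition in_range (k N : nat) (L : seq int) : bool :=
  all (fun x : int => (- (k%:Z) <= x) && (x <= (N%:Z) - (k%:Z) - 1)) L.

Definition plucker_index (k N : nat) (I J : seq int) : Prop :=
  [/\ (0 < k)%N, (k < N)%N, size I = k.-1, size J = k.+1 &
      in_range k N I && in_range k N J].

(* omega(e_p, e_q) = (-1)^p delta_{p,-q-1}                              *)
Definition omega (p q : int) : int :=
  if p + q == -1 then (-1) ^+ (odd (absz p)) else 0.

(* |lambda> = e_{L_k} /\ ... /\ e_{L_1} = v_1 /\ ... /\ v_k with
   v_a = e_{lambda_a - a} (a = 1..k); we list the indices of v_1..v_k. *)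
Definition lag_vec (k : nat) (lam : seq nat) : seq int :=
  [seq ((nth 0%N lam a)%:Z - (a.+1)%:Z) | a <- iota 0 k].

(* coefficient of pi_lambda in the coefficient of the basis (k-2)-vector
   e_{M_1} /\ ... /\ e_{M_{k-2}} of iota_omega(sum_lambda pi_lambda |lambda>);
   a,b are 0-based (so (-1)^{a+b} is unchanged). *)
Definition lagr_coef (k : nat) (M : seq int) (lam : seq nat) : int :=
  let v := lag_vec k lam in
  \sum_(a < k) \sum_(b < k)
    (if (a < b)%N && (rem_at a (rem_at b v) == M)
     then (-1) ^+ (a + b) * omega (nth 0 v a) (nth 0 v b) else 0).

Definition plucker_val (pi : seq nat -> C) (I J : seq int) : C :=
  \sum_(x <- plucker_terms I J) (x.1.1)%:~R * pi x.1.2 * pi x.2.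

Definition lagr_val (pi : seq nat -> C) (k : nat) (M : seq int) : C :=
  \sum_(lam <- box k) (lagr_coef k M lam)%:~R * pi lam.

(* w0 in Gr^L_{H+}(H, omega): a family (pi_lambda) of complex numbers,
   not all zero, annihilated by I^L (i.e. by all its generators). *)
Definition in_LagrGr (pi : seq nat -> C) : Prop :=
  [/\ exists lam, is_partition lam /\ pi lam != 0,
      forall k N I J, plucker_index k N I J -> plucker_val pi I J = 0 &
      forall k M, (2 <= k)%N -> lagr_val pi k M = 0].

(* The formal power series ring C[[y, t']] in y_1, y_2, ... and
   t_1, t_3, t_5, ...  A monomial is a pair (ey, et) of exponent lists:
   ey`_a is the exponent of y_{a+1}, et`_a the exponent of t_{2a+1};
   trailing zeros are irrelevant.  A series is its coefficient function,
   read on canonical (trailing-zero-free) monomials. *)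
Fixpoint rstrip (s : seq nat) : seq nat :=
  match s with
  | [::] => [::]
  | x :: s' => let r := rstrip s' in
               if (x == 0%N) && (r == [::]) then [::] else x :: r
  end.

Definition mono := (seq nat * seq nat)%type.
Definition cm (m : mono) : mono := (rstrip m.1, rstrip m.2).

Definition ps := mono -> C.
Definition coef (f : ps) (m : mono) : C := f (cm m).

Definition ps_eq (f g : ps) : Prop := forall m, coef f m = coef g m.

Definition ps0 : ps := fun _ => 0.
Definition ps_mono (m0 : mono) : ps := fun m => if cm m == cm m0 then 1 else 0.
Definition ps1 : ps := ps_mono ([::], [::]).
Definition ps_add (f g : ps) : ps := fun m => coef f m + coef g m.
Definition ps_scale (c : C) (f : ps) : ps := fun m => c * coef f m.
Definition ps_opp (f : ps) : ps := ps_scale (-1) f.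

Fixpoint lesubs (s : seq nat) : seq (seq nat) :=
  match s with
  | [::] => [:: [::]]
  | a :: s' => flatten [seq [seq x :: r | r <- lesubs s'] | x <- iota 0 a.+1]
  end.

Definition subn_seq (s u : seq nat) : seq nat := [seq (x.1 - x.2)%N | x <- zip s u].

Definition ps_mul (f g : ps) : ps := fun m =>
  let m := cm m in
  \sum_(u <- lesubs m.1) \sum_(v <- lesubs m.2)
     coef f (u, v) * coef g (subn_seq m.1 u, subn_seq m.2 v).

Definition ps_sum (l : seq ps) : ps := foldr ps_add ps0 l.
Definition ps_prod (l : seq ps) : ps := foldr ps_mul ps1 l.
Definition ps_exp (f : ps) (e : nat) : ps := ps_prod (nseq e f).

(* y_a^e (a >= 1) and t_j (j odd) *)
Definition y_pow (a e : nat) : ps := ps_mono (rcons (nseq a.-1 0%N) e, [::]).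
Definition t_var (j : nat) : ps := ps_mono ([::], rcons (nseq j./2 0%N) 1%N).

Definition wdeg (m : mono) : nat :=
  (sumn m.1 + \sum_(a < size m.2) (a.*2.+1 * nth 0 m.2 a))%N.

(* The substitution T_sp:  x_i |-> sigma_i, with sigma_i = y_{i+1} (i>=0),
   sigma_i = - y_{-i} (i<0); t_j |-> t_j (j odd), t_j |-> 0 (j even).     *)
Definition sig_pow (i : int) (e : nat) : ps :=
  if (0 <= i) then y_pow (absz i).+1 e
  else ps_scale ((-1) ^+ e) (y_pow (absz i) e).
Definition sig (i : int) : ps := sig_pow i 1.

Definition window (W : nat) : seq int := [seq (k%:Z - W%:Z) | k <- iota 0 (W + W)].

(* T_sp(t_j + sum_i n_i x_i^j / j), n supported in the window *)
Definition Tsub (n : int -> int) (W : nat) (j : nat) : ps :=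
  ps_add (if odd j then t_var j else ps0)
         (ps_sum [seq ps_scale ((n i)%:~R / j%:R) (sig_pow i j) | i <- window W]).

(* complete homogeneous functions h_0..h_k at the arguments T:
   sum_k h_k z^k = exp(sum_j T_j z^j), i.e. k h_k = sum_{j=1}^k j T_j h_{k-j} *)
Fixpoint hlist (T : nat -> ps) (k : nat) : seq ps :=
  match k with
  | 0 => [:: ps1]
  | k'.+1 => let l := hlist T k' in
             rcons l (ps_scale (k%:R)^-1
               (ps_sum [seq ps_scale (j%:R) (ps_mul (T j) (nth ps0 l (k - j)))
                       | j <- iota 1 k]))
  end.

Definition hfun (T : nat -> ps) (z : int) : ps :=
  if z < 0 then ps0 else nth ps0 (hlist T (absz z)) (absz z).

(* Schur function s_lambda(T) by the Jacobi-Trudi formula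
   s_lambda = det (h_{lambda_i - i + j})_{1<=i,j<=l(lambda)} (Leibniz expansion) *)
Definition schur (T : nat -> ps) (lam : seq nat) : ps :=
  let l := size lam in
  ps_sum [seq ps_scale ((-1) ^+ (odd_perm s))
            (ps_prod [seq hfun T ((nth 0%N lam (i : 'I_l))%:Z - (i : nat)%:Z + (s i : nat)%:Z)
                     | i <- enum 'I_l])
         | s : {perm 'I_l} <- enum {perm 'I_l}].

(* T_sp( tau_{w0}( t + sum_i n_i [x_i] ) ) = sum_lambda pi_lambda s_lambda(T),
   coefficientwise (only |lambda| = weighted degree contributes). *)
Definition tau_sp (pi : seq nat -> C) (n : int -> int) (W : nat) : ps :=
  fun m => \sum_(lam <- partsn (wdeg (cm m)))
             pi lam * coef (schur (Tsub n W) lam) m.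

Definition conjp (lam : seq nat) (i : nat) : nat := count (fun x => i <= x)%N lam.
Definition frank (lam : seq nat) : nat :=
  count (fun i => i.+1 <= nth 0%N lam i)%N (iota 0 (size lam)).
Definition frob_a (lam : seq nat) : seq int :=
  [seq ((nth 0%N lam i)%:Z - (i.+1)%:Z) | i <- iota 0 (frank lam)].
Definition frob_b (lam : seq nat) : seq int :=
  [seq ((conjp lam i.+1)%:Z - (i.+1)%:Z) | i <- iota 0 (frank lam)].

Definition shiftn (n : int -> int) (lam : seq nat) : int -> int := fun p =>
  n p + (count (fun a => a == p) (frob_a lam))%:Z
      - (count (fun b => - b - 1 == p) (frob_b lam))%:Z.

(* The localization (S_y^x)^{-1} C[[y,t']]: elements are written as
   fractions (numerator, denominator) with denominators products of
   factors sigma_i - sigma_j = +-(y_a -+ y_b), which are (up to sign)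
   in the multiplicative set S_y^x.                                    *)
Definition frac := (ps * ps)%type.
Definition fr0 : frac := (ps0, ps1).
Definition fr_add (x y : frac) : frac :=
  (ps_add (ps_mul x.1 y.2) (ps_mul y.1 x.2), ps_mul x.2 y.2).
Definition fr_mul (x y : frac) : frac := (ps_mul x.1 y.1, ps_mul x.2 y.2).
Definition fr_scale (c : C) (x : frac) : frac := (ps_scale c x.1, x.2).
Definition fr_sum (l : seq frac) : frac := foldr fr_add fr0 l.

(* generators of S_y^x: (a, b, false) = y_a - y_b (a <> b),
   (a, b, true) = y_a + y_b;  indices a, b >= 1 *)
Definition gen_ok (g : nat * nat * bool) : bool :=
  [&& (0 < g.1.1)%N, (0 < g.1.2)%N & g.2 || (g.1.1 != g.1.2)].
Definition gen_ps (g : nat * nat * bool) : ps :=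
  ps_add (y_pow g.1.1 1) (ps_scale (if g.2 then 1 else -1) (y_pow g.1.2 1)).

Definition loc_zero (x : frac) : Prop :=
  exists s : seq (nat * nat * bool),
    all gen_ok s /\ ps_eq (ps_mul (ps_prod (map gen_ps s)) x.1) ps0.

(* prefactor prod_{i<j} (sigma_i - sigma_j)^{m_i m_j}, split into the
   positive-exponent part (numerator) and negative-exponent part (denominator) *)
Definition sdiff (i j : int) : ps := ps_add (sig i) (ps_opp (sig j)).
Definition pref_num (m : int -> int) (W : nat) : ps :=
  ps_prod [seq ps_exp (sdiff ij.1 ij.2) (absz (m ij.1 * m ij.2))
          | ij <- [seq (i, j) | i <- window W, j <- window W]
          & (ij.1 < ij.2) && (0 < m ij.1 * m ij.2)].
Definition pref_den (m : int -> int) (W : nat) : ps :=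
  ps_prod [seq ps_exp (sdiff ij.1 ij.2) (absz (m ij.1 * m ij.2))
          | ij <- [seq (i, j) | i <- window W, j <- window W]
          & (ij.1 < ij.2) && (m ij.1 * m ij.2 < 0)].

(* h^{n,lambda}_{w0} = T_sp(H^{n,lambda}_{w0}) as an element of the
   localization; n is supported in {i : |i| < K}. The window is chosen
   large enough to contain the support of the shifted point. *)
Definition hfrac (pi : seq nat -> C) (n : int -> int) (K : nat) (lam : seq nat) : frac :=
  let m := shiftn n lam in
  let W := (K + sumn lam + size lam).+1 in
  (ps_mul (pref_num m W) (tau_sp pi m W), pref_den m W).

Definition plucker_img (pi : seq nat -> C) (n : int -> int) (K : nat) (I J : seq int) : frac :=
  fr_sum [seq fr_scale (x.1.1)%:~R (fr_mul (hfrac pi n K x.1.2) (hfrac pi n K x.2))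
         | x <- plucker_terms I J].

Definition lagr_img (pi : seq nat -> C) (n : int -> int) (K : nat) (k : nat) (M : seq int) : frac :=
  fr_sum [seq fr_scale (lagr_coef k M lam)%:~R (hfrac pi n K lam) | lam <- box k].

Definition finsupp_by (n : int -> int) (K : nat) : Prop :=
  forall i : int, (K <= absz i)%N -> n i = 0.
Definition in_B (n : int -> int) : Prop :=
  forall i : nat, (1 <= i)%N -> n (i%:Z - 1) = - n (- (i%:Z)).

(* Main.v *)
(** The truncation of tau to the partitions inside an N x N box is the pairing of a
    vector of Lambda^N with the covectors z^j H_n (0 <= j < N), where
    H_n = exp (sum_j T_j z^j) is the generating series of the h_k at the shifted times.
    Put m = n - sum_(-k <= i < 0) alpha_i.  For an increasing k-tuple L, the shifted point
    attached to lambda(L) is m + sum_(i in L) alpha_i, and since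
    H_m = prod_(i in L) (1 - x_i z) H_(m + 1_L), a change of basis among polynomials of
    degree < N shows that H^(n, lambda(L)) is, up to a factor independent of L, the pairing
    with the fixed covectors z^j H_m (j < N - k) followed by
    u_i = c_i z^(N - k) H_(m + alpha_i), i in L: the Vandermonde factors and the c_i
    account for the prefactor prod (x_i - x_j)^(n_i n_j).  Hence the Plucker relations for
    the H^(n, lambda) are the Plucker relations of the box vector, extended
    multilinearly to covectors.

    For the Lagrange relations, after x_(- i - 1) = - x_i and t_even = 0 the form
    [z^(-1)] f(-z) g(z) makes multiplication by a series with H(z) H(-z) = 1 symplectic.
    The u_i, the z^j H_m and the z^j / H_m(-z) form a Darboux basis, so that contracting
    with omega in this basis or in the standard one gives the same result, and only the
    u_i contribute because the z^j H_m are already present among the covectors.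

    These identities hold in the fraction field of a polynomial ring in finitely many y_i
    and t_j; a power series is compared with a polynomial up to a given weighted degree,
    which is enough because a Schur function is homogeneous of degree |lambda|. *)

From HB Require Import structures.
Require Import Defs.
From mathcomp Require Import all_boot all_order all_algebra all_fingroup.
From mathcomp Require Import complex Rstruct boolp mpoly.
From mathcomp Require Import zify ring.
Set Implicit Arguments. Unset Strict Implicit. Unset Printing Implicit Defensive.
Import Order.TTheory GRing.Theory Num.Theory.
Local Open Scope ring_scope.

(** * Alternating functions of sequences *)

(** Every coefficient of a relation is tested separately. For a monomial of weighted degree d the
    box has side N = d + k, so that r = d covectors z^j H_m join the k covectors attached to L. All
    partitions of size at most d lie in this box, and the hypotheses on the given point are used
    only for the N x N box, where they hold exactly; hence the identities between truncated values
    are exact and no error term is propagated. The obstacle is division: the prefactors have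
    denominators of positive degree, by which a truncated series cannot be divided. The two
    components of a fraction are therefore represented separately by polynomials, the identity is
    proved for the quotients of the representatives, and a quotient 0 forces the numerator to be 0.
    So the numerators vanish coefficient by coefficient, and the empty product witnesses vanishing
    in the localization. The Lagrange relations, indexed by decreasing tuples, are first rewritten
    as sums over all ordered pairs (p, q), a form that extends to covectors and survives a change of
    basis. *)

Section Alternating.
Variables (R : comNzRingType) (T : Type).

(** Only adjacent exchanges at one fixed length: this can be checked by a local computation on
    inversions, and it passes to the tail when the head is fixed. Vanishing on repetitions is not
    built in. *)
Definition adjalt (n : nat) (phi : seq T -> R) : Prop :=
  forall A p q B, size (A ++ p :: q :: B) = n ->
    phi (A ++ p :: q :: B) = - phi (A ++ q :: p :: B).

Lemma adjalt_cons n phi x :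
  adjalt n.+1 phi -> adjalt n (fun L => phi (x :: L)).
Proof. by move=> alt A p q B sz; apply: (alt (x :: A)); rewrite /= sz. Qed.

Lemma adjalt_move n phi A x B : adjalt n phi -> size (A ++ x :: B) = n ->
  phi (A ++ x :: B) = (-1) ^+ size A * phi (x :: A ++ B).
Proof.
move=> alt; elim/last_ind: A B => [|A y IH] B; first by rewrite mul1r.
rewrite cat_rcons => sz; rewrite (alt A y x B) // IH.
  by rewrite size_rcons exprS mulN1r mulNr cat_rcons.
by rewrite -sz !size_cat.
Qed.

(** With both copies of [x] brought to the front, the value is its own opposite; the first
    hypothesis says that 2 is not a zero divisor. *)
Lemma adjalt_repeat n phi A x B D : (forall y : R, y = - y -> y = 0) ->
  adjalt n phi -> size (A ++ x :: B ++ x :: D) = n -> phi (A ++ x :: B ++ x :: D) = 0.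
Proof.
move=> two0 alt sz.
rewrite (adjalt_move alt) // catA -cat_cons (adjalt_move alt) /=; last first.
  by rewrite -sz !size_cat /= !size_cat /=; lia.
suff -> : phi [:: x, x & (A ++ B) ++ D] = 0 by rewrite !mulr0.
apply: two0; apply: (alt [::]).
by rewrite -sz /= !size_cat /= !size_cat /=; lia.
Qed.
End Alternating.

Lemma adjalt_nuniq (R : comNzRingType) (T : eqType) n (phi : seq T -> R) L :
    (forall y : R, y = - y -> y = 0) -> adjalt n phi -> size L = n ->
  ~~ uniq L -> phi L = 0.
Proof.
move=> two0; elim: L n phi => [|x L IH] [|n] phi //= alt [sz].
rewrite negb_and negbK => /orP[xL|nu]; last first.
  by apply: (IH n (fun L => phi (x :: L))) => //; apply: adjalt_cons.
case/splitPr: xL sz => B D sz.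
by apply: (@adjalt_repeat _ _ n.+1 phi [::] x B D) => //=; rewrite -sz.
Qed.

Lemma sgnL_nuniq L : ~~ uniq L -> sgnL L = 0.
Proof. by rewrite /sgnL => /negbTE ->. Qed.

Lemma sgnL_cons x L :
  sgnL (x :: L) = if x \in L then 0 else (-1) ^+ count (fun y => y < x) L * sgnL L.
Proof.
rewrite /sgnL /=; case: (x \in L) => //=; case: (uniq L); last by rewrite mulr0.
rewrite -exprD; congr (_ ^+ _).
rewrite big_ord_recl /= big_ord_recl /= add0n; congr (_ + _)%N.
  rewrite -sum1_count (big_nth 0) big_mkord [RHS]big_mkcond /=.
  by apply: eq_bigr => i _; case: ifP.
apply: eq_bigr => i _; rewrite big_ord_recl /= add0n.
by [].
Qed.

Lemma perm_eq_adj (T : eqType) (A B : seq T) (p q : T) :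
  perm_eq (A ++ p :: q :: B) (A ++ q :: p :: B).
Proof.
rewrite perm_cat2l -[p :: _]/([:: p; q] ++ B) -[q :: p :: _]/([:: q; p] ++ B).
by rewrite perm_cat2r (perm_catC [:: p] [:: q]).
Qed.

Lemma sgnL_swap A p q B : sgnL (A ++ p :: q :: B) = - sgnL (A ++ q :: p :: B).
Proof.
elim: A => [|x A IH] /=.
  rewrite !sgnL_cons !inE /= [q == p]eq_sym.
  case: eqVneq => [->|npq] /=; first by rewrite oppr0.
  case pB: (p \in B); case qB: (q \in B); rewrite ?mulr0 ?oppr0 //.
  rewrite !exprD; case: ltgtP npq => // _ _; rewrite ?expr1 ?expr0; ring.
rewrite !sgnL_cons (perm_mem (perm_eq_adj A B p q)).
case: ifP => _; first by rewrite oppr0.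
by rewrite IH mulrN (seq.permP (perm_eq_adj A B p q)).
Qed.

Lemma sgnL_sqr L : uniq L -> sgnL L * sgnL L = 1.
Proof. by rewrite /sgnL => ->; rewrite -expr2 sqrr_sign. Qed.

Lemma lamL_perm L1 L2 : perm_eq L1 L2 -> lamL L1 = lamL L2.
Proof.
move=> eL; rewrite /lamL (perm_size eL).
suff -> : sort (fun a b : int => a <= b) L1 = sort (fun a b : int => a <= b) L2 by [].
by apply/perm_sortP => //; [exact: le_total|exact: le_trans|exact: le_anti].
Qed.

(** Insertion sort: the tail is sorted by induction, then the head moves past the smaller entries,
    which are exactly its inversions counted by [sgnL_cons]. *)
Lemma adjalt_sort (R : comNzRingType) (phi : seq int -> R) L :
  adjalt (size L) phi -> uniq L ->
  phi L = (sgnL L)%:~R * phi (sort <=%R L).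
Proof.
elim: L phi => [|x L IH] phi alt uL.
  by rewrite /sgnL /= big_ord0 expr0 mul1r.
have [/= xL {}uL] := andP uL.
have:= IH (fun L => phi (x :: L)) (@adjalt_cons _ _ _ _ x alt) uL => /= ->.
rewrite sgnL_cons (negbTE xL) rmorphM /= -mulrA [RHS]mulrCA; congr (_ * _).
rewrite rmorphXn /= rmorphN1; set S := sort _ L.
have eS : perm_eq S L by rewrite perm_sort.
have sS : sorted <=%R S by apply: sort_sorted; exact: le_total.
have xS : x \notin S by rewrite (perm_mem eS).
(* [A] is the stretch of the sorted tail that [x] has to cross; its length is the exponent of the
   sign. *)
pose A := [seq y <- S | y < x]; pose B := [seq y <- S | ~~ (y < x)].
have eAB : S = A ++ B.
  apply: (sorted_eq le_trans le_anti) => //; last first.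
    by rewrite perm_sym; apply/permPl; exact: perm_filterC.
  have sf P : sorted <=%R (filter P S) by apply: sorted_filter => //; exact: le_trans.
  rewrite sorted_pairwise; last exact: le_trans.
  rewrite pairwise_cat -!sorted_pairwise ?sf ?andbT; try exact: le_trans.
  apply/allrelP => a b; rewrite !mem_filter -leNgt => /andP[ax _] /andP[xb _].
  exact: ltW (lt_le_trans ax xb).
have -> : sort <=%R (x :: L) = A ++ x :: B.
  apply: (sorted_eq le_trans le_anti); first by apply: sort_sorted; exact: le_total.
    have := sS; rewrite eAB !(sorted_pairwise le_trans) !pairwise_cat /=.
    case/and3P=> rAB pA pB; rewrite pA pB !andbT; apply/andP; split.
      apply/allrelP => a b aA; rewrite inE => /orP[/eqP->|bB].
        by move: aA; rewrite mem_filter => /andP[/ltW].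
      exact: (allrelP rAB).
    by apply/allP => b; rewrite mem_filter -leNgt => /andP[].
  by rewrite perm_sort perm_sym -(cat1s x B) perm_catCA /= perm_cons -eAB.
have szA : size A = count (fun y => y < x) L by rewrite size_filter; apply/seq.permP.
rewrite (@adjalt_move _ _ (size (x :: L)) phi A x B) //; last first.
  by rewrite size_cat /= addnS -size_cat -eAB (perm_size eS).
by rewrite -eAB szA mulrA -exprD addnn -mul2n exprM sqrrN !expr1n mul1r.
Qed.

Lemma adjalt_sgnL (R : comNzRingType) n (phi : seq nat -> R) :
  adjalt n (fun L => (sgnL L)%:~R * phi (lamL L)).
Proof.
move=> A p q B _; rewrite sgnL_swap rmorphN mulNr.
by rewrite (lamL_perm (perm_eq_adj A B p q)).
Qed.

(** * Multilinear extension to covectors *)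

Section MultilinearExtension.
Variable R : comNzRingType.
Implicit Types (rg : seq int) (phi psi : seq int -> R) (f g : int -> R).
Implicit Types (fs gs : seq (int -> R)).

(** Contraction of the tensor [phi], with indices in [rg], against one covector per slot. The tensor
    need not be alternating: in [mlext_rem_at] it is a product of two functions of disjoint
    slots. *)
Fixpoint mlext rg phi fs : R :=
  if fs is f :: fs' then
    \sum_(p <- rg) f p * mlext rg (fun L => phi (p :: L)) fs'
  else phi [::].

Lemma eq_mlext rg phi psi fs :
  (forall L, size L = size fs -> {subset L <= rg} -> phi L = psi L) ->
  mlext rg phi fs = mlext rg psi fs.
Proof.
elim: fs phi psi => [|f fs IH] phi psi eqphi /=; first exact: eqphi.
apply: eq_big_seq => p prg; congr (_ * _); apply: IH => L sL sub.
by apply: eqphi => [/=|q]; rewrite ?sL // inE => /orP[/eqP->|/sub].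
Qed.

Lemma mlext0 rg fs : mlext rg (fun=> 0) fs = 0.
Proof. by elim: fs => //= f fs ->; rewrite big1 // => p _; rewrite mulr0. Qed.

Lemma mlextZ rg c phi fs : mlext rg (fun L => c * phi L) fs = c * mlext rg phi fs.
Proof.
elim: fs phi => //= f fs IH phi; rewrite mulr_sumr; apply: eq_bigr => p _.
by rewrite IH mulrCA.
Qed.

Lemma mlextZr rg c phi fs : mlext rg (fun L => phi L * c) fs = mlext rg phi fs * c.
Proof.
by rewrite mulrC -mlextZ; apply: eq_mlext => L _ _; rewrite mulrC.
Qed.

Lemma mlext_sum (I : Type) (s : seq I) rg (phi : I -> seq int -> R) fs :
  mlext rg (fun L => \sum_(i <- s) phi i L) fs = \sum_(i <- s) mlext rg (phi i) fs.
Proof.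
elim: fs phi => //= f fs IH phi; rewrite exchange_big; apply: eq_bigr => p _ /=.
by rewrite IH mulr_sumr.
Qed.

Lemma mlext_cat rg phi fs gs :
  mlext rg phi (fs ++ gs) =
  mlext rg (fun L => mlext rg (fun L' => phi (L ++ L')) gs) fs.
Proof. by elim: fs phi => //= f fs IH phi; apply: eq_bigr => p _; rewrite IH. Qed.

Lemma mlext_slot rg phi A f B :
  mlext rg phi (A ++ f :: B) = \sum_(p <- rg)
    f p * mlext rg (fun L => mlext rg (fun L' => phi (L ++ p :: L')) B) A.
Proof.
rewrite mlext_cat /= mlext_sum; apply: eq_bigr => p _.
by rewrite -mlextZ.
Qed.

Lemma mlext_linear (I : Type) (s : seq I) (c : I -> R) (g : I -> int -> R) f
    rg phi A B :
  {in rg, forall p, f p = \sum_(i <- s) c i * g i p} ->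
  mlext rg phi (A ++ f :: B) = \sum_(i <- s) c i * mlext rg phi (A ++ g i :: B).
Proof.
move=> fE; rewrite mlext_slot.
under eq_big_seq => p prg do rewrite (fE _ prg) mulr_suml.
rewrite exchange_big /=; apply: eq_bigr => i _.
by rewrite mlext_slot mulr_sumr; apply: eq_bigr => p _; rewrite mulrA.
Qed.

Lemma mlext_scale c f g rg phi A B :
  {in rg, forall p, f p = c * g p} ->
  mlext rg phi (A ++ f :: B) = c * mlext rg phi (A ++ g :: B).
Proof.
move=> fE; rewrite (@mlext_linear _ [:: tt] (fun=> c) (fun=> g) f).
  by rewrite big_seq1.
by move=> p prg; rewrite big_seq1 fE.
Qed.

Lemma eq_mlext_covec rg phi (I : eqType) (s : seq I) (f g : I -> int -> R) :
  {in s & rg, forall i p, f i p = g i p} ->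
  mlext rg phi (map f s) = mlext rg phi (map g s).
Proof.
elim: s phi => //= i s IH phi fg; apply: eq_big_seq => p prg.
rewrite fg ?mem_head //; congr (_ * _); apply: IH => j q js.
by apply: fg; rewrite inE js orbT.
Qed.

Lemma adjalt_mlext rg n phi : adjalt n phi -> adjalt n (mlext rg phi).
Proof.
move=> alt A f g B sz; rewrite !mlext_cat -mulN1r -mlextZ.
apply: eq_mlext => L sL _ /=; rewrite mulN1r.
under eq_bigr => p _ do rewrite mulr_sumr.
under [in RHS]eq_bigr => p _ do rewrite mulr_sumr.
rewrite exchange_big /= -sumrN; apply: eq_bigr => p _.
rewrite -sumrN; apply: eq_bigr => q _; rewrite mulrCA -!mulrN; congr (_ * (_ * _)).
rewrite -mulN1r -mlextZ; apply: eq_mlext => L' sL' _; rewrite mulN1r.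
by apply: alt; rewrite -sz !size_cat /= sL sL'.
Qed.

Definition pairing fs (L : seq int) : R := \prod_(x <- zip fs L) x.1 x.2.

Fixpoint allseqs rg (n : nat) : seq (seq int) :=
  if n is n'.+1 then [seq p :: L | p <- rg, L <- allseqs rg n'] else [:: [::]].

Lemma mem_allseqs rg n L :
  (L \in allseqs rg n) = (size L == n) && all (mem rg) L.
Proof.
elim: n L => [|n IH] [|p L] //=; first by apply/negbTE/negP => /allpairsP[[q L] [_ _]].
rewrite eqSS; apply/allpairsP/and3P => [[[q L'] /= [qr + [-> ->]]]|[sL pr aL]].
  by rewrite IH => /andP[-> ->].
by exists (p, L); split; rewrite //= IH sL aL.
Qed.

Lemma allseqs_uniq rg n : uniq rg -> uniq (allseqs rg n).
Proof.
move=> ur; elim: n => //= n IH.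
by apply: allpairs_uniq => // -[p L] [q L'] _ _ /= [-> ->].
Qed.

Lemma mlext_allseqs rg phi fs :
  mlext rg phi fs = \sum_(L <- allseqs rg (size fs)) phi L * pairing fs L.
Proof.
elim: fs phi => [|f fs IH] phi /=; first by rewrite big_seq1 /pairing big_nil mulr1.
rewrite big_allpairs_dep /=; apply: eq_bigr => p _.
rewrite IH mulr_sumr; apply: eq_bigr => L _.
by rewrite /pairing big_cons /=; ring.
Qed.

Lemma mlext_lincomb rg bs phi (Ms : seq (int -> R)) (g : int -> int -> R) :
  mlext rg phi [seq (fun p => \sum_(b <- bs) M b * g b p) | M : int -> R <- Ms] =
  mlext bs (fun s => mlext rg phi (map g s)) Ms.
Proof.
elim: Ms phi => //= M Ms IH phi.
under [RHS]eq_bigr => b _ do rewrite mlext_sum mulr_sumr.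
rewrite exchange_big /=; apply: eq_bigr => p _.
rewrite IH mulr_suml; apply: eq_bigr => b _.
by rewrite -mulrA -mlextZ.
Qed.

End MultilinearExtension.

(** * Signs of integer tuples, Leibniz sums and minors *)

Lemma sgz_prod_sub (x : int) (s : seq int) :
  sgz (\prod_(y <- s) (y - x)) = if x \in s then 0 else (-1) ^+ count (fun y => y < x) s.
Proof.
elim: s => [|y s IH]; first by rewrite big_nil.
rewrite big_cons sgzM IH inE /= exprD.
case: (x \in s); first by rewrite orbT mulr0.
rewrite orbF; case: ltgtP => // [lyx|lxy|->]; last by rewrite subrr mul0r.
  by rewrite ltr0_sgz ?subr_lt0.
by rewrite gtr0_sgz ?subr_gt0.
Qed.

(** An inversion is a negative factor of the Vandermonde product and a repetition a zero factor. The
    effect of a permutation on [sgnL] then follows from multiplicativity of determinants, without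
    counting inversions. *)
Lemma sgnL_Vandermonde n (D : 'I_n -> int) :
  sgnL [seq D i | i <- enum 'I_n] = sgz (\det (Vandermonde n (\row_i D i))).
Proof.
rewrite det_Vandermonde.
elim: n D => [|n IH] D.
  by rewrite big_ord0 enum_ord0 /= /sgnL /= big_ord0.
rewrite big_ord_recl /= sgzM enum_ordSl /= sgnL_cons -map_comp.
have := sgz_prod_sub (D ord0) [seq (D \o lift ord0) i | i <- enum 'I_n].
rewrite big_map big_enum /= => e.
have -> : \prod_(j < n.+1 | (0 < j)%N) ((\row_i D i) 0 j - (\row_i D i) 0 ord0) =
          \prod_(i < n) (D (lift ord0 i) - D ord0).
  rewrite big_mkcond big_ord_recl /= mul1r; apply: eq_bigr => i _.
  by rewrite !mxE.
rewrite e; case: ifP => _; first by rewrite mul0r.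
rewrite IH; congr (_ * sgz _); apply: eq_bigr => i _.
rewrite [RHS]big_mkcond big_ord_recl /= mul1r -big_mkcond /=.
by apply: eq_bigr => j _; rewrite !mxE.
Qed.

Lemma sgnL_increasing n (D : 'I_n -> int) :
  {homo D : i j / (i < j)%N >-> i < j} -> sgnL [seq D i | i <- enum 'I_n] = 1.
Proof.
move=> incD; rewrite sgnL_Vandermonde det_Vandermonde gtr0_sgz //.
apply: prodr_gt0 => i _; apply: prodr_gt0 => j ij.
by rewrite !mxE subr_gt0 incD.
Qed.

Lemma sgnL_perm n (D : 'I_n -> int) (s : {perm 'I_n}) :
  sgnL [seq D (s i) | i <- enum 'I_n] = (-1) ^+ s * sgnL [seq D i | i <- enum 'I_n].
Proof.
rewrite !sgnL_Vandermonde.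
have -> : Vandermonde n (\row_i D (s i)) = Vandermonde n (\row_i D i) *m perm_mx s^-1.
  by rewrite -col_permE; apply/matrixP => i j; rewrite !mxE.
rewrite det_mulmx det_perm sgzM mulrC odd_permV; congr (_ * _).
by case: (odd_perm s).
Qed.

Section AlternatingDet.
Variable R : comNzRingType.
Implicit Types (phi : seq int -> R) (fs : seq (int -> R)).

Lemma pairing_ord n fs (E : 'I_n -> int) : size fs = n ->
  pairing fs [seq E i | i <- enum 'I_n] = \prod_(i < n) nth (fun=> 0) fs i (E i).
Proof.
move=> sfs; rewrite /pairing (big_nth (fun=> 0, 0)) size_zip size_map size_enum_ord.
rewrite sfs minnn big_mkord; apply: eq_bigr => i _.
rewrite nth_zip; last by rewrite size_map size_enum_ord.
by rewrite (nth_map i) ?size_enum_ord // nth_ord_enum.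
Qed.

(** By alternation each rearrangement contributes the value at the increasing tuple times a sign,
    and what remains is the Leibniz expansion of the minor with columns [D]. *)
Lemma sum_permutations_det n (D : 'I_n -> int) phi fs :
    {homo D : i j / (i < j)%N >-> i < j} -> adjalt n phi -> size fs = n ->
  \sum_(L <- permutations [seq D i | i <- enum 'I_n]) phi L * pairing fs L =
  phi [seq D i | i <- enum 'I_n] *
    \det (\matrix_(i < n, j < n) nth (fun=> 0) fs i (D j)).
Proof.
move=> incD alt sfs; set D0 := [seq D i | i <- _].
have injD : injective D.
  by move=> i j eD; apply: val_inj; case: (ltngtP i j) => // /incD; rewrite eD ltxx.
have uD0 : uniq D0 by rewrite map_inj_uniq ?enum_uniq.
have szD0 : size D0 = n by rewrite size_map size_enum_ord.
have permD (s : 'S_n) : perm_eq [seq D (s i) | i <- enum 'I_n] D0.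
  rewrite -[D0]/(tval [tuple D i | i < n]); apply/tuple_permP; exists s.
  by apply: eq_map => i; rewrite tnth_mktuple.
have -> : \sum_(L <- permutations D0) phi L * pairing fs L =
    \sum_(s : 'S_n) phi [seq D (s i) | i <- enum 'I_n] *
       pairing fs [seq D (s i) | i <- enum 'I_n].
  rewrite -big_enum /= -(big_map (fun s : 'S_n => [seq D (s i) | i <- enum 'I_n])
     xpredT (fun L => phi L * pairing fs L)).
  apply: perm_big; apply: uniq_perm; first exact: permutations_uniq.
    rewrite map_inj_uniq ?enum_uniq // => s t /eq_in_map eq_st.
    by apply/permP => i; apply/injD/eq_st; rewrite mem_enum.
  move=> L; rewrite mem_permutations; apply/idP/mapP => [|[s _ ->]]; last exact: permD.
  rewrite -[D0]/(tval [tuple D i | i < n]) => /tuple_permP[s ->].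
  exists s; first by rewrite mem_enum.
  by apply: eq_map => i; rewrite tnth_mktuple.
rewrite /determinant mulr_sumr; apply: eq_bigr => s _.
set Ls := [seq D (s i) | i <- _].
have uLs : uniq Ls by rewrite map_inj_uniq ?enum_uniq // => i j /injD /perm_inj.
have szL : size Ls = n by rewrite size_map size_enum_ord.
have sD : sorted <=%R D0.
  apply: (@homo_sorted_in _ _ predT D (fun i j => i < j)%N); first 2 last.
  - by have := iota_ltn_sorted 0 n; rewrite -val_enum_ord sorted_map.
  - by move=> i j _ _ /incD/ltW.
  by apply/allP.
rewrite adjalt_sort ?szL // sgnL_perm sgnL_increasing // mulr1.
have -> : sort <=%R Ls = D0.
  apply: (sorted_eq le_trans le_anti) => //; first by apply: sort_sorted; exact: le_total.
  by rewrite perm_sort; exact: permD.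
rewrite rmorphXn /= rmorphN1 mulrAC mulrC; congr (_ * (_ * _)).
by rewrite pairing_ord //; apply: eq_bigr => i _; rewrite mxE.
Qed.
End AlternatingDet.

(** * Change of basis and Plucker relations for alternating extensions *)

Section MultilinearAlternating.
Variables (R : comNzRingType) (rg : seq int).
Hypothesis two0 : forall y : R, y = - y -> y = 0.
Implicit Types (phi : seq int -> R) (fs gs : seq (int -> R)).

Lemma mlext_repeat n phi A f B D : adjalt n phi ->
  size (A ++ f :: B ++ f :: D) = n -> mlext rg phi (A ++ f :: B ++ f :: D) = 0.
Proof. by move=> alt; apply: adjalt_repeat two0 _; apply: adjalt_mlext. Qed.

(** There are as many slots as indices, so an index sequence without repetition is a permutation of
    [bs]; sequences with a repetition contribute 0. *)
Lemma mlext_permutations (bs : seq int) n (phi : seq int -> R) fs :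
    adjalt n phi -> size fs = n -> size bs = n -> uniq bs ->
  mlext bs phi fs = \sum_(L <- permutations bs) phi L * pairing fs L.
Proof.
move=> alt sfs sbs ubs; rewrite mlext_allseqs (bigID uniq) /= [X in _ + X]big_seq_cond.
rewrite [X in _ + X]big1 ?addr0 => [|L]; last first.
  rewrite mem_allseqs => /andP[/andP[/eqP sL _] nuL].
  by rewrite (adjalt_nuniq two0 alt) ?mul0r ?sL.
rewrite -big_filter; apply: perm_big; apply: uniq_perm.
- by rewrite filter_uniq ?allseqs_uniq.
- exact: permutations_uniq.
move=> L; rewrite mem_filter mem_allseqs mem_permutations.
apply/and3P/idP => [[uL /eqP sL /allP subL]|pL].
  rewrite uniq_perm //.
  by apply: (uniq_min_size uL subL _).2; rewrite sL sfs sbs.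
split; first by rewrite (perm_uniq pL).
  by rewrite (perm_size pL) sbs sfs.
by apply/allP => p; rewrite (perm_mem pL).
Qed.

(** The determinant law in top degree: n covectors that are combinations of n given ones. The tensor
    [s |-> mlext rg phi (map g s)] is again alternating, so the Leibniz sum applies to it over
    [bs]. *)
Lemma mlext_det n (D : 'I_n -> int) phi (Ms : seq (int -> R)) (g : int -> int -> R) :
    {homo D : i j / (i < j)%N >-> i < j} -> adjalt n phi -> size Ms = n ->
  let bs := [seq D i | i <- enum 'I_n] in
  mlext rg phi [seq (fun p => \sum_(b <- bs) M b * g b p) | M : int -> R <- Ms] =
  \det (\matrix_(i < n, j < n) nth (fun=> 0) Ms i (D j)) * mlext rg phi (map g bs).
Proof.
move=> incD alt sMs bs; rewrite mlext_lincomb.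
have altg : adjalt n (fun s => mlext rg phi (map g s)).
  move=> A p q B sz; rewrite !map_cat; apply: (@adjalt_mlext _ rg n) => //.
  by rewrite -sz !size_cat /= !size_map.
have injD : injective D.
  by move=> i j eD; apply: val_inj; case: (ltngtP i j) => // /incD; rewrite eD ltxx.
rewrite (mlext_permutations altg) //; first last.
- by rewrite map_inj_uniq ?enum_uniq.
- by rewrite size_map size_enum_ord.
by rewrite (sum_permutations_det incD altg) // mulrC.
Qed.

Lemma mlext_rcons phi fs f :
  mlext rg phi (rcons fs f) =
  mlext rg (fun I => \sum_(p <- rg) f p * phi (rcons I p)) fs.
Proof.
rewrite -cats1 mlext_cat; apply: eq_mlext => L _ _ /=.
by apply: eq_bigr => p _; rewrite cats1.
Qed.

Lemma mlext_rem_at (a : int -> R) (b : seq int -> R) gs j : (j < size gs)%N ->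
  (\sum_(p <- rg) nth (fun=> 0) gs j p * a p) * mlext rg b (rem_at j gs) =
  mlext rg (fun J => a (nth 0 J j) * b (rem_at j J)) gs.
Proof.
elim: gs j b => [|g gs IH] [|j] b //= sj.
  rewrite mulr_suml; apply: eq_bigr => p _; rewrite -mulrA -mlextZ; congr (_ * _).
  by rewrite /rem_at /= drop0; apply: eq_mlext => L _ _; rewrite /= drop0.
rewrite /rem_at /= -/(rem_at j gs) mulr_sumr; apply: eq_bigr => p _.
by rewrite mulrCA IH.
Qed.

(** Each term is linear in every slot of I and of J separately, so the sum is the extension, first
    in J and then in I, of the relation between basis indices. *)
Lemma mlext_plucker phi fs gs :
    (forall I J, size I = size fs -> size J = size gs ->
       {subset I <= rg} -> {subset J <= rg} ->
       \sum_(j <- iota 0 (size J)) (-1) ^+ j.+1 *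
         phi (rcons I (nth 0 J j)) * phi (rem_at j J) = 0) ->
  \sum_(j <- iota 0 (size gs)) (-1) ^+ j.+1 *
    mlext rg phi (rcons fs (nth (fun=> 0) gs j)) * mlext rg phi (rem_at j gs) = 0.
Proof.
move=> pl; rewrite -[RHS](mlext0 rg fs).
under eq_big_seq => j.
  rewrite mem_iota => /andP[_ sj]; rewrite mlext_rcons -mulrA -mlextZr.
  rewrite (eq_mlext (psi := fun I => mlext rg
     (fun J => phi (rcons I (nth 0 J j)) * phi (rem_at j J)) gs)); last first.
    by move=> I _ _; rewrite mlext_rem_at.
  rewrite -mlextZ.
  over.
rewrite -mlext_sum; apply: eq_mlext => I sI subI.
under eq_bigr => j _ do rewrite -mlextZ.
rewrite -mlext_sum -[RHS](mlext0 rg gs); apply: eq_mlext => J sJ subJ.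
rewrite -[RHS](pl I J sI sJ subI subJ) sJ; apply: eq_bigr => j _.
by rewrite mulrA.
Qed.

End MultilinearAlternating.

(** * Partitions and Maya diagrams *)

Lemma is_partition_cons p r :
  is_partition (p :: r) = [&& (0 < p)%N, all (fun x => x <= p)%N r & is_partition r].
Proof.
rewrite /is_partition /= (path_sortedE (rev_trans leq_trans)).
by case: (0 < p)%N; case: (sorted _ r); case: (all _ r); rewrite ?andbT ?andbF.
Qed.

Lemma mem_parts_aux fuel m d l : (d <= fuel)%N ->
  (l \in parts_aux fuel m d) =
  [&& is_partition l, all (fun x => x <= m)%N l & sumn l == d].
Proof.
elim: fuel m d l => [|fuel IH] m d l /= led.
  move: led; rewrite leqn0 => /eqP -> /=; case: l => [|p r] //=.
  by rewrite is_partition_cons inE; apply/esym/negbTE; lia.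
have [->|nd0] := eqVneq d 0%N.
  case: l => [|p r] //=.
  by rewrite is_partition_cons inE; apply/esym/negbTE; lia.
case: l => [|p r] /=.
  rewrite [RHS]eq_sym (negbTE nd0); apply/negbTE/negP.
  by case/flatten_mapP => p _ /mapP[].
rewrite is_partition_cons; apply/flatten_mapP/idP.
  case=> q; rewrite mem_iota => qle /mapP[r' + [-> ->]].
  rewrite IH; last by lia.
  move=> /and3P[pr ar /eqP sr]; rewrite pr ar /=.
  have -> : all (fun x => x <= m)%N r'.
    by apply/allP => x /(allP ar) /= xq; lia.
  by rewrite sr; lia.
case/and3P => /and3P[p0 ar pr] /andP[pm _] /eqP sr.
exists p; first by rewrite mem_iota; lia.
by apply/mapP; exists r => //; rewrite IH ?pr ?ar //=; lia.
Qed.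

Lemma uniq_parts_aux fuel m d : uniq (parts_aux fuel m d).
Proof.
elim: fuel m d => [|fuel IH] m d /=; first by case: ifP.
case: ifP => // _.
apply: allpairs_uniq_dep => [||]; first exact: iota_uniq.
  by move=> p _; exact: IH.
by move=> [p r] [p' r'] _ _ /= [-> ->].
Qed.

Lemma mem_partsn d l : (l \in partsn d) = is_partition l && (sumn l == d).
Proof.
rewrite mem_parts_aux //; case: (is_partition l) => //=.
case: eqP => [<-|]; last by rewrite andbF.
rewrite andbT; apply/allP => x; elim: l => //= y l IH; rewrite inE.
by case/orP => [/eqP->|/IH]; lia.
Qed.

Lemma uniq_partsn d : uniq (partsn d).
Proof. exact: uniq_parts_aux. Qed.

Lemma sumn_leq_mul (l : seq nat) k m : (size l <= k)%N -> all (fun x => x <= m)%N l ->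
  (sumn l <= k * m)%N.
Proof.
elim: l k => [|x l IH] [|k] //= sl /andP[xm al].
by rewrite mulSn leq_add // IH.
Qed.

Lemma mem_box k l :
  (l \in box k) = [&& is_partition l, (size l <= k)%N & all (fun x => x <= k)%N l].
Proof.
rewrite /box mem_filter; apply/andP/and3P => [[/andP[sl al]]|[pl sl al]].
  by case/flatten_mapP => d _; rewrite mem_partsn => /andP[].
split; first by rewrite sl.
apply/flatten_mapP; exists (sumn l); last by rewrite mem_partsn pl eqxx.
by rewrite mem_iota /= add0n ltnS sumn_leq_mul.
Qed.

Lemma uniq_box k : uniq (box k).
Proof.
apply: filter_uniq.
have -> : flatten [seq partsn d | d <- iota 0 (k * k).+1] =
          [seq l | d <- iota 0 (k * k).+1, l <- partsn d].
  by congr flatten; apply: eq_map => d; rewrite map_id.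
apply: allpairs_uniq_dep => [||]; first exact: iota_uniq.
  by move=> d _; exact: uniq_partsn.
move=> [d l] [d' l'] /allpairsPdep[d1 [l1 [_ + [-> ->]]]].
rewrite mem_partsn => /andP[_ /eqP s1].
move=> /allpairsPdep[d2 [l2 [_ + [-> ->]]]].
rewrite mem_partsn => /andP[_ /eqP s2] /= e12.
by move: s1 s2; rewrite e12 => -> ->.
Qed.

Lemma nth_filter_pos (xs : seq nat) a : sorted geq xs ->
  nth 0%N [seq x <- xs | 0 < x]%N a = nth 0%N xs a.
Proof.
elim: xs a => //= x xs IH a; rewrite (path_sortedE (rev_trans leq_trans)) => /andP[ax sx].
case: ifP => x0; first by case: a => //= a; exact: IH.
have z0 y : y \in xs -> y = 0%N by move=> /(allP ax) /=; lia.
have -> : [seq y <- xs | 0 < y]%N = [::].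
  by apply/eqP; rewrite -[_ == _]negbK -has_filter; apply/hasPn => y /z0 ->.
have {}x0 : x = 0%N by lia.
rewrite nth_nil; case: a => //= a.
have [sa|sa] := ltnP a (size xs); last by rewrite nth_default.
by rewrite (z0 _ (mem_nth _ sa)).
Qed.

Lemma partition_eq l1 l2 : is_partition l1 -> is_partition l2 ->
  nth 0%N l1 =1 nth 0%N l2 -> l1 = l2.
Proof.
elim: l1 l2 => [|x l1 IH] [|y l2] //.
- by rewrite is_partition_cons => _ /and3P[y0 _ _] /(_ 0%N) /=; lia.
- by rewrite is_partition_cons => /and3P[y0 _ _] _ /(_ 0%N) /=; lia.
rewrite !is_partition_cons => /and3P[_ _ p1] /and3P[_ _ p2] e12.
by rewrite (e12 0%N : x = y) (IH l2) // => a; exact: (e12 a.+1).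
Qed.

Lemma partition_nth_leq l i j : is_partition l -> (i <= j)%N ->
  (nth 0%N l j <= nth 0%N l i)%N.
Proof.
move=> /andP[sl _] ij; have [sj|sj] := ltnP j (size l); last by rewrite nth_default.
by apply: (sorted_leq_nth (rev_trans leq_trans) leqnn) => //; rewrite inE; lia.
Qed.

Lemma size_lag_vec k lam : size (lag_vec k lam) = k.
Proof. by rewrite size_map size_iota. Qed.

Lemma nth_lag_vec k lam a : (a < k)%N ->
  nth 0 (lag_vec k lam) a = (nth 0%N lam a)%:Z - (a.+1)%:Z.
Proof. by move=> ak; rewrite (nth_map 0%N) ?size_iota // nth_iota. Qed.

Definition sdec (L : seq int) := sorted (fun a b : int => b < a) L.

Lemma sdec_nth L i j : sdec L -> (i < j)%N -> (j < size L)%N -> nth 0 L j < nth 0 L i.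
Proof.
move=> sL ij sj; have tr : transitive (fun a b : int => b < a).
  by move=> a b c /= ab bc; exact: lt_trans bc ab.
by apply: (sorted_ltn_nth tr 0 sL) => //; rewrite inE; exact: ltn_trans sj.
Qed.

Lemma sdec_uniq L : sdec L -> uniq L.
Proof.
apply: sorted_uniq; first by move=> a b c /= ab bc; exact: lt_trans bc ab.
by move=> a; rewrite ltxx.
Qed.

Lemma sdec_lag_vec k lam : is_partition lam -> sdec (lag_vec k lam).
Proof.
move=> pl; apply/(path.sortedP 0) => i; rewrite size_lag_vec => ik.
rewrite !nth_lag_vec //; last by lia.
by have := partition_nth_leq pl (leqnSn i); lia.
Qed.

Lemma mem_window W p : (p \in window W) = (- W%:Z <= p < W%:Z).
Proof.
apply/mapP/idP => [[a + ->]|pW]; first by rewrite mem_iota /=; lia.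
by exists (absz (p + W%:Z)); rewrite ?mem_iota; lia.
Qed.

Lemma uniq_window W : uniq (window W).
Proof. by rewrite map_inj_uniq ?iota_uniq // => a b; lia. Qed.

Lemma big_window_sub (T : Type) (idx : T) (op : Monoid.com_law idx) k N (G : int -> T) :
    (k <= N)%N -> {in window N, forall a, a \notin window k -> G a = idx} ->
  \big[op/idx]_(a <- window N) G a = \big[op/idx]_(a <- window k) G a.
Proof.
move=> kN G0; rewrite (bigID (mem (window k))) /= [X in op _ X]big_seq_cond.
rewrite [X in op _ X]big1 ?Monoid.mulm1 => [|a /andP[aN ak]]; last exact: G0.
rewrite -big_filter; apply: perm_big.
apply: uniq_perm; rewrite ?filter_uniq ?uniq_window // => a.
by rewrite mem_filter !mem_window; lia.
Qed.

Lemma lag_vec_window k lam : lam \in box k -> {subset lag_vec k lam <= window k}.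
Proof.
rewrite mem_box => /and3P[_ sl al] p /mapP[a]; rewrite mem_iota => ak ->.
rewrite mem_window.
have : (nth 0%N lam a <= k)%N.
  have [sa|sa] := ltnP a (size lam); last by rewrite nth_default.
  exact: (allP al _ (mem_nth _ sa)).
by lia.
Qed.

Lemma perm_sdec L : uniq L -> sdec (rev (sort <=%R L)).
Proof.
move=> uL; rewrite /sdec rev_sorted sort_lt_sorted //.
Qed.

Section LamL.
Variables (L : seq int) (k : nat).
Hypotheses (uL : uniq L) (sL : size L = k) (geL : {in L, forall p, - k%:Z <= p}).
Let S := rev (sort (fun a b : int => a <= b) L).
Let size_S : size S = k. Proof. by rewrite size_rev size_sort. Qed.

(** The entries decrease strictly and the last one is at least -k, whence the bound by descending
    induction. It makes the argument of [absz] in [lamL] nonnegative. *)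
Let S_ge a : (a < k)%N -> - (a.+1)%:Z <= nth 0 S a.
Proof.
have sdS : sdec S by exact: perm_sdec.
have [d] := ubnPleq (k - a.+1); elim: d a => [|d IH] a ka ak.
  have /geL : nth 0 S a \in L.
    by rewrite -(mem_sort (fun a b : int => a <= b)) -mem_rev mem_nth ?size_S.
  by lia.
have [ak1|ak1] := ltnP a.+1 k; last by apply: IH; lia.
have := sdec_nth sdS (ltnSn a); rewrite size_S => /(_ ak1).
have {}ka : (k - a.+2 <= d)%N by lia.
by have := IH a.+1 ka ak1; lia.
Qed.

Let xs := [seq absz (nth 0 (sort (fun a b : int => a <= b) L) (k - i) + (i%:Z)) | i <- iota 1 k].

Let xsE a : (a < k)%N -> (nth 0%N xs a)%:Z = nth 0 S a + (a.+1)%:Z.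
Proof.
move=> ak; rewrite (nth_map 0%N) ?size_iota // nth_iota // add1n.
rewrite -[nth 0 (sort _ _) _](_ : nth 0 S a = _).
  by have := S_ge ak; lia.
by rewrite nth_rev size_sort sL.
Qed.

Let xs_sorted : sorted geq xs.
Proof.
apply/(path.sortedP 0%N) => i; rewrite size_map size_iota => ik /=.
have sdS : sdec S by exact: perm_sdec.
have := @sdec_nth S i i.+1 sdS (ltnSn i); rewrite size_S => /(_ ik).
by have := xsE ik; have := @xsE i; lia.
Qed.

Lemma lamL_nth a : (a < k)%N -> (nth 0%N (lamL L) a)%:Z = nth 0 S a + (a.+1)%:Z.
Proof. by move=> ak; rewrite /lamL sL nth_filter_pos // xsE. Qed.

Lemma lag_vec_lamL : lag_vec k (lamL L) = S.
Proof.
apply: (@eq_from_nth _ 0) => [|a]; rewrite size_lag_vec ?size_S // => ak.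
by rewrite nth_lag_vec // lamL_nth //; lia.
Qed.

Lemma lamL_partition : is_partition (lamL L).
Proof.
rewrite /is_partition /lamL filter_all andbT sorted_filter ?sL //.
exact: rev_trans leq_trans.
Qed.

Lemma size_lamL : (size (lamL L) <= k)%N.
Proof. by rewrite /lamL size_filter (leq_trans (count_size _ _)) // size_map size_iota sL. Qed.

Lemma lamL_le m : {in L, forall p, p < m%:Z} -> all (fun x => x <= m)%N (lamL L).
Proof.
move=> ltL; apply/allP => x xl.
apply: (@leq_trans (nth 0%N (lamL L) 0)).
  move: xl; case: (lamL L) lamL_partition => // y l.
  by rewrite is_partition_cons inE => /and3P[_ /allP al _] /orP[/eqP->//|/al].
have k0 : (0 < k)%N.
  by move: xl (size_lamL); case: (lamL L) => // y l _; case: k.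
have /ltL : nth 0 S 0 \in L.
  by rewrite -(mem_sort (fun a b : int => a <= b)) -mem_rev mem_nth ?size_S.
by have := lamL_nth k0; lia.
Qed.
End LamL.

Lemma lamL_box k L : uniq L -> size L = k -> {subset L <= window k} -> lamL L \in box k.
Proof.
move=> uL sL subL.
have geL : {in L, forall p, - k%:Z <= p} by move=> p /subL; rewrite mem_window => /andP[].
rewrite mem_box (lamL_partition uL sL geL) (size_lamL sL) /=.
by apply: (lamL_le uL sL geL) => // p /subL; rewrite mem_window => /andP[].
Qed.

Lemma lag_vec_inj k : {in box k &, injective (lag_vec k)}.
Proof.
move=> l1 l2; rewrite !mem_box => /and3P[p1 s1 _] /and3P[p2 s2 _] e12.
apply: partition_eq => // a; have [ak|ak] := ltnP a k; last first.
  by rewrite !nth_default //; apply: leq_trans ak.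
have := congr1 (fun v : seq int => nth 0 v a) e12; rewrite !nth_lag_vec //.
by lia.
Qed.

Lemma perm_eq_sdec L1 L2 : sdec L1 -> sdec L2 -> perm_eq L1 L2 -> L1 = L2.
Proof.
apply: sorted_eq; first by move=> a b c /= ab bc; exact: lt_trans bc ab.
by move=> a b /andP[ab ba]; have := lt_trans ab ba; rewrite ltxx.
Qed.

Lemma lamL_perm_eq k lam L : lam \in box k -> perm_eq (lag_vec k lam) L -> lamL L = lam.
Proof.
move=> bl pL; have pl : is_partition lam by move: bl; rewrite mem_box => /and3P[].
have uv := sdec_uniq (sdec_lag_vec k pl).
have uL : uniq L by rewrite -(perm_uniq pL).
have sL : size L = k by rewrite -(perm_size pL) size_lag_vec.
have subL : {subset L <= window k}.
  by move=> p; rewrite -(perm_mem pL); exact: lag_vec_window.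
have geL : {in L, forall p, - k%:Z <= p} by move=> p /subL; rewrite mem_window => /andP[].
apply: (@lag_vec_inj k) => //; first exact: lamL_box.
rewrite lag_vec_lamL //; apply: perm_eq_sdec; [exact: perm_sdec|exact: sdec_lag_vec|].
by rewrite perm_rev perm_sort perm_sym.
Qed.

Lemma perm_lag_vec_lamL k L : uniq L -> size L = k -> {subset L <= window k} ->
  perm_eq (lag_vec k (lamL L)) L.
Proof.
move=> uL sL subL; rewrite lag_vec_lamL ?perm_rev ?perm_sort //.
by move=> p /subL; rewrite mem_window => /andP[].
Qed.

(** Repetition-free N-tuples of the window are grouped by their partition: each group consists of
    the rearrangements of one Maya diagram and yields one minor. *)
Lemma mlext_box (R : comNzRingType) N (phi : seq nat -> R) (fs : seq (int -> R)) :
  size fs = N ->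
  mlext (window N) (fun L => (sgnL L)%:~R * phi (lamL L)) fs =
  \sum_(lam <- box N) phi lam * \det (\matrix_(i < N, j < N)
     nth (fun=> 0) fs i ((nth 0%N lam (N - j.+1))%:Z - (N - j)%:Z)).
Proof.
move=> sfs; rewrite mlext_allseqs (bigID uniq) /= [X in _ + X]big1 ?addr0; last first.
  by move=> L nuL; rewrite sgnL_nuniq // !mul0r.
(* The Maya diagram [lag_vec N lam] read backwards, hence increasing and of sign 1. *)
pose D lam (j : 'I_N) := (nth 0%N lam (N - j.+1))%:Z - (N - j)%:Z.
have DE lam : [seq D lam j | j <- enum 'I_N] = rev (lag_vec N lam).
  apply: (@eq_from_nth _ 0) => [|a]; rewrite size_map size_enum_ord.
    by rewrite size_rev size_lag_vec.
  move=> aN; rewrite (nth_map (Ordinal aN)) ?size_enum_ord // nth_rev ?size_lag_vec //.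
  by rewrite nth_lag_vec ?(@nth_enum_ord _ (Ordinal aN)) /D ?nth_enum_ord //; lia.
have Dinc lam : lam \in box N -> {homo D lam : i j / (i < j)%N >-> i < j}.
  rewrite mem_box => /and3P[pl _ _] i j ij; rewrite /D.
  have := @partition_nth_leq lam (N - j.+1) (N - i.+1) pl.
  by have := ltn_ord j; lia.
have -> : \sum_(L <- allseqs (window N) (size fs) | uniq L)
      (sgnL L)%:~R * phi (lamL L) * pairing fs L =
    \sum_(L <- [seq L | lam <- box N,
                        L <- permutations [seq D lam j | j <- enum 'I_N]])
      (sgnL L)%:~R * phi (lamL L) * pairing fs L.
  rewrite -big_filter; apply: perm_big; apply: uniq_perm.
  - by rewrite filter_uniq ?allseqs_uniq ?uniq_window.
  - apply: allpairs_uniq_dep => [||]; first exact: uniq_box.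
      by move=> lam _; exact: permutations_uniq.
    move=> [l1 L1] [l2 L2] /allpairsPdep[a [b [al + [-> ->]]]].
    rewrite mem_permutations DE perm_sym => pab.
    move=> /allpairsPdep[c [d [cl + [-> ->]]]].
    rewrite mem_permutations DE perm_sym => pcd /= ebd.
    rewrite !perm_rev in pab pcd.
    by rewrite -(lamL_perm_eq al pab) -(lamL_perm_eq cl pcd) ebd.
  move=> L; rewrite mem_filter mem_allseqs sfs; apply/idP/allpairsPdep.
    case/and3P=> uL /eqP sL /allP subL; exists (lamL L), L; split=> //.
      exact: lamL_box.
    by rewrite mem_permutations DE perm_sym perm_rev perm_lag_vec_lamL.
  case=> lam [L' [bl + ->]]; rewrite mem_permutations DE => pL.
  have pl : is_partition lam by move: bl; rewrite mem_box => /and3P[].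
  rewrite (perm_uniq pL) rev_uniq (sdec_uniq (sdec_lag_vec _ pl)).
  rewrite (perm_size pL) size_rev size_lag_vec eqxx /=.
  by apply/allP => p; rewrite (perm_mem pL) mem_rev; exact: lag_vec_window.
rewrite big_allpairs_dep /=; apply: eq_big_seq => lam bl.
have pl : is_partition lam by move: bl; rewrite mem_box => /and3P[].
rewrite (@sum_permutations_det _ _ (D lam) (fun L => (sgnL L)%:~R * phi (lamL L))) //.
- rewrite sgnL_increasing ?mul1r; last exact: Dinc.
  by rewrite (lamL_perm_eq bl) // DE perm_sym perm_rev.
- exact: Dinc.
- exact: adjalt_sgnL.
Qed.

(** A decreasing predicate holds on an initial segment, whose length is the count. This reads off
    the Frobenius rank, the conjugate parts and, later, the number of window elements below a
    point. *)
Lemma count_initial (P : pred nat) n i : (forall j, P j.+1 -> P j) ->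
  (forall j, (n <= j)%N -> ~~ P j) ->
  (i < count P (iota 0 n))%N = P i.
Proof.
move=> dP; have dP' a b : (a <= b)%N -> P b -> P a.
  by move/subnK <-; elim: (b - a)%N => // c IH /dP.
elim: n => [|n IH] nP; first by rewrite (negbTE (nP i _)).
rewrite -(addn1 n) iotaD count_cat /= addn0.
case Pn: (P n); last first.
  rewrite addn0; apply: IH => j; rewrite leq_eqVlt => /orP[/eqP <-|]; last exact: nP.
  by rewrite Pn.
have -> : count P (iota 0 n) = n.
  rewrite -[RHS](size_iota 0); apply/eqP; rewrite -all_count; apply/allP => j.
  by rewrite mem_iota => jn; apply: dP' Pn; lia.
rewrite addn1 ltnS; apply/idP/idP => [/dP'->//|]; apply: contraLR; rewrite -ltnNge.
exact: nP.
Qed.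

Lemma ltn_frank lam i : is_partition lam -> (i < frank lam)%N = (i < nth 0%N lam i)%N.
Proof.
move=> pl; apply: count_initial => j.
  by have := partition_nth_leq pl (leqnSn j); lia.
by move=> sj; rewrite nth_default // -leqNgt.
Qed.

Lemma ltn_conjp lam i j : is_partition lam ->
  (i < conjp lam j.+1)%N = (j < nth 0%N lam i)%N.
Proof.
move=> pl; rewrite /conjp -{1}(mkseq_nth 0%N lam) /mkseq count_map.
apply: (@count_initial (fun i => j < nth 0 lam i)%N) => a.
  by have := partition_nth_leq pl (leqnSn a); lia.
by move=> sa; rewrite nth_default.
Qed.

Lemma mem_lag_vec k lam p :
  reflect (exists2 i, (i < k)%N & p = (nth 0%N lam i)%:Z - i.+1%:Z) (p \in lag_vec k lam).
Proof.
apply: (iffP mapP) => -[a]; first by rewrite mem_iota => ak ->; exists a.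
by move=> ak ->; exists a; rewrite ?mem_iota.
Qed.

(** The first Frobenius coordinates are the occupied nonnegative positions of the Maya diagram: row
    i meets the diagonal exactly when lambda_i - i >= 0. *)
Lemma count_frob_a k lam p : is_partition lam -> (size lam <= k)%N ->
  count (fun a => a == p) (frob_a lam) = (0 <= p) && (p \in lag_vec k lam).
Proof.
move=> pl sl; rewrite (count_uniq_mem p (_ : uniq (frob_a lam))); last first.
  rewrite map_inj_in_uniq ?iota_uniq // => i j _ _.
  by have := @partition_nth_leq lam i j pl; have := @partition_nth_leq lam j i pl; lia.
congr (nat_of_bool _); apply/mapP/andP => [[i ]|[p0 /mem_lag_vec[i ik pE]]].
  rewrite mem_iota add0n ltn_frank // => /andP[_ ri] ->; split; first by lia.
  apply/mem_lag_vec; exists i => //; apply: leq_trans sl.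
  by rewrite ltnNge; apply/negP => si; rewrite nth_default in ri.
by exists i => //; rewrite mem_iota /= add0n ltn_frank //; lia.
Qed.

(** The numbers -b - 1 are the holes at negative positions. The bound -k comes from the conjugate
    parts being at most k. *)
Lemma count_frob_b k lam p : is_partition lam -> (size lam <= k)%N ->
  count (fun b => - b - 1 == p) (frob_b lam) =
  [&& - k%:Z <= p, p < 0 & p \notin lag_vec k lam].
Proof.
move=> pl sl.
have conj_le i j : (i <= j)%N -> (conjp lam j.+1 <= conjp lam i.+1)%N.
  by move=> ij; apply: sub_count => x /=; lia.
have conj_k j : (conjp lam j.+1 <= k)%N by rewrite (leq_trans (count_size _ _)).
(* This is -b - 1 for b = lambda'_(j+1) - (j+1). *)
pose h (j : nat) : int := j%:Z - (conjp lam j.+1)%:Z.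
have hinj : injective h.
  by move=> i j; rewrite /h; have := conj_le i j; have := conj_le j i; lia.
have -> : count (fun b => - b - 1 == p) (frob_b lam) =
          count (fun a => a == p) [seq h j | j <- iota 0 (frank lam)].
  rewrite /frob_b !count_map; apply: eq_count => j /=; congr (_ == p).
  by rewrite /h; lia.
rewrite (count_uniq_mem p (_ : uniq [seq h j | j <- _])); last first.
  by rewrite map_inj_uniq ?iota_uniq.
congr (nat_of_bool _); apply/mapP/and3P => [[j]|[pk p0 pv]].
  rewrite mem_iota add0n ltn_frank // => /andP[_ rj] ->; rewrite /h.
  split; first by have := conj_k j; lia.
    by rewrite -ltn_conjp // in rj; lia.
  apply/mem_lag_vec => -[i ik].
  have [lt|ge] := ltnP i (conjp lam j.+1).
    by have := lt; rewrite ltn_conjp //; lia.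
  by have := ltn_conjp i j pl; lia.
(* the hole p is the boundary step below the rows with lam_i - i - 1 > p *)
pose P i := (p < (nth 0%N lam i)%:Z - i.+1%:Z) && (i < k)%N.
pose c := count P (iota 0 k).
have cP i : (i < c)%N = P i.
  apply: count_initial => j; last by rewrite /P; lia.
  by have := partition_nth_leq pl (leqnSn j); rewrite /P; lia.
have ck : (c <= k)%N by rewrite -(size_iota 0 k) count_size.
have pE i : (c <= i)%N -> (i < k)%N -> (nth 0%N lam i)%:Z - i.+1%:Z < p.
  move=> ci ik; have := cP i; rewrite /P ik andbT ltnNge ci /= => /esym/negbT.
  rewrite -leNgt le_eqVlt => /orP[/eqP e|//].
  by case/negP: pv; apply/mem_lag_vec; exists i.
have j0 : 0 <= p + c%:Z.
  have [ck'|ck'] := ltnP c k; first by have := pE c (leqnn c) ck'; lia.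
  by lia.
have [j jE] : exists j : nat, j%:Z = p + c%:Z by exists (absz (p + c%:Z)); lia.
have le1 : ~~ (c < conjp lam j.+1)%N.
  rewrite ltn_conjp //; have [ck'|ck'] := ltnP c k.
    by have := pE c (leqnn c) ck'; lia.
  by rewrite nth_default //; exact: leq_trans ck'.
have le2 : ~~ (conjp lam j.+1 < c)%N.
  apply/negP => lt; have c1 : (c.-1 < c)%N by lia.
  have := ltn_conjp c.-1 j pl.
  by have := cP c.-1; rewrite c1 /P => /esym/andP[]; lia.
have cj : conjp lam j.+1 = c by lia.
exists j; last by rewrite /h cj; lia.
by rewrite mem_iota add0n ltn_frank //= -ltn_conjp // cj; lia.
Qed.

(** A position of [-k, 0) is either in L or a hole, so removing the holes amounts to removing the
    whole interval and putting back the negative members of L. *)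
Lemma shiftn_lamL n k L p : uniq L -> size L = k -> {in L, forall p, - k%:Z <= p} ->
  shiftn n (lamL L) p = n p - ((- k%:Z <= p) && (p < 0))%:Z + (p \in L)%:Z.
Proof.
move=> uL sL geL; rewrite /shiftn.
have [pl sl] := (lamL_partition uL sL geL, size_lamL sL).
rewrite (count_frob_a _ pl sl) (count_frob_b _ pl sl).
rewrite lag_vec_lamL // mem_rev mem_sort.
by have := geL p; case: (p \in L) => [/(_ isT)|_]; lia.
Qed.

(** * Lagrange relations *)

Lemma cat_rem_at (T : Type) (x0 : T) j s : (j < size s)%N ->
  s = take j s ++ nth x0 s j :: drop j.+1 s.
Proof. by move=> sj; rewrite -drop_nth // cat_take_drop. Qed.

Lemma perm_rem_at (T : eqType) (x0 : T) j s : (j < size s)%N ->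
  perm_eq (nth x0 s j :: rem_at j s) s.
Proof.
by move=> sj; rewrite [X in perm_eq _ X](cat_rem_at x0 sj) -[_ :: drop _ _]cat1s
  perm_sym perm_catCA.
Qed.

Lemma size_rem_at (T : Type) j (s : seq T) : (j < size s)%N -> size (rem_at j s) = (size s).-1.
Proof. by move=> sj; rewrite size_cat size_take sj size_drop; lia. Qed.

Lemma subseq_rem_at (T : eqType) j (s : seq T) : subseq (rem_at j s) s.
Proof.
rewrite -{2}(cat_take_drop j s) /rem_at cat_subseq // -add1n -drop_drop.
by rewrite drop1; case: (drop j s) => // x t; exact: subseq_cons.
Qed.

Lemma nth_rem_at (T : Type) (x0 : T) a b s : (a < b)%N -> (b < size s)%N ->
  nth x0 (rem_at b s) a = nth x0 s a.
Proof. by move=> ab sb; rewrite nth_cat size_take sb ab nth_take. Qed.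

Lemma perm_rem_at2 (T : eqType) (x0 : T) a b s : (a < b)%N -> (b < size s)%N ->
  perm_eq (nth x0 s a :: nth x0 s b :: rem_at a (rem_at b s)) s.
Proof.
move=> ab sb; rewrite -(nth_rem_at x0 ab sb); set w := rem_at b s.
have aw : (a < size w)%N by rewrite size_rem_at //; lia.
apply: perm_trans (perm_rem_at x0 sb).
apply: (@perm_trans _ (nth x0 s b :: nth x0 w a :: rem_at a w)).
  exact: (perm_eq_adj [::]).
by rewrite perm_cons perm_rem_at.
Qed.

Lemma sdec_subseq s t : subseq s t -> sdec t -> sdec s.
Proof. by apply: subseq_sorted => a b c /= ab bc; exact: lt_trans bc ab. Qed.

Lemma adjalt_front (R : comNzRingType) n (phi : seq int -> R) j s :
  adjalt n phi -> size s = n -> (j < n)%N ->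
  phi s = (-1) ^+ j * phi (nth 0 s j :: rem_at j s).
Proof.
move=> alt sn jn; have sj : (j < size s)%N by rewrite sn.
rewrite {1}(cat_rem_at 0 sj) (adjalt_move alt) -?(cat_rem_at 0 sj) //.
by rewrite size_take sj.
Qed.

Lemma sgnL_sdec v w : sdec v -> sdec w -> size v = size w -> sgnL v = sgnL w.
Proof.
move=> dv dw e; rewrite /sgnL !sdec_uniq // -e; congr (_ ^+ _).
apply: eq_bigr => a _; apply: eq_bigr => b _; case: ltnP => //= ab.
by rewrite !sdec_nth // -e.
Qed.

Section LagrangeSum.
Variables (R : comNzRingType) (k : nat) (phi : seq nat -> R) (M : seq int).
Let phit L : R := (sgnL L)%:~R * phi (lamL L).
(** All decreasing k-tuples have the same sign ([sgnL_sdec]); the empty partition serves as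
    representative. *)
Let eps : int := sgnL (lag_vec k [::]).

(** Bringing entry b and then entry a, by that time at position a + 1, to the front costs
    (-1)^(a+b+1): the sign in the contraction, up to the global factor -eps. *)
Let phi_move lam a b : lam \in box k -> (a < b)%N -> (b < k)%N ->
  let v := lag_vec k lam in
  phi lam = - eps%:~R * (-1) ^+ (a + b) *
    phit (nth 0 v a :: nth 0 v b :: rem_at a (rem_at b v)).
Proof.
move=> bl ab bk v; have pl : is_partition lam by move: bl; rewrite mem_box => /and3P[].
have sv : size v = k by exact: size_lag_vec.
have -> : phi lam = eps%:~R * phit v.
  rewrite /phit (lamL_perm_eq bl) // mulrA -rmorphM.
  have -> : sgnL v = eps.
    by apply: sgnL_sdec; rewrite ?size_lag_vec //; exact: sdec_lag_vec.
  by rewrite sgnL_sqr ?mul1r ?sdec_uniq ?sdec_lag_vec.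
rewrite mulNr -mulrN -!mulrA; congr (_ * _).
have alt : adjalt k phit by exact: adjalt_sgnL.
rewrite (adjalt_front alt sv bk).
have sw : size (nth 0 v b :: rem_at b v) = k by rewrite /= size_rem_at sv //; lia.
have ak : (a.+1 < k)%N by lia.
rewrite (adjalt_front alt sw ak) /= nth_rem_at ?sv // mulrA -exprD.
rewrite -[rem_at a.+1 _]/(nth 0 v b :: rem_at a (rem_at b v)).
by rewrite addnS exprS addnC mulN1r mulNr.
Qed.

Hypotheses (k2 : (2 <= k)%N) (decM : sdec M) (sM : size M = k.-2).
Hypothesis subM : {subset M <= window k}.

Let pairs : seq (seq nat * (nat * nat)) :=
  [seq x <- [seq (lam, ab) | lam <- box k, ab <- [seq (a, b) | a <- iota 0 k, b <- iota 0 k]]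
  | (x.2.1 < x.2.2)%N && (rem_at x.2.1 (rem_at x.2.2 (lag_vec k x.1)) == M)].

Let h (x : seq nat * (nat * nat)) : int * int :=
  (nth 0 (lag_vec k x.1) x.2.1, nth 0 (lag_vec k x.1) x.2.2).

Let pairsP x : x \in pairs -> [/\ x.1 \in box k, (x.2.1 < x.2.2)%N, (x.2.2 < k)%N &
  rem_at x.2.1 (rem_at x.2.2 (lag_vec k x.1)) = M].
Proof.
case: x => lam [a b]; rewrite mem_filter => /andP[/andP[ab /eqP eM]].
move=> /allpairsPdep[lam' [ab' [bl + [lamE abE]]]]; rewrite -abE.
rewrite -lamE in bl.
by move=> /allpairsPdep[a' [b' [_ + [_ bE]]]]; rewrite mem_iota -bE => /andP[_ bk]; split.
Qed.

Let perm_h x : x \in pairs -> perm_eq (lag_vec k x.1) ((h x).1 :: (h x).2 :: M).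
Proof.
move=> /pairsP[bl ab bk <-]; rewrite perm_sym.
by apply: perm_rem_at2; rewrite ?size_lag_vec.
Qed.

(** The contributing triples (lambda, a, b) correspond to the pairs q < p outside M: lambda is the
    partition of [p :: q :: M], and a, b are the positions of p, q in its decreasing arrangement. *)
Lemma lagr_sum :
  \sum_(lam <- box k) (lagr_coef k M lam)%:~R * phi lam =
  - eps%:~R * \sum_(p <- window k) \sum_(q <- window k | q < p)
     (omega p q)%:~R * phit (p :: q :: M).
Proof.
pose G p q := (omega p q)%:~R * phit (p :: q :: M).
have -> : \sum_(p <- window k) \sum_(q <- window k | q < p) G p q =
   \sum_(x <- pairs) G (h x).1 (h x).2.
  (* Pairs that meet M are discarded, since [sgnL] vanishes there; they have no counterpart among
     the partitions. *)
  have -> : \sum_(p <- window k) \sum_(q <- window k | q < p) G p q =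
    \sum_(y <- [seq (p, q) | p <- window k, q <- window k] | (y.2 < y.1) && uniq (y.1 :: y.2 :: M)) G y.1 y.2.
    rewrite [RHS]big_mkcond big_allpairs_dep /=; apply: eq_bigr => p _.
    rewrite big_mkcond /=; apply: eq_bigr => q _; case: ifP => //= pq.
    by case: ifP => // /negbT nu; rewrite /G /phit sgnL_nuniq // mul0r mulr0.
  rewrite -big_filter -(big_map h xpredT (fun y => G y.1 y.2)).
  apply: perm_big; rewrite perm_sym; apply: uniq_perm.
  - rewrite map_inj_in_uniq.
      apply: filter_uniq; apply: allpairs_uniq; rewrite ?uniq_box //.
      by apply: allpairs_uniq; rewrite ?iota_uniq // => -[? ?] [? ?] _ _ [-> ->].
      by move=> [? ?] [? ?] _ _ [-> ->].
    move=> x y px py exy; have pvx := perm_h px; have pvy := perm_h py.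
    have [bx abx bkx _] := pairsP px; have [by_ aby bky _] := pairsP py.
    have e1 : x.1 = y.1.
      by rewrite -(lamL_perm_eq bx pvx) -(lamL_perm_eq by_ pvy) exy.
    have uv : uniq (lag_vec k x.1).
      by apply/sdec_uniq/sdec_lag_vec; move: bx; rewrite mem_box => /and3P[].
    case: x y e1 exy {px py pvx pvy} uv bx abx bkx by_ aby bky
      => l1 [a1 b1] [l2 [a2 b2]] /= <- [/eqP ea /eqP eb] uv bx abx bkx by_ aby bky.
    move: ea eb; rewrite !nth_uniq ?size_lag_vec //; try lia.
    by move=> /eqP -> /eqP ->.
  - apply: filter_uniq; apply: allpairs_uniq; rewrite ?uniq_window //.
    by move=> [? ?] [? ?] _ _ [-> ->].
  move=> [p q]; rewrite mem_filter; apply/mapP/idP => [[x px pqE]|].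
    have [bx abx bkx _] := pairsP px; have pv := perm_h px.
    have dv : sdec (lag_vec k x.1).
      by apply: sdec_lag_vec; move: bx; rewrite mem_box => /and3P[].
    have := pv; rewrite -pqE /= => pv'.
    apply/andP; split; first (apply/andP; split).
    - by case: pqE => -> ->; rewrite sdec_nth ?size_lag_vec.
    - by have := perm_uniq pv'; rewrite sdec_uniq.
    rewrite pqE; apply/allpairsP; exists (h x); split=> //; apply: (lag_vec_window bx).
      by apply: mem_nth; rewrite size_lag_vec; exact: ltn_trans bkx.
    by apply: mem_nth; rewrite size_lag_vec.
  move=> /andP[/andP[qp u]] /allpairsP[[p' q'] [pw qw [pE qE]]].
  move: pw qw; rewrite -pE -qE => pw qw {p' q' pE qE}.
  set L := p :: q :: M; have uL : uniq L by [].
  have sL : size L = k by rewrite /= sM; lia.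
  have subL : {subset L <= window k}.
    by move=> r; rewrite !inE => /or3P[/eqP->|/eqP->|/subM].
  have bl := lamL_box uL sL subL; have pL := perm_lag_vec_lamL uL sL subL.
  have pl : is_partition (lamL L) by move: bl; rewrite mem_box => /and3P[].
  set v := lag_vec k (lamL L) in pL *; have dv : sdec v by exact: sdec_lag_vec.
  have sv : size v = k by exact: size_lag_vec.
  have pv : p \in v by rewrite (perm_mem pL) mem_head.
  have qv : q \in v by rewrite (perm_mem pL) inE mem_head orbT.
  have aE : nth 0 v (index p v) = p by exact: nth_index.
  have bE : nth 0 v (index q v) = q by exact: nth_index.
  have ak : (index p v < size v)%N by rewrite index_mem.
  have bk : (index q v < size v)%N by rewrite index_mem.
  have ab : (index p v < index q v)%N.
    case: ltngtP => // [/(fun x => sdec_nth dv x ak)|ab].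
      by rewrite aE bE => /(lt_trans qp); rewrite ltxx.
    by move: qp; rewrite -aE ab bE ltxx.
  exists (lamL L, (index p v, index q v)); last by rewrite /h /= aE bE.
  rewrite mem_filter; apply/andP; split; first (apply/andP; split=> //).
    apply/eqP/perm_eq_sdec => //.
      by apply: sdec_subseq dv; apply: subseq_trans (subseq_rem_at _ _) (subseq_rem_at _ _).
    have := perm_rem_at2 0 ab bk; rewrite aE bE => pv2.
    by have := perm_trans pv2 pL; rewrite !perm_cons.
  apply/allpairsPdep; exists (lamL L), (index p v, index q v); split=> //.
  by apply/allpairsPdep; exists (index p v), (index q v); rewrite !mem_iota -sv.
rewrite mulr_sumr [RHS]big_filter [RHS]big_mkcond [RHS]big_allpairs_dep /=.
apply: eq_big_seq => lam bl; rewrite big_allpairs_dep /=.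
rewrite /lagr_coef !rmorph_sum /= mulr_suml.
have -> : iota 0 k = index_iota 0 k by rewrite /index_iota subn0.
rewrite [RHS]big_mkord.
apply: eq_bigr => a _; rewrite rmorph_sum /= mulr_suml [RHS]big_mkord.
apply: eq_bigr => b _; case: ifP => [/andP[ab /eqP eM]|_]; last by rewrite mul0r.
rewrite {1}(phi_move bl ab (ltn_ord b)) eM /G !rmorphM rmorphXn rmorphN1 /=.
set e := (-1) ^+ (a + b); set X := (omega _ _)%:~R; set Y := phit _.
rewrite [LHS](_ : _ = (e * e) * (- eps%:~R * (X * Y))); last by ring.
by rewrite /e -exprD addnn -mul2n exprM sqrrN !expr1n mul1r.
Qed.
End LagrangeSum.

(** Deleting two entries of a decreasing k-tuple of the window leaves a decreasing (k-2)-tuple of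
    the window, so for any other M the relation is empty. *)
Lemma lagr_coef_eq0 k M lam : lam \in box k ->
  ~~ [&& sdec M, size M == k.-2 & all (mem (window k)) M] -> lagr_coef k M lam = 0.
Proof.
move=> bl; apply: contraNeq => nz.
have pl : is_partition lam by move: bl; rewrite mem_box => /and3P[].
have [a nza] : exists a : 'I_k, \sum_(b < k)
    (if (a < b)%N && (rem_at a (rem_at b (lag_vec k lam)) == M)
     then (-1) ^+ (a + b) * omega (nth 0 (lag_vec k lam) a) (nth 0 (lag_vec k lam) b)
     else 0) != 0.
  apply/existsP; apply: contraR nz; rewrite negb_exists => /forallP z.
  by apply/eqP/big1 => a _; apply/eqP; rewrite -[_ == _]negbK.
have [b] : exists b : 'I_k, (a < b)%N && (rem_at a (rem_at b (lag_vec k lam)) == M).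
  apply/existsP; apply: contraR nza; rewrite negb_exists => /forallP z.
  by apply/eqP/big1 => b _; rewrite (negbTE (z b)).
case/andP => ab /eqP <-; set v := lag_vec k lam.
have sv : size v = k by exact: size_lag_vec.
have sub : subseq (rem_at a (rem_at b v)) v.
  exact: subseq_trans (subseq_rem_at _ _) (subseq_rem_at _ _).
rewrite (sdec_subseq sub) ?sdec_lag_vec //=; apply/andP; split.
  by rewrite !size_rem_at ?sv //; have := ltn_ord b; lia.
by apply/allP => p /(mem_subseq sub); exact: lag_vec_window.
Qed.

Lemma omega_swap p q : omega q p = - omega p q.
Proof.
rewrite /omega addrC; case: eqP => [e|_]; last by rewrite oppr0.
have -> : odd (absz q) = ~~ odd (absz p) by lia.
by case: (odd _); rewrite ?opprK.
Qed.

(** * Lagrange relations as contractions over all ordered pairs *)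

Section LagrangeSymmetric.
Variables (R : comNzRingType) (k : nat) (phi : seq nat -> R).
Hypothesis two0 : forall y : R, y = - y -> y = 0.
Let phit L : R := (sgnL L)%:~R * phi (lamL L).

(** Both [omega] and [phit] change sign when p and q are exchanged, so the summand is symmetric,
    with zero diagonal. *)
Lemma sum_omega_double M :
  \sum_(p <- window k) \sum_(q <- window k) (omega p q)%:~R * phit (p :: q :: M) =
  (\sum_(p <- window k) \sum_(q <- window k | q < p)
     (omega p q)%:~R * phit (p :: q :: M)) *+ 2.
Proof.
pose F p q := (omega p q)%:~R * phit (p :: q :: M).
have Fsym p q : F q p = F p q.
  rewrite /F omega_swap /phit -[q :: p :: M]cat0s sgnL_swap.
  rewrite (lamL_perm (perm_eq_adj [::] M q p)) /= !rmorphN /=; ring.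
have Fdiag p : F p p = 0.
  by rewrite /F /phit sgnL_nuniq ?mul0r ?mulr0 //= mem_head.
rewrite -!/(F _ _) mulr2n.
transitivity (\sum_(p <- window k) (\sum_(q <- window k | q < p) F p q +
                                    \sum_(q <- window k | p < q) F p q)).
  apply: eq_bigr => p _; rewrite (bigID (fun q => q < p)) /=; congr (_ + _).
  rewrite big_mkcond [RHS]big_mkcond; apply: eq_bigr => q _.
  by case: ltgtP => // ->; exact: Fdiag.
rewrite big_split /=; congr (_ + _).
under eq_bigr => p _ do rewrite big_mkcond.
rewrite exchange_big /=; apply: eq_bigr => q _; rewrite [RHS]big_mkcond.
by apply: eq_bigr => p _; rewrite Fsym.
Qed.

(** The full sum is alternating in L, so it is enough to know it on decreasing tuples, where it is
    twice a Lagrange relation up to sign. *)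
Lemma omega_sum_of_lagr :
    (2 <= k)%N ->
    (forall M, \sum_(lam <- box k) (lagr_coef k M lam)%:~R * phi lam = 0) ->
  forall L, size L = k.-2 -> {subset L <= window k} ->
  \sum_(p <- window k) \sum_(q <- window k) (omega p q)%:~R * phit (p :: q :: L) = 0.
Proof.
move=> k2 lagr0 L sL subL.
pose psi L : R := \sum_(p <- window k) \sum_(q <- window k) (omega p q)%:~R * phit (p :: q :: L).
have alt : adjalt k.-2 psi.
  move=> A p q B _; rewrite /psi -sumrN; apply: eq_bigr => r _.
  rewrite -sumrN; apply: eq_bigr => t _; rewrite -mulrN; congr (_ * _).
  exact: (@adjalt_sgnL _ _ phi [:: r, t & A] p q B erefl).
have [uL|nuL] := boolP (uniq L); last exact: (adjalt_nuniq two0 alt).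
set M := rev (sort <=%R L); have pM : perm_eq M L by rewrite perm_rev perm_sort.
have psiM : psi M = 0.
  rewrite /psi sum_omega_double.
  have := lagr0 M; rewrite lagr_sum //; last first.
  - by move=> p; rewrite (perm_mem pM); exact: subL.
  - by rewrite (perm_size pM).
  - exact: perm_sdec.
  move=> /(congr1 ( *%R (- (sgnL (lag_vec k [::]))%:~R))).
  rewrite mulr0 mulrA mulrNN -rmorphM sgnL_sqr ?mul1r => [->|]; first by rewrite mul0rn.
  by apply/sdec_uniq/sdec_lag_vec.
have uM : uniq M by rewrite (perm_uniq pM).
have sM : size M = k.-2 by rewrite (perm_size pM).
have eS : sort <=%R M = sort <=%R L.
  by apply/perm_sortP; [exact: le_total|exact: le_trans|exact: le_anti|].
rewrite -/(psi L) adjalt_sort ?sL // -eS.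
move: psiM; rewrite adjalt_sort ?sM // => /(congr1 ( *%R (sgnL M)%:~R)).
by rewrite mulr0 mulrA -rmorphM sgnL_sqr // mul1r => ->; rewrite mulr0.
Qed.

Lemma lagr_of_omega_sum :
    (2 <= k)%N ->
    (forall L, size L = k.-2 -> {subset L <= window k} ->
      \sum_(p <- window k) \sum_(q <- window k) (omega p q)%:~R * phit (p :: q :: L) = 0) ->
  forall M, \sum_(lam <- box k) (lagr_coef k M lam)%:~R * phi lam = 0.
Proof.
move=> k2 omega0 M.
have [/and3P[decM /eqP sM /allP subM]|bad] :=
  boolP [&& sdec M, size M == k.-2 & all (mem (window k)) M]; last first.
  by rewrite big_seq big1 // => lam bl; rewrite lagr_coef_eq0 // mul0r.
rewrite lagr_sum //; have := omega0 M sM subM; rewrite sum_omega_double mulr2n => /eqP.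
by rewrite addr_eq0 => /eqP /two0 ->; rewrite mulr0.
Qed.
End LagrangeSymmetric.

(** * Formal power series *)

Definition fps (R : Type) : Type := nat -> R.

Section FpsRing.
Variable R : comNzRingType.
Implicit Types f g h : fps R.

HB.instance Definition _ := gen_eqMixin (fps R).
HB.instance Definition _ := gen_choiceMixin (fps R).

Definition fps_add f g : fps R := fun n => f n + g n.
Definition fps_opp f : fps R := fun n => - f n.
Definition fps_zero : fps R := fun=> 0.
Definition fps_mul f g : fps R := fun n => \sum_(i < n.+1) f i * g (n - i)%N.
Definition fps_poly (p : {poly R}) : fps R := fun n => p`_n.

Fact fps_addA : associative fps_add.
Proof. by move=> f g h; apply/funext => n; exact: addrA. Qed.
Fact fps_addC : commutative fps_add.
Proof. by move=> f g; apply/funext => n; exact: addrC. Qed.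
Fact fps_add0 : left_id fps_zero fps_add.
Proof. by move=> f; apply/funext => n; exact: add0r. Qed.
Fact fps_addN : left_inverse fps_zero fps_opp fps_add.
Proof. by move=> f; apply/funext => n; exact: addNr. Qed.

HB.instance Definition _ :=
  GRing.isZmodule.Build (fps R) fps_addA fps_addC fps_add0 fps_addN.

Let trunc m f : {poly R} := \poly_(i < m) f i.

(** The coefficient of z^n involves only terms up to degree n, so the ring axioms are inherited from
    polynomials. *)
Let fps_mul_trunc m f g n : (n < m)%N -> fps_mul f g n = (trunc m f * trunc m g)`_n.
Proof.
move=> nm; rewrite coefM; apply: eq_bigr => i _.
by rewrite !coef_poly !(leq_ltn_trans _ nm) ?leq_subr // -ltnS.
Qed.

Fact fps_mulC : commutative fps_mul.
Proof. by move=> f g; apply/funext => n; rewrite !(@fps_mul_trunc n.+1) // mulrC. Qed.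

Fact fps_mulA : associative fps_mul.
Proof.
move=> f g h; apply/funext => n.
have mulE f' g' h' : fps_mul (fps_mul f' g') h' n =
    (trunc n.+1 f' * trunc n.+1 g' * trunc n.+1 h')`_n.
  rewrite coefM; apply: eq_bigr => i _.
  by rewrite (@fps_mul_trunc n.+1) // coef_poly ltnS leq_subr.
by rewrite fps_mulC !mulE mulrC mulrA.
Qed.

Fact fps_mul1 : left_id (fps_poly 1) fps_mul.
Proof.
move=> f; apply/funext => n; rewrite /fps_mul big_ord_recl /fps_poly coef1 mul1r subn0.
by rewrite big1 ?addr0 // => i _; rewrite coef1 mul0r.
Qed.

Fact fps_mulDl : left_distributive fps_mul fps_add.
Proof.
move=> f g h; apply/funext => n; rewrite /fps_mul /fps_add -big_split.
by apply: eq_bigr => i _; rewrite mulrDl.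
Qed.

Fact fps_1neq0 : fps_poly 1 != 0.
Proof.
apply/negP => /eqP /(congr1 (fun f : fps R => f 0%N)).
by rewrite /fps_poly coef1 => /eqP; rewrite oner_eq0.
Qed.

HB.instance Definition _ := GRing.Zmodule_isComNzRing.Build (fps R)
  fps_mulA fps_mulC fps_mul1 fps_mulDl fps_1neq0.

Lemma fpsP f g : f =1 g -> f = g. Proof. exact: funext. Qed.
Lemma fpsD f g n : (f + g) n = f n + g n. Proof. by []. Qed.
Lemma fpsN f n : (- f) n = - f n. Proof. by []. Qed.
Lemma fpsM f g n : (f * g) n = \sum_(i < n.+1) f i * g (n - i)%N. Proof. by []. Qed.
Lemma fps1 n : (1 : fps R) n = (n == 0%N)%:R. Proof. exact: coef1. Qed.
Fact fps_poly_is_zmod_morphism : zmod_morphism fps_poly.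
Proof. by move=> p q; apply/fpsP => n; rewrite /fps_poly coefB. Qed.
HB.instance Definition _ :=
  GRing.isZmodMorphism.Build {poly R} (fps R) fps_poly fps_poly_is_zmod_morphism.
Fact fps_poly_is_monoid_morphism : monoid_morphism fps_poly.
Proof. by split=> // p q; apply/fpsP => n; rewrite /fps_poly coefM. Qed.
HB.instance Definition _ :=
  GRing.isMonoidMorphism.Build {poly R} (fps R) fps_poly fps_poly_is_monoid_morphism.

Lemma fps_polyE p n : fps_poly p n = p`_n. Proof. by []. Qed.

Lemma fps_polyM p f n : (fps_poly p * f) n =
  \sum_(i < size p) if (i <= n)%N then p`_i * f (n - i)%N else 0.
Proof.
rewrite fpsM -(big_mkord xpredT (fun i => p`_i * f (n - i)%N)).
rewrite -(big_mkord xpredT (fun i => if (i <= n)%N then p`_i * f (n - i)%N else 0)).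
set m := (n.+1 + size p)%N.
rewrite (big_nat_widen _ _ m) ?leq_addr //= [RHS](big_nat_widen _ _ m) ?leq_addl //=.
rewrite big_mkcond [RHS]big_mkcond /=; apply: eq_bigr => i _; rewrite ltnS.
by case: (i <= n)%N; case: ltnP => // sp; rewrite nth_default // mul0r.
Qed.

Lemma fps_polyC_mul c f n : (fps_poly c%:P * f) n = c * f n.
Proof.
rewrite fps_polyM; have [->|c0] := eqVneq c 0; first by rewrite size_poly0 big_ord0 mul0r.
by rewrite size_polyC c0 big_ord1 /= coefC subn0.
Qed.

Lemma fps_Xn_mul j f n : (fps_poly 'X^j * f) n = if (j <= n)%N then f (n - j)%N else 0.
Proof.
rewrite fps_polyM size_polyXn big_ord_recr /= coefXn eqxx mul1r big1 ?add0r // => i _.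
by rewrite coefXn; case: eqP => [e|_]; [have := ltn_ord i; lia|rewrite mul0r if_same].
Qed.

(** The operator z d/dz, which avoids the index shift of the derivative; [fps_neg] below is f(z) |->
    f(-z). *)
Definition fps_euler f : fps R := fun n => n%:R * f n.
Definition fps_neg f : fps R := fun n => (-1) ^+ n * f n.

Lemma fps_eulerM f g : fps_euler (f * g) = fps_euler f * g + f * fps_euler g.
Proof.
apply/fpsP => n; rewrite fpsD !fpsM /fps_euler mulr_sumr -big_split /=.
apply: eq_bigr => i _; have : (i <= n)%N by have := ltn_ord i; lia.
by move: (nat_of_ord i) => j jn; rewrite -{1}(subnKC jn) natrD; ring.
Qed.

Lemma fps_negM f g : fps_neg (f * g) = fps_neg f * fps_neg g.
Proof.
apply/fpsP => n; rewrite fpsM /fps_neg fpsM mulr_sumr.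
apply: eq_bigr => i _; have : (i <= n)%N by have := ltn_ord i; lia.
by move: (nat_of_ord i) => j jn; rewrite -{1}(subnKC jn) exprD; ring.
Qed.

Lemma fps_neg_Xn j f : fps_neg (fps_poly 'X^j * f) = (-1) ^+ j * (fps_poly 'X^j * fps_neg f).
Proof.
rewrite fps_negM mulrA; congr (_ * _); apply/fpsP => n.
rewrite -(rmorphN1 fps_poly) -rmorphXn -rmorphM /= /fps_neg !fps_polyE.
have -> : (-1) ^+ j * 'X^j = (-1) ^+ j *: 'X^j :> {poly R}.
  by rewrite -mul_polyC rmorphXn rmorphN1.
rewrite coefZ coefXn.
by case: eqP => [->|_]; rewrite ?mulr0.
Qed.
End FpsRing.

(** * Exponentials as solutions of a first-order linear equation *)

Section FpsExp.
Variable F : fieldType.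
Hypothesis natF0 : forall k, k.+1%:R != 0 :> F.
Implicit Types (T : nat -> F) (f g D : fps F).

(** The recursion of [hlist] with field elements in place of series, so that [rep_hlist] can compare
    the two term by term. *)
Fixpoint explist T (k : nat) : seq F :=
  match k with
  | 0 => [:: 1]
  | k'.+1 => let l := explist T k' in
      rcons l (k%:R^-1 * \sum_(j <- iota 1 k) j%:R * (T j * nth 0 l (k - j)))
  end.

Definition fps_exp T : fps F := fun k => nth 0 (explist T k) k.

Lemma size_explist T k : size (explist T k) = k.+1.
Proof. by elim: k => //= k IH; rewrite size_rcons IH. Qed.

Lemma nth_explist T k i : (i <= k)%N -> nth 0 (explist T k) i = fps_exp T i.
Proof.
elim: k => [|k IH]; first by rewrite leqn0 => /eqP->.
rewrite leq_eqVlt => /orP[/eqP->//|ik].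
by rewrite /= nth_rcons size_explist ik IH.
Qed.

Definition fps_dlog T : fps F := fun j => j%:R * T j.

Lemma fps_exp0 T : fps_exp T 0%N = 1. Proof. by []. Qed.

Lemma fps_euler_exp T : fps_euler (fps_exp T) = fps_dlog T * fps_exp T.
Proof.
apply/fpsP => -[|k].
  by rewrite /fps_euler fpsM big_ord_recl big_ord0 /fps_dlog !mul0r add0r.
rewrite /fps_euler fpsM big_ord_recl /= /fps_dlog !mul0r add0r.
rewrite {1}/fps_exp [explist T k.+1]/(rcons _ _) nth_rcons size_explist ltnn eqxx.
rewrite mulrA divff // mul1r -[in iota 1](addn0 1%N) iotaDl big_map.
have -> : iota 0 k.+1 = index_iota 0 k.+1 by rewrite /index_iota subn0.
rewrite big_mkord; apply: eq_bigr => i _; rewrite /bump leq0n add1n -mulrA subSS.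
by rewrite nth_explist ?leq_subr.
Qed.

(** Since D has no constant term, the equation expresses n f_n through lower coefficients, and n is
    invertible for n > 0. The exponential identities below are proved by exhibiting a common
    equation. *)
Lemma fps_euler_unique D f g : D 0%N = 0 -> f 0%N = g 0%N ->
  fps_euler f = D * f -> fps_euler g = D * g -> f = g.
Proof.
move=> D0 fg0 ef eg; apply/fpsP => n; have [m] := ubnP n; elim: m n => // m IH [|n] // nm.
apply: (mulfI (natF0 n)).
rewrite -[LHS]/(fps_euler f n.+1) -[RHS]/(fps_euler g n.+1) ef eg !fpsM.
apply: eq_bigr => -[[|i] ilt] _ /=; first by rewrite D0 !mul0r.
by rewrite IH //; lia.
Qed.

Lemma eq_fps_exp T T' : (forall j, (0 < j)%N -> T j = T' j) -> fps_exp T = fps_exp T'.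
Proof.
move=> eT; have eD : fps_dlog T = fps_dlog T'.
  by apply/fpsP => -[|j]; rewrite /fps_dlog ?mul0r // eT.
apply: (@fps_euler_unique (fps_dlog T)); rewrite ?fps_euler_exp ?eD //.
by rewrite /fps_dlog mul0r.
Qed.

Lemma fps_expD T T' : fps_exp (fun j => T j + T' j) = fps_exp T * fps_exp T'.
Proof.
apply: (@fps_euler_unique (fps_dlog T + fps_dlog T')).
- by rewrite fpsD /fps_dlog !mul0r addr0.
- by rewrite fpsM big_ord_recl big_ord0 !fps_exp0 mulr1 addr0.
- rewrite fps_euler_exp; congr (_ * _); apply/fpsP => j.
  by rewrite fpsD /fps_dlog mulrDr.
- by rewrite fps_eulerM !fps_euler_exp; ring.
Qed.

Lemma fps_exp_zero : fps_exp (fun=> 0) = 1.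
Proof.
apply: (@fps_euler_unique 0).
- by [].
- by rewrite fps1.
- rewrite fps_euler_exp; congr (_ * _); apply/fpsP => j.
  by rewrite /fps_dlog mulr0.
- rewrite mul0r; apply/fpsP => -[|j]; rewrite /fps_euler ?mul0r // fps1 mulr0 //.
Qed.

Lemma fps_exp_neg T : fps_neg (fps_exp T) = fps_exp (fun j => (-1) ^+ j * T j).
Proof.
apply: (@fps_euler_unique (fps_neg (fps_dlog T))).
- by rewrite /fps_neg /fps_dlog mul0r mulr0.
- by rewrite /fps_neg !fps_exp0 mulr1.
- have -> : fps_euler (fps_neg (fps_exp T)) = fps_neg (fps_euler (fps_exp T)).
    by apply/fpsP => n; rewrite /fps_euler /fps_neg mulrCA.
  by rewrite fps_euler_exp fps_negM.
- rewrite fps_euler_exp; congr (_ * _); apply/fpsP => n.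
  by rewrite /fps_neg /fps_dlog mulrCA.
Qed.

Lemma fps_exp_log (x : F) : fps_exp (fun j => - (x ^+ j / j%:R)) = fps_poly (1 - x *: 'X).
Proof.
set T := fun j => _; apply: (@fps_euler_unique (fps_dlog T)).
- by rewrite /fps_dlog mul0r.
- by rewrite fps_polyE fps_exp0 coefB coefZ coef1 coefX mulr0 subr0.
- exact: fps_euler_exp.
apply/fpsP => n; rewrite (mulrC (fps_dlog T)) fps_polyM.
have sp : (size (1 - x *: 'X : {poly F})%R <= 2)%N.
  rewrite (leq_trans (size_polyD _ _)) // geq_max size_poly1 size_polyN /=.
  by rewrite (leq_trans (size_scale_leq _ _)) ?size_polyX.
have cE i : (1 - x *: 'X : {poly F})`_i = (i == 0%N)%:R - x * (i == 1%N)%:R.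
  by rewrite coefB coef1 coefZ coefX.
pose G i : F := if (i <= n)%N then (1 - x *: 'X)`_i * fps_dlog T (n - i)%N else 0.
have -> : \sum_(i < size (1 - x *: 'X : {poly F})%R) G i = \sum_(i < 2) G i.
  rewrite -(big_mkord xpredT G) -[RHS](big_mkord xpredT G).
  rewrite [RHS](big_cat_nat (leq0n _) sp) /=.
  suff -> : \sum_(size (1 - x *: 'X : {poly F})%R <= i < 2) G i = 0 by rewrite addr0.
  rewrite big_nat big1 // => i /andP[si _].
  by rewrite /G nth_default // mul0r if_same.
rewrite !big_ord_recl big_ord0 /G /= /fps_euler fps_polyE !cE /fps_dlog /T.
case: n {G} => [|[|n]] /=; rewrite ?mul0r ?mulr0 ?subr0 ?addr0 ?mul1r ?sub0r //.
  by rewrite expr1 invr1 !mulr1.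
rewrite -[bump 0 0]/1%N subSS !subn0 mulr0.
have d k : k.+1%:R * - (x ^+ k.+1 / k.+1%:R) = - x ^+ k.+1.
  by rewrite mulrN mulrCA divff ?mulr1.
by rewrite !d mulr1 exprS; ring.
Qed.
End FpsExp.

(** * Plucker coordinates in a box *)

(** This is x^k p(1/x) for p = prod (1 - c_y z), written without division so that x = 0 is
    allowed. *)
Lemma sum_rev_poly (F : comNzRingType) (I : Type) (rs : seq I) (c : I -> F) (x : F) k :
  (size rs <= k)%N ->
  \sum_(b < k.+1) (\prod_(y <- rs) (1 - c y *: 'X))`_b * x ^+ (k - b) =
  x ^+ (k - size rs) * \prod_(y <- rs) (x - c y).
Proof.
elim: rs k => [|y rs IH] k /=.
  rewrite !big_nil big_ord_recl coef1 mul1r mulr1 big1 ?addr0 // => i _.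
  by rewrite coef1 mul0r.
case: k => // k srs; rewrite !big_cons; set p := \prod_(j <- rs) (1 - _).
transitivity (\sum_(b < k.+2) p`_b * x ^+ (k.+1 - b) -
   c y * \sum_(b < k.+1) p`_b * x ^+ (k - b)).
  rewrite big_ord_recl [in RHS]big_ord_recl -addrA; congr (_ + _).
    by rewrite mulrBl mul1r coefB -scalerAl coefZ coefXM mulr0 subr0.
  rewrite mulr_sumr -sumrB; apply: eq_bigr => i _.
  rewrite mulrBl mul1r coefB -scalerAl coefZ coefXM lift0 succnK subSS.
  by rewrite mulrBl mulrA.
have srs' : (size rs <= k.+1)%N by exact: ltnW.
rewrite (IH _ srs') (IH k srs) subSS subSn // exprS.
ring.
Qed.

Section Core.
Variables (F : fieldType) (N : nat) (phi : seq nat -> F).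
Hypothesis natF0 : forall k, k.+1%:R != 0 :> F.
Implicit Types (f g : fps F) (L : seq int).

Lemma eqN_eq0 (y : F) : y = - y -> y = 0.
Proof.
move=> e; have /eqP : y + y = 0 by rewrite {1}e addNr.
by rewrite -mulr2n -mulr_natl mulf_eq0 (negbTE (natF0 1)) => /eqP.
Qed.

Definition pit L : F := (sgnL L)%:~R * phi (lamL L).
(* Covectors of the span of e_(-N), ..., e_(N-1) are encoded as series modulo z^(2N):
   the value at e_p is the coefficient of z^(p + N). *)
Definition cov f : int -> F := fun p => if 0 <= p + N%:Z then f (absz (p + N%:Z)) else 0.
Definition wedge (fs : seq (fps F)) : F := mlext (window N) pit (map cov fs).

Lemma adjalt_pit d : adjalt d pit. Proof. exact: adjalt_sgnL. Qed.

Lemma adjalt_wedge d : adjalt d wedge.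
Proof.
by move=> A f g B sz; rewrite /wedge !map_cat; apply: (adjalt_mlext _ (@adjalt_pit d));
  rewrite -sz !size_cat /= !size_map.
Qed.

(** A polynomial q of degree < N makes q f a combination of the z^j f, j < N, with the coefficients
    of q; [mlext_det] then gives the determinant. *)
Lemma wedge_poly (qs : seq {poly F}) f :
  size qs = N -> {in qs, forall q : {poly F}, (size q <= N)%N} ->
  wedge [seq fps_poly q * f | q <- qs] =
  \det (\matrix_(i < N, j < N) (nth 0 qs i)`_j) *
    wedge [seq fps_poly 'X^j * f | j <- iota 0 N].
Proof.
(* Here the integers 0, ..., N-1 only label the monomials z^j; they are not positions in the
   window. *)
move=> sqs qN; pose D (i : 'I_N) := (i : nat)%:Z.
have incD : {homo D : i j / (i < j)%N >-> i < j} by [].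
pose g (b : int) := cov (fps_poly 'X^(absz b) * f).
have := @mlext_det _ (window N) eqN_eq0 N D pit
  [seq (fun b : int => q`_(absz b)) | q : {poly F} <- qs] g incD (@adjalt_pit N).
rewrite size_map sqs => /(_ erefl) /= e.
have -> : wedge [seq fps_poly 'X^j * f | j <- iota 0 N] =
   mlext (window N) pit (map g [seq D i | i <- enum 'I_N]).
  by rewrite /wedge -val_enum_ord -!map_comp; congr mlext.
have -> : \det (\matrix_(i < N, j < N) (nth 0 qs i)`_j) = \det (\matrix_(i < N, j < N)
   nth (fun=> 0) [seq (fun b : int => q`_(absz b)) | q : {poly F} <- qs] i (D j)).
  by congr (\det _); apply/matrixP => i j; rewrite !mxE (nth_map 0) ?sqs.
rewrite -e /wedge -!map_comp; apply: eq_mlext_covec => q p qqs pw /=.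
rewrite /= big_map -enumT big_enum /= /g /cov /=.
have p0 : 0 <= p + N%:Z by move: pw; rewrite mem_window; lia.
rewrite p0 fps_polyM; set i := absz _.
rewrite -(big_mkord xpredT (fun j => if (j <= i)%N then q`_j * f (i - j)%N else 0)).
rewrite (big_nat_widen _ _ _ _ _ (qN q qqs)) big_mkord big_mkcond /=.
apply: eq_bigr => j _; rewrite fps_Xn_mul; case: ifP => sj; case: ifP => ji //.
  by rewrite mulr0.
by rewrite nth_default ?mul0r // leqNgt sj.
by rewrite mulr0.
Qed.

Definition hcoef f (z : int) : F := if z < 0 then 0 else f (absz z).

Definition tau_box f : F := \sum_(lam <- box N) phi lam *
  \det (\matrix_(i < N, j < N) hcoef f ((nth 0%N lam i)%:Z - (i : nat)%:Z + (j : nat)%:Z)).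

(** The value of z^j f at the position lambda_i - i is h_(lambda_i - i - j + N) up to reindexing:
    the Jacobi-Trudi matrix appears transposed, with rows and columns reversed, and the two
    reversals cost the same sign. *)
Lemma tau_box_wedge f : tau_box f = wedge [seq fps_poly 'X^j * f | j <- iota 0 N].
Proof.
rewrite /wedge /pit mlext_box ?size_map ?size_iota //; apply: eq_bigr => lam _.
congr (_ * _); rewrite -det_tr.
pose r := perm (@rev_ord_inj N).
set A := \matrix_(i, j) _; set B := \matrix_(i, j) _.
have -> : B = row_perm r (col_perm r A^T).
  apply/matrixP => i j; rewrite !mxE !permE /=.
  rewrite -map_comp (nth_map 0%N) ?size_iota // nth_iota // add0n /cov /hcoef /=.
  rewrite fps_Xn_mul; have ilt := ltn_ord i; have jlt := ltn_ord j.
  set x := nth _ _ _.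
  have -> : x%:Z - (N - j)%:Z + N%:Z = (x + j)%:Z by lia.
  have -> : x%:Z - (N - j.+1)%:Z + (N - i.+1)%:Z = (x + j)%:Z - i%:Z by lia.
  rewrite /=; case: leqP => ij.
    have -> : ((x + j)%:Z - i%:Z < 0) = false by lia.
    by congr (f _); lia.
  by have -> : ((x + j)%:Z - i%:Z < 0) = true by lia.
rewrite row_permE col_permE !det_mulmx !det_perm odd_permV mulrCA.
by rewrite -expr2 sqrr_sign mulr1.
Qed.

End Core.

(** * The determinant of the base change among polynomials *)

Section BaseChange.
Variables (F : fieldType) (s : int -> F).
Implicit Types (L : seq int).

Definition pfac x : {poly F} := 1 - s x *: 'X.

Definition vdet L : F :=
  \prod_(a < size L) \prod_(c < size L | (a < c)%N) (s (nth 0 L c) - s (nth 0 L a)).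

Lemma vdet_cons x L : vdet (x :: L) = \prod_(y <- L) (s y - s x) * vdet L.
Proof.
rewrite /vdet /= big_ord_recl /=; congr (_ * _).
  rewrite big_mkcond big_ord_recl /= mul1r.
  by rewrite (big_nth 0) big_mkord; apply: eq_bigr.
apply: eq_bigr => a _; rewrite big_mkcond big_ord_recl /= mul1r [RHS]big_mkcond.
by apply: eq_bigr => c _.
Qed.

(** The sign of the reversal that turns a Vandermonde matrix upside down, times one sign for each
    pair a < c; it depends on k only. *)
Definition sgn_base (k : nat) : F :=
  (-1) ^+ (perm (@rev_ord_inj k)) * \prod_(a < k) \prod_(c < k | (a < c)%N) (-1).

Lemma sgn_base_sqr k : sgn_base k * sgn_base k = 1.
Proof.
have -> : sgn_base k = (-1) ^+ (odd_perm (perm (@rev_ord_inj k)) +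
    \sum_(a < k) \sum_(c < k | (a < c)%N) 1)%N.
  rewrite /sgn_base exprD; congr (_ * _); rewrite expr_sum; apply: eq_bigr => a _.
  by rewrite expr_sum; apply: eq_bigr => c _; rewrite expr1.
by rewrite -expr2 sqrr_sign.
Qed.

Lemma prod_pfac_coef0 (I : Type) (L : seq I) (P : pred I) (c : I -> int) :
  (\prod_(y <- L | P y) pfac (c y))`_0 = 1.
Proof.
elim: L => [|y L IH]; first by rewrite big_nil coef1.
rewrite big_cons; case: ifP => // _.
by rewrite mulrBl mul1r coefB -scalerAl coefZ coefXM IH mulr0 subr0.
Qed.

Lemma size_prod_pfac L (P : pred int) :
  (size (\prod_(y <- L | P y) pfac y)%R <= (count P L).+1)%N.
Proof.
elim: L => [|y L IH]; first by rewrite big_nil size_poly1.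
rewrite big_cons /=; case: ifP => // _.
rewrite mulrBl mul1r (leq_trans (size_polyD _ _)) // geq_max (leq_trans IH) //=.
rewrite size_polyN -scalerAl (leq_trans (size_scale_leq _ _)) //.
by rewrite mulrC (leq_trans (size_polyMleq _ _)) // size_polyX addn2.
Qed.

(** The rows are reversed Lagrange interpolation polynomials, so a reversed Vandermonde matrix makes
    the product diagonal. The factor [vdet L] is cancelled, being nonzero by injectivity of [s] on
    L. *)
Lemma det_pfac L k : size L = k -> uniq L -> {in L &, injective s} ->
  \det (\matrix_(i < k, j < k) (\prod_(y <- L | y != nth 0 L i) pfac y)`_j) =
  sgn_base k * vdet L.
Proof.
case: k => [|k] sL uL sinj.
  rewrite det_mx00 /sgn_base /vdet (size0nil sL) !big_ord0 !mulr1.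
  have -> : perm (@rev_ord_inj 0) = 1%g by apply/permP => -[].
  by rewrite odd_perm1.
set A := \matrix_(i, j) _.
pose V := \matrix_(b < k.+1, c < k.+1) s (nth 0 L c) ^+ (k - b).
have detV : \det V = (-1) ^+ (perm (@rev_ord_inj k.+1)) * vdet L.
  have -> : V = row_perm (perm (@rev_ord_inj k.+1))
      (Vandermonde k.+1 (\row_c s (nth 0 L c))).
    apply/matrixP => b c; rewrite !mxE permE /=.
    by rewrite subSS.
  rewrite row_permE det_mulmx det_perm det_Vandermonde /vdet sL; congr (_ * _).
  by apply: eq_bigr => a _; apply: eq_bigr => c _; rewrite !mxE.
have sn (i : 'I_k.+1) : (i < size L)%N by rewrite sL.
(* Column c of [V] evaluates the reversed polynomials of the rows of [A] at [s L_c],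
   a root of all of them but one. *)
have AV : A *m V = diag_mx (\row_a
    \prod_(y <- L | y != nth 0 L a) (s (nth 0 L a) - s y)).
  apply/matrixP => a c; rewrite !mxE.
  transitivity (\sum_(b < k.+1) (\prod_(y <- [seq y <- L | y != nth 0 L a]) pfac y)`_b *
      s (nth 0 L c) ^+ (k - b)).
    by apply: eq_bigr => b _; rewrite !mxE big_filter.
  have sF : size [seq y <- L | y != nth 0 L a] = k.
    by rewrite -(rem_filter _ uL) size_rem ?sL // mem_nth.
  rewrite sum_rev_poly ?sF // subnn mul1r.
  have [<-|nac] := eqVneq a c; first by rewrite mulr1n big_filter.
  have cF : nth 0 L c \in [seq y <- L | y != nth 0 L a].
    by rewrite mem_filter mem_nth // andbT nth_uniq // eq_sym.
  by rewrite (big_rem _ cF) /= subrr; exact: mul0r.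
(* Every pair of points occurs twice on the diagonal with opposite signs, which gives [vdet L]
   squared up to sign. *)
have detAV : \det A * \det V = (\prod_(a < k.+1) \prod_(c < k.+1 | (a < c)%N) (-1)) *
    vdet L * vdet L.
  rewrite -det_mulmx AV det_diag.
  pose G (a c : 'I_k.+1) := s (nth 0 L c) - s (nth 0 L a).
  transitivity (\prod_(a < k.+1) ((\prod_(c < k.+1 | (a < c)%N) - G a c) *
      \prod_(c < k.+1 | (c < a)%N) G c a)).
    apply: eq_bigr => a _; rewrite !mxE (big_nth 0) big_mkord sL.
    rewrite (bigID (fun c : 'I_k.+1 => a < c)%N) /=; congr (_ * _); apply: eq_big.
    - by move=> c; rewrite nth_uniq // neq_ltn; case: ltngtP.
    - by move=> c _; rewrite /G opprB.
    - by move=> c; rewrite nth_uniq // neq_ltn; case: ltngtP.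
    - by [].
  rewrite big_split /=; congr (_ * _).
    rewrite /vdet sL -big_split; apply: eq_bigr => a _.
    by rewrite -big_split; apply: eq_bigr => c _; exact: (esym (mulN1r _)).
  under eq_bigr => a _ do rewrite big_mkcond.
  rewrite exchange_big /vdet sL /=; apply: eq_bigr => c _.
  by rewrite [RHS]big_mkcond; apply: eq_bigr.
have v0 : vdet L != 0.
  rewrite /vdet sL; apply/prodf_neq0 => a _; apply/prodf_neq0 => c ac.
  rewrite subr_eq0; apply: contraTneq ac => /sinj e.
  have /eqP := e (mem_nth 0 (sn c)) (mem_nth 0 (sn a)).
  by rewrite nth_uniq // => /eqP ->; rewrite ltnn.
apply: (mulIf v0); move: detAV; rewrite detV mulrA.
set e1 := (-1) ^+ _ => e.
have e11 : e1 * e1 = 1 by rewrite /e1 -expr2 sqrr_sign.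
transitivity (e1 * (\det A * e1 * vdet L)).
  by rewrite -[\det A * e1 * _]mulrA mulrCA (mulrA e1) e11 mul1r.
by rewrite e /sgn_base -/e1 !mulrA.
Qed.

Variables (r k : nat) (phi : seq nat -> F).
Hypothesis natF0 : forall k, k.+1%:R != 0 :> F.

(** Block triangular: multiples of z^r have no coefficient below r, and the rows z^j P with P(0) = 1
    form a unitriangular block. The remaining block is that of [det_pfac]. *)
Lemma det_base L : size L = k -> uniq L -> {in L &, injective s} ->
  \det (\matrix_(i < r + k, j < r + k) (nth 0
     ([seq 'X^j * \prod_(y <- L) pfac y | j <- iota 0 r] ++
      [seq 'X^r * \prod_(y <- L | y != x) pfac y | x <- L]) i)`_j) =
  sgn_base k * vdet L.
Proof.
move=> sL uL sinj; set M := \matrix_(i, j) _.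
rewrite -[M]submxK; have -> : dlsubmx M = 0.
  apply/matrixP => i j; rewrite !mxE /= nth_cat size_map size_iota ltnNge leq_addr /=.
  by rewrite addKn (nth_map 0) ?sL // coefXnM ltn_ord.
rewrite det_ublock; have -> : \det (ulsubmx M) = 1.
  rewrite -det_tr det_trig.
    apply: big1 => i _; rewrite !mxE /= nth_cat size_map size_iota ltn_ord.
    by rewrite (nth_map 0%N) ?size_iota // nth_iota // add0n coefXnM ltnn subnn prod_pfac_coef0.
  apply/is_trig_mxP => i j ij; rewrite !mxE /= nth_cat size_map size_iota ltn_ord.
  by rewrite (nth_map 0%N) ?size_iota // nth_iota // add0n coefXnM ij.
rewrite mul1r -(det_pfac sL uL sinj); congr (\det _); apply/matrixP => i j.
rewrite !mxE /= nth_cat size_map size_iota ltnNge leq_addr /= addKn.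
by rewrite (nth_map 0) ?sL // coefXnM ltnNge leq_addr /= addKn.
Qed.

(** To be used with g = H_(m + 1_L), f = H_m and u_x = H_(m + alpha_x): every covector is then g
    times a polynomial of degree < r + k. *)
Lemma wedge_base L (f g : fps F) (u : int -> fps F) :
    size L = k -> uniq L -> {in L &, injective s} ->
    f = fps_poly (\prod_(y <- L) pfac y) * g ->
    {in L, forall x, u x = fps_poly (\prod_(y <- L | y != x) pfac y) * g} ->
  wedge (r + k) phi ([seq fps_poly 'X^j * f | j <- iota 0 r] ++
                     [seq fps_poly 'X^r * u x | x <- L]) =
  sgn_base k * vdet L * tau_box (r + k) phi g.
Proof.
move=> sL uL sinj fE uE; rewrite tau_box_wedge -(det_base sL uL sinj).
rewrite -wedge_poly //; last first.
- move=> q; rewrite mem_cat => /orP[/mapP[j]|/mapP[x xL ->]].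
    rewrite mem_iota => jr ->; rewrite mulrC (leq_trans (size_polyMleq _ _)) //.
    have := size_prod_pfac L xpredT; rewrite count_predT sL size_polyXn addnS /=.
    by move: (size _) => z; lia.
  rewrite mulrC (leq_trans (size_polyMleq _ _)) //.
  have := size_prod_pfac L (fun y => y != x).
  rewrite -size_filter -(rem_filter _ uL) size_rem // sL size_polyXn addnS /=.
  have : (0 < k)%N by rewrite -sL; case: (L) xL.
  by move: (size _) => z; lia.
- by rewrite size_cat !size_map size_iota sL.
congr (wedge _ _); rewrite map_cat -!map_comp; congr (_ ++ _).
  by apply: eq_map => j /=; rewrite fE rmorphM mulrA.
by apply/eq_in_map => x xL /=; rewrite uE // rmorphM mulrA.
Qed.
End BaseChange.

(** * Shifted values as pairings with fixed covectors *)

Section Evaluation.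
Variables (F : fieldType) (w : nat) (s : int -> F) (t : nat -> F).
Hypothesis natF0 : forall k, k.+1%:R != 0 :> F.
Hypothesis sinj : {in window w &, injective s}.
Implicit Types (m n q : int -> int) (L : seq int).

Definition powsum q (j : nat) : F :=
  \sum_(i <- window w) (q i)%:~R / j%:R * s i ^+ j.
Definition shifted_time n (j : nat) : F := t j + powsum n j.
Definition hseries n : fps F := fps_exp (shifted_time n).

Lemma powsumD n q j : powsum (fun i => n i + q i) j = powsum n j + powsum q j.
Proof.
rewrite /powsum -big_split; apply: eq_bigr => i _ /=.
by rewrite intrD !mulrDl.
Qed.

Lemma hseriesD n q : hseries (fun i => n i + q i) = hseries n * fps_exp (powsum q).
Proof.
rewrite /hseries -fps_expD //; apply: eq_fps_exp => // j _.
by rewrite /shifted_time powsumD addrA.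
Qed.

Lemma exp_powsum0 : fps_exp (powsum (fun=> 0)) = 1.
Proof.
rewrite -(fps_exp_zero natF0); apply: eq_fps_exp => // j _.
by rewrite /powsum big1 // => i _; rewrite !mul0r.
Qed.

Lemma exp_powsumD n q :
  fps_exp (powsum (fun i => n i + q i)) = fps_exp (powsum n) * fps_exp (powsum q).
Proof.
by rewrite -fps_expD //; apply: eq_fps_exp => // j _; rewrite powsumD.
Qed.

Lemma exp_powsum_pfac L : {subset L <= window w} ->
  fps_exp (powsum (fun i => - (count_mem i L)%:Z)) = fps_poly (\prod_(x <- L) pfac s x).
Proof.
elim: L => [|x L IH] subL.
  by rewrite big_nil rmorph1 -exp_powsum0; congr (fps_exp (powsum _)).
have xw : x \in window w by apply: subL; rewrite mem_head.
rewrite big_cons rmorphM /= -IH; last by move=> y yL; apply: subL; rewrite inE yL orbT.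
rewrite -fps_exp_log // -fps_expD //; apply: eq_fps_exp => // j _.
transitivity (powsum (fun i => - (i == x)%:Z + - (count_mem i L)%:Z) j).
  congr powsum; apply/funext => i; rewrite /= -opprD eq_sym; congr (- _).
rewrite powsumD; congr (_ + _).
rewrite /powsum (bigD1_seq x) ?uniq_window //= eqxx big1 ?addr0 => [|i /negbTE ->].
  by rewrite -[(- 1)%:~R]/(- 1) mulN1r mulNr mulrC.
by rewrite oppr0 !mul0r.
Qed.

Lemma hseries_pfac n n' L : {subset L <= window w} ->
  (forall i, n' i = n i + (count_mem i L)%:Z) ->
  hseries n = fps_poly (\prod_(x <- L) pfac s x) * hseries n'.
Proof.
move=> subL nE; rewrite -exp_powsum_pfac // mulrC -hseriesD; congr hseries.
by apply/funext => i; rewrite nE addrK.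
Qed.

Definition vpref n : F := \prod_(i <- window w) \prod_(j <- window w | i < j)
  (s i - s j) ^ (n i * n j).
(** Symmetric in x and y: the order of the indices, as in the prefactor, fixes the sign. *)
Definition sdif x y : F := if x < y then s x - s y else s y - s x.
(** The factor c_x, by which the prefactor changes when alpha_x is added to n; the exponent n_x
    itself does not enter. *)
Definition cfac n x : F := \prod_(j <- window w | j != x) sdif x j ^ n j.

Lemma sdif_neq0 x y : x \in window w -> y \in window w -> x != y -> sdif x y != 0.
Proof.
move=> xw yw xy; rewrite /sdif; case: ifP => _; rewrite subr_eq0.
  by apply: contraNneq xy => /sinj -> //.
by apply: contraNneq xy => /sinj <- //.
Qed.

Lemma big_seq_eq1 (G : int -> F) x : x \in window w ->
  \prod_(i <- window w) (if i == x then G i else 1) = G x.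
Proof.
move=> xw; rewrite (bigD1_seq x) ?uniq_window //= eqxx big1 ?mulr1 // => i /negbTE ->.
by [].
Qed.

Lemma vpref_add1 n n' x : x \in window w -> (forall i, n' i = n i + (i == x)%:Z) ->
  vpref n' = vpref n * cfac n x.
Proof.
move=> xw nE.
pose G i j := s i - s j.
have Gn0 i j : i \in window w -> j \in window w -> i < j -> G i j != 0.
  by move=> iw jw ij; have := sdif_neq0 iw jw; rewrite /sdif ij lt_eqF //; apply.
have step i : i \in window w ->
    \prod_(j <- window w | i < j) G i j ^ (n' i * n' j) =
    (\prod_(j <- window w | i < j) G i j ^ (n i * n j)) *
    ((if i == x then \prod_(j <- window w | i < j) G i j ^ n j else 1) *
     \prod_(j <- window w) (if j == x then (if i < j then G i j ^ n i else 1) else 1)).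
  move=> iw.
  have -> : (if i == x then \prod_(j <- window w | i < j) G i j ^ n j else 1) =
            \prod_(j <- window w | i < j) (if i == x then G i j ^ n j else 1).
    by case: ifP => // _; rewrite big1.
  have -> : \prod_(j <- window w) (if j == x then (if i < j then G i j ^ n i else 1) else 1)
     = \prod_(j <- window w | i < j) (if j == x then G i j ^ n i else 1).
    by rewrite [RHS]big_mkcond; apply: eq_bigr => j _; case: ifP; case: ifP.
  rewrite -!big_split /= big_seq_cond [RHS]big_seq_cond; apply: eq_bigr => j /andP[jw ij].
  rewrite !nE mulrDl !mulrDr !expfzDr ?Gn0 // -mulrA; congr (_ * _).
  have [eix|_] := eqVneq i x; have [ejx|_] := eqVneq j x;
    rewrite ?(mulr0, mul0r, mulr1, mul1r, expr0z) //.
  by move: ij; rewrite eix ejx ltxx.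
rewrite /vpref (eq_big_seq _ step) big_split; congr (_ * _); rewrite big_split /=.
rewrite (@big_seq_eq1 (fun i => \prod_(j <- window w | i < j) G i j ^ n j)) //.
under [X in _ * X]eq_bigr => i _.
  rewrite (@big_seq_eq1 (fun j => if i < j then G i j ^ n i else 1)) //; over.
rewrite /cfac [RHS](bigID (fun j => x < j)) /=; congr (_ * _).
  rewrite big_mkcond [RHS]big_mkcond; apply: eq_bigr => j _.
  by rewrite /sdif; case: ltgtP.
rewrite [RHS]big_mkcond; apply: eq_bigr => j _.
by rewrite /sdif; case: ltgtP.
Qed.

Fixpoint pdif L : F := if L is x :: L' then \prod_(y <- L') sdif x y * pdif L' else 1.

Definition addL m L : int -> int := fun i => m i + (count_mem i L)%:Z.

Lemma cfac_addL m L x : uniq (x :: L) -> {subset x :: L <= window w} ->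
  cfac (addL m L) x = cfac m x * \prod_(y <- L) sdif x y.
Proof.
elim: L => [|y L IH] u subL.
  rewrite big_nil mulr1; congr cfac; apply/funext => i.
  by rewrite /addL /= addr0.
have subL' : {subset x :: L <= window w}.
  by move=> z; rewrite inE => zL; apply: subL; rewrite !inE orbCA zL orbT.
have u' : uniq (x :: L) by move: u; rewrite /= !inE negb_or; case/and3P=> /andP[_ ->] _ ->.
have xy : y != x by move: u; rewrite /= !inE negb_or eq_sym; case/and3P=> /andP[-> _] _ _.
have yw : y \in window w by apply: subL; rewrite !inE eqxx orbT.
have xw : x \in window w by apply: subL; rewrite !inE eqxx.
rewrite big_cons mulrCA -(IH u' subL') /cfac.
have -> : sdif x y = \prod_(j <- window w | j != x) (if j == y then sdif x j else 1).
  rewrite big_mkcond (eq_bigr (fun j => if j == y then sdif x j else 1)) ?big_seq_eq1 //.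
  by move=> j _; case: eqVneq => // ->; rewrite [x == y]eq_sym (negbTE xy).
rewrite -big_split big_seq_cond [RHS]big_seq_cond; apply: eq_bigr => j /andP[jw jx] /=.
rewrite /addL /= eq_sym PoszD addrCA [LHS]expfzDr; last first.
  by apply: sdif_neq0 => //; rewrite eq_sym.
by case: eqVneq.
Qed.

Lemma vpref_addL m L : uniq L -> {subset L <= window w} ->
  vpref (addL m L) = vpref m * \prod_(x <- L) cfac m x * pdif L.
Proof.
elim: L => [|x L IH] u subL.
  rewrite big_nil !mulr1; congr vpref; apply/funext => i.
  by rewrite /addL /= addr0.
have xw : x \in window w by apply: subL; rewrite mem_head.
have subL' : {subset L <= window w} by move=> y yL; apply: subL; rewrite inE yL orbT.
rewrite (@vpref_add1 (addL m L) _ x) //; last first.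
  by move=> i; rewrite /addL /= eq_sym; lia.
rewrite cfac_addL // IH //; last by case/andP: u.
by rewrite big_cons /=; ring.
Qed.

(** Compared with s_y - s_x, [sdif x y] has the opposite sign exactly when x < y. The sign of L
    absorbs the dependence on the order, and one sign for each pair remains. *)
Lemma sgnL_pdif L : uniq L ->
  (sgnL L)%:~R * pdif L = (-1) ^+ 'C(size L, 2) * vdet s L.
Proof.
elim: L => [|x L IH] /=.
  by rewrite /sgnL /vdet /= !big_ord0.
case/andP=> xL uL; rewrite vdet_cons sgnL_cons (negbTE xL) rmorphM rmorphXn rmorphN1 /=.
have -> : \prod_(y <- L) sdif x y =
   (-1) ^+ (count (fun y => y < x) L + size L) * \prod_(y <- L) (s y - s x).
  elim: L xL {IH uL} => [|y L IH]; first by rewrite !big_nil mulr1.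
  rewrite inE negb_or => /andP[xy xL]; rewrite !big_cons IH // /sdif /=.
  case: ltgtP xy => // _ _; rewrite ?add0n ?add1n ?addSn ?addnS ?exprS; ring.
rewrite binS bin1 !exprD; set a := (-1) ^+ count _ L.
transitivity (a * a * ((-1) ^+ size L * \prod_(y <- L) (s y - s x)) * ((sgnL L)%:~R * pdif L)).
  by ring.
by rewrite IH // -expr2 sqrr_sign; ring.
Qed.

Variables (r k : nat) (phi : seq nat -> F) (n : int -> int).
Hypothesis kw : (k <= w)%N.

Definition base_shift : int -> int := fun p => n p - ((- k%:Z <= p) && (p < 0))%:Z.

Definition hval (lam : seq nat) : F :=
  vpref (shiftn n lam) * tau_box (r + k) phi (hseries (shiftn n lam)).

Definition ubase : seq (fps F) := [seq fps_poly 'X^j * hseries base_shift | j <- iota 0 r].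
Definition ucov (x : int) : fps F :=
  fps_poly (cfac base_shift x)%:P * (fps_poly 'X^r * hseries (addL base_shift [:: x])).

(** The factor independent of L: [sgn_base] from the base change (its own inverse), the binomial
    sign from [sgnL_pdif], and the prefactor at m. *)
Definition kappa : F := sgn_base F k * (-1) ^+ 'C(k, 2) * vpref base_shift.

Lemma wedge_scale A (c : int -> F) (f : int -> fps F) L :
  wedge (r + k) phi (A ++ [seq fps_poly (c x)%:P * f x | x <- L]) =
  \prod_(x <- L) c x * wedge (r + k) phi (A ++ map f L).
Proof.
elim: L A => [|x L IH] A /=; first by rewrite big_nil mul1r.
rewrite big_cons -mulrA /wedge map_cat /=.
rewrite (@mlext_scale _ (c x) _ (cov (r + k) (f x))); last first.
  move=> p _; rewrite /cov; case: ifP => _; last by rewrite mulr0.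
  exact: fps_polyC_mul.
congr (_ * _); have := IH (rcons A (f x)); rewrite /wedge !cat_rcons !map_cat /=.
by [].
Qed.

(* This is where H^(n, lambda) becomes a Plucker coordinate. *)
Lemma hval_wedge L : size L = k -> {subset L <= window w} ->
  {in L, forall p, - k%:Z <= p} ->
  (sgnL L)%:~R * hval (lamL L) = kappa * wedge (r + k) phi (ubase ++ map ucov L).
Proof.
move=> sL subL geL; have [uL|nuL] := boolP (uniq L); last first.
  (* For a tuple with a repetition the right side vanishes too, being alternating in L. *)
  rewrite sgnL_nuniq // mul0r.
  have alt : adjalt k (fun L => wedge (r + k) phi (ubase ++ map ucov L)).
    move=> A p q B sz; rewrite !map_cat /= !catA.
    apply: (@adjalt_wedge _ _ _ (r + k)).
    by rewrite -sz !size_cat /= !size_map size_iota; lia.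
  by rewrite (adjalt_nuniq (eqN_eq0 natF0) alt sL nuL) mulr0.
have shiftE : shiftn n (lamL L) = addL base_shift L.
  apply/funext => p; rewrite (shiftn_lamL n _ uL sL geL) /addL /base_shift.
  by rewrite (count_uniq_mem p uL).
rewrite /hval shiftE vpref_addL // wedge_scale.
have injL : {in L &, injective s} by move=> x y /subL xw /subL; exact: sinj.
rewrite (@wedge_base _ s r k phi natF0 L _ (hseries (addL base_shift L))
  (fun x => hseries (addL base_shift [:: x]))) //; first last.
- move=> x xL; rewrite -big_filter; apply: hseries_pfac => [y|i].
    by rewrite mem_filter => /andP[_ /subL].
  rewrite /addL /= addn0 -[RHS]addrA -PoszD; congr (_ + Posz _).
  rewrite !count_uniq_mem ?filter_uniq // mem_filter /= eq_sym.
  by case: eqVneq => [->|]; rewrite ?xL.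
- exact: hseries_pfac.
have := sgnL_pdif uL; rewrite sL => e; rewrite /kappa.
transitivity ((sgnL L)%:~R * pdif L * vpref base_shift * \prod_(x <- L) cfac base_shift x *
   tau_box (r + k) phi (hseries (addL base_shift L))); first by ring.
rewrite e -[(-1) ^+ _]mul1r -{1}(sgn_base_sqr F k); ring.
Qed.
End Evaluation.

(** * Plucker relations of the shifted values *)

Lemma rem_at_cat (T : Type) (A B : seq T) j : (j < size B)%N ->
  rem_at (size A + j) (A ++ B) = A ++ rem_at j B.
Proof.
move=> jB; rewrite /rem_at take_cat drop_cat ltnNge leq_addr /= addKn -addnS.
by rewrite ltnNge leq_addr /= addKn catA.
Qed.

Lemma map_rem_at (T S : Type) (f : T -> S) j L : map f (rem_at j L) = rem_at j (map f L).
Proof. by rewrite /rem_at map_cat map_take map_drop. Qed.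

Section PluckerCore.
Variables (F : fieldType) (w : nat) (s : int -> F) (t : nat -> F).
Hypothesis natF0 : forall k, k.+1%:R != 0 :> F.
Hypothesis sinj : {in window w &, injective s}.
Variables (r k : nat) (phi : seq nat -> F) (n : int -> int).
Hypothesis kw : (k <= w)%N.
Let N := (r + k)%N.
Hypothesis pl : forall I J, size I = N.-1 -> size J = N.+1 ->
  {subset I <= window N} -> {subset J <= window N} ->
  \sum_(j <- iota 0 (size J)) (-1) ^+ j.+1 *
     pit phi (rcons I (nth 0 J j)) * pit phi (rem_at j J) = 0.

Let h := hval w s t r k phi n.

(** The relation for N is applied to the covector tuples [B ++ map u I] and [B ++ map u J], where
    [B] holds the r base covectors. *)
Lemma hval_plucker I J : (0 < k)%N -> size I = k.-1 -> size J = k.+1 ->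
  {subset I <= window w} -> {subset J <= window w} ->
  {in I, forall p, - k%:Z <= p} -> {in J, forall p, - k%:Z <= p} ->
  \sum_(j <- iota 0 (size J)) (-1) ^+ j.+1 *
     ((sgnL (rcons I (nth 0 J j)))%:~R * h (lamL (rcons I (nth 0 J j)))) *
     ((sgnL (rem_at j J))%:~R * h (lamL (rem_at j J))) = 0.
Proof.
move=> k0 sI sJ subI subJ geI geJ.
pose W := wedge N phi.
pose B := ubase w s t r k n; pose u := ucov w s t r k n.
have sB : size B = r by rewrite size_map size_iota.
have key : \sum_(j <- iota 0 (size J)) (-1) ^+ j.+1 *
     W (B ++ map u (rcons I (nth 0 J j))) * W (B ++ map u (rem_at j J)) = 0.
  have two0 := eqN_eq0 natF0.
  set fs := map (cov N) (B ++ map u I); set gs := map (cov N) (B ++ map u J).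
  have szfs : size fs = N.-1 by rewrite size_map size_cat sB size_map sI /N; lia.
  have szgs : size gs = N.+1 by rewrite size_map size_cat sB size_map sJ /N; lia.
  have pl' I' J' : size I' = size fs -> size J' = size gs ->
      {subset I' <= window N} -> {subset J' <= window N} ->
      \sum_(j <- iota 0 (size J')) (-1) ^+ j.+1 *
         pit phi (rcons I' (nth 0 J' j)) * pit phi (rem_at j J') = 0.
    by rewrite szfs szgs; exact: pl.
  have := mlext_plucker pl'; rewrite szgs.
  have -> : iota 0 N.+1 = iota 0 r ++ [seq (r + j)%N | j <- iota 0 (size J)].
    by rewrite -iotaDl addn0 -iotaD sJ /N addnS.
  (* Exchanging one of the first r covectors of [gs] repeats it in the first factor, because [fs]
     begins with the same ones; the other terms carry a common (-1)^r. *)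
  rewrite big_cat /= big_seq [X in X + _]big1 ?add0r => [|j]; last first.
    rewrite mem_iota add0n => /andP[_ jr].
    have jB : (j < size B)%N by rewrite sB.
    have jfs : (j < size fs)%N by rewrite size_map size_cat; lia.
    have -> : nth (fun=> 0) gs j = nth (fun=> 0) fs j.
      rewrite /gs /fs !(nth_map 0) ?size_cat ?ltn_addr //.
      by rewrite !nth_cat jB.
    have e := cat_rem_at (fun=> 0) jfs.
    have -> : rcons fs (nth (fun=> 0) fs j) = take j fs ++ nth (fun=> 0) fs j ::
        drop j.+1 fs ++ nth (fun=> 0) fs j :: [::].
      by rewrite -cat_cons catA -e cats1.
    rewrite (@mlext_repeat _ (window N) two0 N _ _ _ _ _ (@adjalt_pit _ phi N)).
      by rewrite mulr0 mul0r.
    by rewrite -cat_cons catA -e cats1 size_rcons szfs prednK //; rewrite /N; lia.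
  rewrite big_map => E.
  have : (-1) ^+ r * \sum_(j <- iota 0 (size J)) (-1) ^+ j.+1 *
     W (B ++ map u (rcons I (nth 0 J j))) * W (B ++ map u (rem_at j J)) = 0.
    rewrite mulr_sumr -[RHS]E; apply: eq_big_seq => j.
    rewrite mem_iota add0n => /andP[_ jJ].
    rewrite !mulrA -exprD addnS; congr (_ * _ * _).
      have -> : nth (fun=> 0) gs (r + j) = cov N (u (nth 0 J j)).
        rewrite /gs (nth_map 0) ?nth_cat ?size_cat ?sB ?size_map ?ltn_add2l //.
        by rewrite ltnNge leq_addr /= addKn (nth_map 0).
      by rewrite /W /wedge /fs map_rcons -rcons_cat map_rcons.
    rewrite /W /wedge /gs -map_rem_at -sB rem_at_cat ?size_map //.
    by rewrite map_rem_at.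
  by move/eqP; rewrite mulf_eq0 signr_eq0 /= => /eqP.
under eq_big_seq => j.
  rewrite mem_iota => /andP[_ jJ].
  rewrite (hval_wedge t natF0 sinj r phi n kw) //; first last.
  - move=> p; rewrite mem_rcons inE => /orP[/eqP->|/geI//]; apply: geJ.
    exact: mem_nth.
  - move=> p; rewrite mem_rcons inE => /orP[/eqP->|/subI//]; apply: subJ.
    exact: mem_nth.
  - by rewrite size_rcons sI prednK.
  rewrite (hval_wedge t natF0 sinj r phi n kw) //; first last.
  - by move=> p /(mem_subseq (subseq_rem_at _ _)); exact: geJ.
  - by move=> p /(mem_subseq (subseq_rem_at _ _)); exact: subJ.
  - by rewrite size_rem_at // sJ.
  over.
transitivity (kappa w s k n * kappa w s k n * \sum_(j <- iota 0 (size J)) (-1) ^+ j.+1 *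
     W (B ++ map u (rcons I (nth 0 J j))) * W (B ++ map u (rem_at j J))).
  by rewrite mulr_sumr; apply: eq_bigr => j _; rewrite /W -/B -/u; ring.
by rewrite key mulr0.
Qed.
End PluckerCore.

(** * Lagrange relations of the shifted values *)

Lemma perm_window_refl W : perm_eq [seq - i - 1 | i <- window W] (window W).
Proof.
have uR : uniq [seq - i - 1 | i <- window W].
  by rewrite map_inj_uniq ?uniq_window // => i j; lia.
apply: (uniq_perm uR (uniq_window W)) => p.
apply/mapP/idP => [[i + ->]|pW]; first by rewrite !mem_window; lia.
by exists (- p - 1); [move: pW; rewrite !mem_window|]; lia.
Qed.

Lemma sum_window (V : zmodType) W (G : int -> V) :
  \sum_(p <- window W) G p = \sum_(a < W + W) G (a%:Z - W%:Z).
Proof.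
rewrite /window big_map.
have -> : iota 0 (W + W) = index_iota 0 (W + W) by rewrite /index_iota subn0.
by rewrite big_mkord.
Qed.

Lemma omega_shift N (a b : 'I_(N + N)) :
  omega (a%:Z - N%:Z) (b%:Z - N%:Z) = if b == rev_ord a then (-1) ^+ (N + a) else 0.
Proof.
have aN := ltn_ord a; have bN := ltn_ord b; rewrite /omega -val_eqE /=.
have -> : (a%:Z - N%:Z + (b%:Z - N%:Z) == -1) = (b == N + N - a.+1 :> nat)%N by lia.
case: ifP => // _; rewrite -[RHS]signr_odd; congr (_ ^+ _).
by have -> : odd `|a%:Z - N%:Z|%N = odd (N + a) by lia.
Qed.

Section Gram.
Variables (F : fieldType) (N : nat).
Implicit Types f g : fps F.

Definition gram f g : F := \sum_(p <- window N) \sum_(q <- window N)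
  (omega p q)%:~R * (cov N f p * cov N g q).

Lemma gram_swap f g : gram f g = - gram g f.
Proof.
rewrite /gram exchange_big -sumrN; apply: eq_bigr => p _ /=.
rewrite -sumrN; apply: eq_bigr => q _.
by rewrite omega_swap rmorphN /= mulNr [cov N f q * _]mulrC.
Qed.

Lemma covE f (a : nat) : cov N f (a%:Z - N%:Z) = f a.
Proof. by rewrite /cov subrK. Qed.

(** The residue form in the encoding of [cov]: each argument is shifted by z^N, so the residue
    becomes the coefficient of index 2N - 1, and the shift inside f(-z) leaves (-1)^N. *)
Lemma gramE f g : (0 < N)%N ->
  gram f g = (-1) ^+ N * (fps_neg f * g) (N + N).-1.
Proof.
move=> N0; rewrite fpsM /gram sum_window mulr_sumr prednK ?addn_gt0 ?N0 //.
apply: eq_bigr => a _; have aN := ltn_ord a.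
rewrite sum_window (bigD1 (rev_ord a)) // omega_shift eqxx big1 ?addr0 => [|b nb]; last first.
  by rewrite omega_shift (negbTE nb) mul0r.
rewrite !covE rmorphXn rmorphN1 /= exprD /fps_neg.
have -> : (N + N - a.+1 = (N + N).-1 - a)%N by lia.
by rewrite !mulrA addr0.
Qed.

Lemma gram_Xn f g e e' : (0 < N)%N ->
  gram (fps_poly 'X^e * f) (fps_poly 'X^e' * g) = (-1) ^+ (N + e) *
    if (e + e' < N + N)%N then (fps_neg f * g) ((N + N).-1 - (e + e'))%N else 0.
Proof.
move=> N0; rewrite gramE // fps_neg_Xn exprD -mulrA; congr (_ * _).
have -> : (-1) ^+ e * (fps_poly 'X^e * fps_neg f) * (fps_poly 'X^e' * g) =
    fps_poly ((-1) ^+ e)%:P * (fps_poly 'X^(e + e') * (fps_neg f * g)).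
  rewrite !rmorphXn /= !rmorphN1 exprD -!mulrA; congr (_ * (_ * _)).
  by rewrite mulrCA.
rewrite fps_polyC_mul; congr (_ * _); rewrite fps_Xn_mul.
have -> : (e + e' < N + N)%N = (e + e' <= (N + N).-1)%N by lia.
by [].
Qed.

Lemma gramZl c f g : gram (fps_poly c%:P * f) g = c * gram f g.
Proof.
rewrite /gram mulr_sumr; apply: eq_bigr => p _; rewrite mulr_sumr; apply: eq_bigr => q _.
have -> : cov N (fps_poly c%:P * f) p = c * cov N f p.
  by rewrite /cov; case: ifP => _; rewrite ?mulr0 // fps_polyC_mul.
ring.
Qed.

Lemma gramZr c f g : gram f (fps_poly c%:P * g) = c * gram f g.
Proof. by rewrite gram_swap gramZl -mulrN -gram_swap. Qed.
End Gram.

(** * A Darboux basis containing the covectors of the window *)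

Section LagrangeCore.
Variables (F : fieldType) (w : nat) (s : int -> F) (t : nat -> F).
Hypothesis natF0 : forall k, k.+1%:R != 0 :> F.
Hypothesis sinj : {in window w &, injective s}.
Hypothesis sodd : forall i, s (- i - 1) = - s i.
Hypothesis teven : forall j, ~~ odd j -> t j = 0.
Variables (r k : nat) (phi : seq nat -> F) (n : int -> int).
Hypothesis kw : (k <= w)%N.
Hypothesis k2 : (2 <= k)%N.
Hypothesis nB : forall i, n (- i - 1) = - n i.
Let N := (r + k)%N.
Implicit Types q : int -> int.

Notation Hs := (hseries w s t).
Notation E0 q := (fps_exp (powsum w s q)).
Let m := base_shift k n.

Lemma sub_window p : p \in window k -> p \in window w.
Proof. by rewrite !mem_window; lia. Qed.

Lemma powsum_refl q j : (-1) ^+ j * powsum w s q j = powsum w s (fun i => q (- i - 1)) j.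
Proof.
rewrite /powsum -[in LHS](perm_big _ (perm_window_refl w)) big_map mulr_sumr.
apply: eq_bigr => i _; rewrite sodd [(- s i) ^+ j]exprNn mulrCA; congr (_ * _).
by rewrite mulrA -expr2 sqrr_sign mul1r.
Qed.

(** The odd times cancel between H(-z) and H(z) and the even ones are 0, so only the points
    contribute, through exponents q' and the reflection of q. *)
Lemma neg_hseries_mul q q' :
  fps_neg (Hs q) * Hs q' = E0 (fun i => q' i + q (- i - 1)).
Proof.
rewrite /hseries fps_exp_neg // -fps_expD //; apply: eq_fps_exp => // j _.
rewrite /shifted_time mulrDr powsum_refl powsumD.
have [oj|ej] := boolP (odd j); last by rewrite teven // mulr0 !add0r addrC.
by rewrite -signr_odd oj expr1 mulN1r addrACA addNr add0r addrC.
Qed.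

(** The lattice condition cancels n, while [-k, 0) and its reflection [0, k) together fill the
    window. *)
Lemma base_shift_refl i : m i + m (- i - 1) = - (i \in window k)%:Z.
Proof.
rewrite /m /base_shift nB mem_window.
have -> : (- k%:Z <= - i - 1) = (i < k%:Z) by lia.
have -> : (- i - 1 < 0) = (0 <= i) by lia.
by move: (n i) => x; case: (lerP (- k%:Z) i); case: (lerP 0 i); case: (ltrP i k%:Z) => /=; lia.
Qed.

Lemma exp_powsum_pfac_sub (A : seq int) q : uniq A -> {subset A <= window w} ->
  (forall i, q i = - (i \in A)%:Z) -> E0 q = fps_poly (\prod_(x <- A) pfac s x).
Proof.
move=> uA subA qE; rewrite -(exp_powsum_pfac s natF0 subA); congr (fps_exp (powsum _ _ _)).
by apply/funext => i; rewrite qE count_uniq_mem.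
Qed.

Lemma coef_prod_pfac (A : seq int) d : (size A < d)%N ->
  (\prod_(x <- A) pfac s x)`_d = 0.
Proof.
move=> Ad; rewrite nth_default //.
by rewrite (leq_trans (size_prod_pfac s A xpredT)) // count_predT.
Qed.

Lemma size_window W : size (window W) = (W + W)%N.
Proof. by rewrite size_map size_iota. Qed.

Lemma exp_powsum_delta x : x \in window w ->
  E0 (fun i => (i == x)%:Z) = (fun j => s x ^+ j) :> fps F.
Proof.
move=> xw; set E := E0 _; pose G : fps F := fun j => s x ^+ j.
have EP : E * fps_poly (pfac s x) = 1.
  have := @exp_powsum_pfac _ w s natF0 [:: x]; rewrite big_seq1 => <-.
    rewrite -exp_powsumD // -(exp_powsum0 w s natF0); congr (fps_exp (powsum _ _ _)).
    by apply/funext => i; rewrite /= addn0 eq_sym subrr.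
  by move=> y; rewrite inE => /eqP->.
have PG : fps_poly (pfac s x) * G = 1.
  apply/fpsP => d; rewrite fps1 /pfac raddfB /= mulrBl rmorph1 mul1r.
  rewrite fpsD fpsN -mul_polyC rmorphM -mulrA.
  rewrite fps_polyC_mul -(expr1 'X) fps_Xn_mul /G; case: d => [|d] /=; first by rewrite mulr0 subr0 expr0.
  by rewrite subn1 /= -exprS subrr.
by rewrite -[LHS]mulr1 -PG mulrA EP mul1r.
Qed.

(** The reflection i |-> -i-1 preserves [sdif], so the exponents add up to m_j + m_(-j-1), which is
    minus the indicator of the window. *)
Lemma cfac_refl b : b \in window k ->
  cfac w s m b * cfac w s m (- b - 1) = \prod_(y <- window k | y != b) (sdif s b y)^-1.
Proof.
move=> bk; have bw := sub_window bk.
have -> : cfac w s m (- b - 1) =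
    \prod_(j <- window w | j != b) sdif s b j ^ m (- j - 1).
  rewrite /cfac -(perm_big _ (perm_window_refl w)) big_map.
  apply: eq_big => [j|j _]; first by apply/idP/idP; lia.
  congr (_ ^ _); rewrite /sdif !sodd.
  have -> : (- b - 1 < - j - 1) = (j < b) by lia.
  have [] := ltgtP j b => [_|_|->]; rewrite ?subrr //; last by rewrite opprK addrC.
  by rewrite opprK addrC.
rewrite /cfac -big_split /=.
have -> : \prod_(y <- window k | y != b) (sdif s b y)^-1 =
   \prod_(y <- window w | y != b) (if y \in window k then (sdif s b y)^-1 else 1).
  rewrite -big_mkcondr -big_filter -[RHS]big_filter; apply: perm_big.
  apply: uniq_perm; rewrite ?filter_uniq ?uniq_window // => y.
  rewrite !mem_filter; case: (boolP (y \in window k)) => [/sub_window->|_].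
    by rewrite !andbT.
  by rewrite !andbF.
rewrite big_seq_cond [RHS]big_seq_cond; apply: eq_bigr => j /andP[jw jb].
have nz : sdif s b j != 0 by apply: (sdif_neq0 sinj) => //; rewrite eq_sym.
rewrite -expfzDr // base_shift_refl; case: ifP => _ /=.
  by rewrite -[(1 : nat)%:Z]/(1%:Z) -invr_expz expr1z.
by rewrite oppr0 expr0z.
Qed.

(* Up to sign and a power of z, the second case is H_m(-z)^(-1), because
   m_i + m_(-i-1) is minus the indicator of the window. *)
Definition ufull (a : int) : fps F :=
  if a < - k%:Z then fps_poly 'X^(absz (a + N%:Z)) * Hs m
  else if k%:Z <= a then fps_poly (-1)%:P *
    (fps_poly 'X^(absz (a + N%:Z)) * Hs (fun i => m i + (i \in window k)%:Z))
  else ucov w s t r k n a.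

Let N0 : (0 < N)%N. Proof. by rewrite /N; lia. Qed.

Lemma omega_eq0 (p p' : int) : p + p' != -1 -> omega p p' = 0.
Proof. by rewrite /omega => /negbTE ->. Qed.

Let addL1 x i : addL m [:: x] i = m i + (i == x)%:Z.
Proof. by rewrite /addL /= addn0 eq_sym. Qed.

Let rem_window x : x \in window k ->
  [/\ uniq (rem x (window k)), {subset rem x (window k) <= window w},
     size (rem x (window k)) = (k + k).-1 &
     forall i, (i \in rem x (window k)) = (i \in window k) && (i != x)].
Proof.
move=> xk; have uk := uniq_window k; split.
- exact: rem_uniq.
- by move=> i /mem_rem; exact: sub_window.
- by rewrite size_rem // size_window.
- by move=> i; rewrite mem_rem_uniq // inE andbC.
Qed.

(** The product series is a polynomial of degree at most 2k, whereas the coefficient required has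
    index -1 - a - b >= 2k + 1. *)
Let gram_base_base a b : a \in window N -> b \in window N -> a < - k%:Z -> b < - k%:Z ->
  gram N (ufull a) (ufull b) = 0.
Proof.
rewrite !mem_window => aN bN ak bk; rewrite /ufull ak bk gram_Xn //.
case: ifP => _; last by rewrite mulr0.
rewrite neg_hseries_mul (@exp_powsum_pfac_sub (window k)) ?uniq_window //; last first.
- by move=> i; rewrite base_shift_refl.
- exact: sub_window.
by rewrite fps_polyE coef_prod_pfac ?mulr0 // size_window; lia.
Qed.

(** One factor of the polynomial is cancelled by b, so its degree is at most 2k - 1, and the index
    required is k - 1 - a >= 2k. *)
Let gram_base_mid a b : a \in window N -> b \in window k -> a < - k%:Z ->
  gram N (ufull a) (ufull b) = 0.
Proof.
move=> aN bk ak; have [uR sR zR mR] := rem_window bk.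
move: (bk); rewrite mem_window => /andP[bl bu].
rewrite mem_window in aN.
rewrite /ufull ak ltNge bl leNgt bu /= /ucov gramZr gram_Xn //.
case: ifP => _; last by rewrite !mulr0.
rewrite neg_hseries_mul (@exp_powsum_pfac_sub (rem b (window k))) //; last first.
  move=> i; rewrite -/m addL1 addrAC base_shift_refl mR.
  by have [->|] := eqVneq i b; rewrite ?bk ?andbT ?addr0.
by rewrite fps_polyE coef_prod_pfac ?mulr0 // zR; rewrite /N in aN *; lia.
Qed.

(** The exponents cancel entirely: the product series is 1 and only index 0, that is a + b = -1,
    survives. *)
Let gram_base_top a b : a \in window N -> b \in window N -> a < - k%:Z -> k%:Z <= b ->
  gram N (ufull a) (ufull b) = - (omega a b)%:~R.
Proof.
rewrite !mem_window => aN bN ak bk; rewrite /ufull ak.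
have -> : (b < - k%:Z) = false by lia.
rewrite bk gramZr gram_Xn // neg_hseries_mul.
have -> : E0 (fun i => m i + (i \in window k)%:Z + m (- i - 1)) = 1.
  rewrite -(exp_powsum0 w s natF0); congr (fps_exp (powsum _ _ _)); apply/funext => i.
  by rewrite addrAC base_shift_refl addNr.
rewrite fps1 mulN1r; congr (- _); rewrite /omega.
have [ab|nab] := eqVneq (a + b) (-1).
  have -> : (absz (a + N%:Z)%R + absz (b + N%:Z)%R = (N + N).-1)%N by lia.
  have -> : ((N + N).-1 < N + N)%N by lia.
  rewrite subnn eqxx mulr1 rmorphXn rmorphN1 -signr_odd; congr (_ ^+ _).
  have [e eE] : exists e : nat, e%:Z = a + N%:Z by exists (absz (a + N%:Z)); lia.
  by rewrite -eE /=; have -> : odd (N + e)%N = odd (absz a) by lia.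
case: ifP => ltN; last by rewrite mulr0.
have -> : ((N + N).-1 - (absz (a + N%:Z)%R + absz (b + N%:Z)%R) == 0)%N = false by lia.
by rewrite mulr0.
Qed.

(** The coefficient required has index 2k - 1 = (2N - 1) - 2r. The weights c_x are exactly what
    normalizes the pairing of mirror points to a sign. *)
Let gram_mid_mid a b : a \in window k -> b \in window k ->
  gram N (ufull a) (ufull b) = - (omega a b)%:~R.
Proof.
move=> ak bk; have [uR sR zR mR] := rem_window bk.
have [al au] : - k%:Z <= a /\ a < k%:Z by apply/andP; rewrite -mem_window.
have [bl bu] : - k%:Z <= b /\ b < k%:Z by apply/andP; rewrite -mem_window.
rewrite /ufull !ltNge al bl /= !leNgt au bu /= /ucov gramZr gramZl gram_Xn //.
have -> : (r + r < N + N)%N by rewrite /N; lia.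
have -> : ((N + N).-1 - (r + r) = (k + k).-1)%N by rewrite /N; lia.
rewrite neg_hseries_mul -/m.
have [ab|nab] := eqVneq (a + b) (-1); last first.
  (* For points that are not mirror images, two distinct factors of the window are cancelled and the
     degree drops to 2k - 2. *)
  rewrite omega_eq0 // oppr0.
  pose A := rem (- a - 1) (rem b (window k)).
  have aR : - a - 1 \in rem b (window k) by rewrite mR mem_window; lia.
  have uA : uniq A by rewrite !rem_uniq ?uniq_window.
  have sA : {subset A <= window w} by move=> i /mem_rem; exact: sR.
  rewrite (exp_powsum_pfac_sub uA sA); last first.
    move=> i; rewrite !addL1 mem_rem_uniq // inE mR addrACA base_shift_refl.
    have -> : (- i - 1 == a) = (i == - a - 1) by lia.
    have [->|ib] := eqVneq i b.
      by rewrite bk andbF; have -> : (b == - a - 1) = false by lia.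
    have [->|ia] := eqVneq i (- a - 1); last by rewrite !addr0 andbT.
    by have -> : - a - 1 \in window k by rewrite mem_window; lia.
  by rewrite fps_polyE coef_prod_pfac ?mulr0 // size_rem // zR; lia.
have aE : a = - b - 1 by lia.
have -> : E0 (fun i => addL m [:: b] i + addL m [:: a] (- i - 1)) =
    fps_poly (\prod_(x <- rem b (window k)) pfac s x) * E0 (fun i => (i == b)%:Z).
  rewrite -(@exp_powsum_pfac_sub _ (fun i => - (i \in rem b (window k))%:Z)) //.
  rewrite -exp_powsumD //; congr (fps_exp (powsum _ _ _)); apply/funext => i.
  rewrite !addL1 mR addrACA base_shift_refl.
  have -> : (- i - 1 == a) = (i == b) by lia.
  by have [->|ib] := eqVneq i b; rewrite ?bk ?andbT ?andbF /= ?addr0.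
rewrite exp_powsum_delta; last exact: sub_window.
(* When a = -b-1, both shifts hit b: one cancels its factor and the other leaves a geometric series.
   The coefficient is then a value of the reversed polynomial at s_b, by [sum_rev_poly]. *)
set A := rem b _ in zR *.
have -> : (fps_poly (\prod_(x <- A) pfac s x) * (fun j => s b ^+ j)) (k + k).-1 =
    \prod_(y <- A) (s b - s y).
  rewrite fpsM; have := @sum_rev_poly F _ A s (s b) (k + k).-1.
  by rewrite zR subnn mul1r leqnn => /(_ isT).
rewrite /A rem_filter ?uniq_window // big_filter.
rewrite aE mulrA cfac_refl //.
transitivity ((-1) ^+ (N + r) * \prod_(y <- window k | y != b) (if y < b then -1 else 1) : F).
  rewrite mulrCA; congr (_ * _); rewrite -big_split /=.
  rewrite big_seq_cond [RHS]big_seq_cond; apply: eq_bigr => y /andP[yk yb].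
  have := sdif_neq0 sinj (sub_window bk) (sub_window yk); rewrite eq_sym yb => /(_ isT).
  rewrite /sdif; case: ltgtP yb => // _ _ nz.
    exact: mulVf.
  rewrite -[s b - s y]opprB; transitivity (- ((s y - s b)^-1 * (s y - s b))).
    exact: mulrN.
  by rewrite mulVf.
(* The number of window elements below b, that is, of factors where [sdif] and s_b - s_y have
   opposite signs. *)
have [e eE] : exists e : nat, e%:Z = b + k%:Z by exists (absz (b + k%:Z)); lia.
have -> : \prod_(y <- window k | y != b) (if y < b then -1 else 1) = (-1) ^+ e :> F.
  transitivity (\prod_(y <- window k | y < b) (-1) : F).
    rewrite big_mkcond [RHS]big_mkcond; apply: eq_bigr => y _.
    by case: ltgtP.
  rewrite big_const_seq iter_mulr_1; congr (_ ^+ _).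
  rewrite /window count_map.
  pose P (x : nat) := x%:Z - k%:Z < b; rewrite (@eq_count _ _ P) //.
  have cP i : (i < count P (iota 0 (k + k)))%N = (i < e)%N.
    have -> : (i < e)%N = P i by rewrite /P; lia.
    by apply: count_initial => j; rewrite /P; lia.
  by apply: anti_leq; rewrite leqNgt cP ltnn leqNgt -cP ltnn.
have -> : omega (- b - 1) b = (-1) ^+ odd (absz (- b - 1)).
  by rewrite /omega; have -> : - b - 1 + b == -1 by lia.
rewrite -exprD rmorphXn rmorphN1 -[RHS]mulN1r -exprS -[LHS]signr_odd -[RHS]signr_odd.
congr (_ ^+ _); rewrite /N; have : odd (absz (- b - 1)) = ~~ odd (e + k) by lia.
by move=> /= ->; rewrite /= !oddD; case: (odd r); case: (odd k); case: (odd e).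
Qed.

Lemma gram_ufull a b : a \in window N -> b \in window N ->
  gram N (ufull a) (ufull b) = - (omega a b)%:~R.
Proof.
wlog ab : a b / a <= b.
  move=> hw aN bN; have [ab|/ltW ba] := leP a b; first exact: hw.
  by rewrite gram_swap hw // omega_swap rmorphN /= opprK.
move=> aN bN; have [bk|bk] := ltP b (- k%:Z).
  by rewrite gram_base_base ?omega_eq0 ?oppr0 //; lia.
have [kb|kb] := leP k%:Z b; last first.
  have bw : b \in window k by rewrite mem_window bk kb.
  have [ak|ak] := ltP a (- k%:Z).
    by rewrite gram_base_mid ?omega_eq0 ?oppr0 //; lia.
  by apply: gram_mid_mid => //; rewrite mem_window ak (le_lt_trans ab).
have [ak|ak] := ltP a (- k%:Z); first exact: gram_base_top.
rewrite omega_eq0 ?oppr0; last by lia.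
rewrite mem_window in bN.
have [c [e [f [re ->]]]] : exists c e f, (r <= e)%N /\
    ufull a = fps_poly c%:P * (fps_poly 'X^e * f).
  rewrite /ufull ltNge ak /=; case: leP => ka; last by do 3 eexists; split; last by [].
  by do 3 eexists; split; last by []; lia.
rewrite /ufull; have -> : (b < - k%:Z) = false by lia.
rewrite kb gramZl gramZr gram_Xn //.
have -> : (e + absz (b + N%:Z)%R < N + N)%N = false by rewrite /N in bN *; lia.
by rewrite !mulr0.
Qed.
End LagrangeCore.

(** With A the matrix of the covectors, A Om A^T = -Om and Om^2 = -1 exhibit a right inverse of A;
    being also a left inverse, it yields A^T Om A = -Om. *)
Lemma gram_dual (F : fieldType) N (U : int -> fps F) :
  {in window N &, forall a b, gram N (U a) (U b) = - (omega a b)%:~R} ->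
  {in window N &, forall p q,
    \sum_(a <- window N) \sum_(b <- window N)
      (omega a b)%:~R * (cov N (U a) p * cov N (U b) q) = - (omega p q)%:~R}.
Proof.
move=> gU; pose x (i : 'I_(N + N)) := i%:Z - N%:Z.
have xw i : x i \in window N by rewrite mem_window /x; have := ltn_ord i; lia.
pose A := \matrix_(i, j) cov N (U (x i)) (x j) : 'M[F]_(N + N).
pose Om := \matrix_(i, j) (omega (x i) (x j))%:~R : 'M[F]_(N + N).
have OmOm : Om *m Om = - 1%:M.
  apply/matrixP => i l; rewrite !mxE (bigD1 (rev_ord i)) //= !mxE !omega_shift eqxx.
  rewrite big1 ?addr0 => [|j nj]; last by rewrite !mxE omega_shift (negbTE nj) mul0r.
  rewrite rev_ordK eq_sym; case: eqP => _; last by rewrite mulr0 oppr0.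
  rewrite !rmorphXn !rmorphN1 -exprD /= -signr_odd.
  by have -> : odd (N + i + (N + (N + N - i.+1)))%N by have := ltn_ord i; lia.
have AOA : A *m Om *m A^T = - Om.
  apply/matrixP => i l; have := gU (x i) (x l) (xw i) (xw l).
  rewrite !mxE => <-; rewrite /gram sum_window exchange_big.
  rewrite sum_window; apply: eq_bigr => j _.
  rewrite !mxE mulr_suml; apply: eq_bigr => p _.
  by rewrite !mxE -/(x p) -/(x j); ring.
have inv : A *m (Om *m A^T *m Om) = 1%:M.
  by rewrite !mulmxA AOA mulNmx OmOm opprK.
have AOA' : A^T *m Om *m A = - Om.
  have := mulmx1C inv => /(congr1 (mulmx Om)); rewrite !mulmxA OmOm mulmx1.
  by rewrite !mulNmx mul1mx => /eqP; rewrite eqr_oppLR => /eqP.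
move=> p q pw qw.
have [i pE] : exists i, p = x i.
  rewrite mem_window in pw; have iN : (absz (p + N%:Z)%R < N + N)%N by lia.
  by exists (Ordinal iN); rewrite /x /=; lia.
have [j qE] : exists j, q = x j.
  rewrite mem_window in qw; have jN : (absz (q + N%:Z)%R < N + N)%N by lia.
  by exists (Ordinal jN); rewrite /x /=; lia.
have := congr1 (fun M : 'M_(N + N) => M i j) AOA'; rewrite !mxE -pE -qE => <-.
rewrite exchange_big sum_window; apply: eq_bigr => b _.
rewrite !mxE mulr_suml sum_window; apply: eq_bigr => a _.
by rewrite !mxE -/(x a) -/(x b) pE qE; ring.
Qed.

(** * Contraction with omega in the new basis *)

Section LagrangeTheorem.
Variables (F : fieldType) (w : nat) (s : int -> F) (t : nat -> F).
Hypothesis natF0 : forall k, k.+1%:R != 0 :> F.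
Hypothesis sinj : {in window w &, injective s}.
Hypothesis sodd : forall i, s (- i - 1) = - s i.
Hypothesis teven : forall j, ~~ odd j -> t j = 0.
Variables (r k : nat) (phi : seq nat -> F) (n : int -> int).
Hypothesis kw : (k <= w)%N.
Hypothesis k2 : (2 <= k)%N.
Hypothesis nB : forall i, n (- i - 1) = - n i.
Let N := (r + k)%N.
Hypothesis om : forall L, size L = N.-2 -> {subset L <= window N} ->
  \sum_(p <- window N) \sum_(q <- window N) (omega p q)%:~R * pit phi (p :: q :: L) = 0.

Let U := ufull w s t r k n.
Let h := hval w s t r k phi n.

Lemma wedge_cons2 f g rest :
  wedge N phi (f :: g :: rest) = \sum_(p <- window N) \sum_(q <- window N)
    (cov N f p * cov N g q) *
    mlext (window N) (fun L => pit phi (p :: q :: L)) (map (cov N) rest).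
Proof.
rewrite /wedge /=; apply: eq_bigr => p _; rewrite mulr_sumr.
by apply: eq_bigr => q _; rewrite mulrA.
Qed.

(** By [gram_dual] the bivector sum of omega(a,b) U_a U_b is minus the standard one, so the
    contraction is reduced to the one that vanishes by hypothesis. *)
Lemma sum_omega_wedge rest : size rest = N.-2 ->
  \sum_(a <- window N) \sum_(b <- window N)
    (omega a b)%:~R * wedge N phi (U a :: U b :: rest) = 0.
Proof.
move=> srest.
pose B p q := mlext (window N) (fun L => pit phi (p :: q :: L)) (map (cov N) rest).
have B0 : \sum_(p <- window N) \sum_(q <- window N) (omega p q)%:~R * B p q = 0.
  rewrite -[RHS](mlext0 (window N) (map (cov N) rest)).
  under eq_bigr => p _ do under eq_bigr => q _ do rewrite -mlextZ.
  under eq_bigr => p _ do rewrite -mlext_sum.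
  rewrite -mlext_sum; apply: eq_mlext => L sL subL; apply: om => //.
  by rewrite sL size_map.
have dual := gram_dual (@gram_ufull F w s t natF0 sinj sodd teven r k n kw k2 nB).
rewrite -[RHS]oppr0 -[in RHS]B0 -sumrN.
transitivity (\sum_(p <- window N) \sum_(q <- window N) (\sum_(a <- window N)
   \sum_(b <- window N) (omega a b)%:~R * (cov N (U a) p * cov N (U b) q)) * B p q).
  transitivity (\sum_(a <- window N) \sum_(p <- window N) \sum_(q <- window N)
      \sum_(b <- window N) (omega a b)%:~R * (cov N (U a) p * cov N (U b) q) * B p q).
    apply: eq_bigr => a _.
    under [RHS]eq_bigr => p _ do rewrite exchange_big.
    rewrite [RHS]exchange_big; apply: eq_bigr => b _ /=.
    rewrite wedge_cons2 mulr_sumr; apply: eq_bigr => p _.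
    by rewrite mulr_sumr; apply: eq_bigr => q _; rewrite mulrA.
  rewrite exchange_big; apply: eq_bigr => p _ /=.
  rewrite exchange_big; apply: eq_bigr => q _ /=.
  by rewrite mulr_suml; apply: eq_bigr => a _; rewrite mulr_suml.
apply: eq_big_seq => p pw; rewrite -sumrN; apply: eq_big_seq => q qw.
by rewrite dual // mulNr.
Qed.

Lemma hval_lagr_sum L : size L = k.-2 -> {subset L <= window k} ->
  \sum_(p <- window k) \sum_(q <- window k)
    (omega p q)%:~R * ((sgnL (p :: q :: L))%:~R * h (lamL (p :: q :: L))) = 0.
Proof.
move=> sL subL.
pose B := ubase w s t r k n; pose u := ucov w s t r k n.
have sB : size B = r by rewrite size_map size_iota.
have srest : size (B ++ map u L) = N.-2 by rewrite size_cat sB size_map sL /N; lia.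
have := sum_omega_wedge srest.
have Ubase a : a \in window N -> a < - k%:Z -> exists A B', B = A ++ U a :: B'.
  rewrite mem_window => /andP[aN _] ak.
  have [j jE] : exists j : nat, j%:Z = a + N%:Z by exists (absz (a + N%:Z)); lia.
  have jr : (j < r)%N by rewrite /N in jE; lia.
  have jB : (j < size B)%N by rewrite sB.
  exists (take j B), (drop j.+1 B); rewrite {1}(cat_rem_at 0 jB); congr (_ ++ _ :: _).
  rewrite /B /ubase (nth_map 0%N) ?size_iota // nth_iota // add0n.
  by rewrite /U /ufull ak -jE.
have Umid a : a \in window k -> U a = u a.
  rewrite mem_window /U /ufull => /andP[a1 a2].
  by rewrite ltNge a1 leNgt a2.
have W0 a b : a \in window N -> b \in window N -> (a \notin window k) || (b \notin window k) ->
    (omega a b)%:~R * wedge N phi (U a :: U b :: B ++ map u L) = 0.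
  (* If a + b = -1 and one index lies outside the window of k, then one of them is below -k, and its
     covector already occurs in [B]. *)
  move=> aN bN abk; have [ab|ab] := eqVneq (a + b) (-1); last first.
    by rewrite omega_eq0 // mul0r.
  have alt := @adjalt_wedge F N phi N; have two0 := eqN_eq0 natF0.
  have sz : size (U a :: U b :: B ++ map u L) = N by rewrite /= srest /N; lia.
  suff -> : wedge N phi (U a :: U b :: B ++ map u L) = 0 by rewrite mulr0.
  have [ak|ak] := ltP a (- k%:Z).
    have [A [B' BE]] := Ubase a aN ak; move: sz; rewrite BE -catA => sz.
    exact: (@adjalt_repeat _ _ N _ [::] (U a) (U b :: A) _ two0 alt sz).
  have bk : b < - k%:Z by move: abk; rewrite !mem_window; lia.
  have [A [B' BE]] := Ubase b bN bk; move: sz; rewrite BE -catA => sz.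
  exact: (@adjalt_repeat _ _ N _ [:: U a] (U b) A _ two0 alt sz).
have kN : (k <= N)%N by exact: leq_addl.
have kNw : {subset window k <= window N} by move=> p; rewrite !mem_window; lia.
rewrite (big_window_sub _ kN); last first.
  by move=> a aN ak; rewrite big_seq big1 // => b bN; rewrite W0 ?ak.
rewrite big_seq => E.
transitivity (kappa w s k n * \sum_(p <- window k | p \in window k) \sum_(q <- window N)
    (omega p q)%:~R * wedge N phi (U p :: U q :: B ++ map u L)); last by rewrite E mulr0.
rewrite mulr_sumr [LHS]big_seq; apply: eq_bigr => p pk.
rewrite (big_window_sub _ kN); last first.
  by move=> b bN bk; rewrite W0 ?bk ?orbT //; exact: kNw.
rewrite mulr_sumr [LHS]big_seq [RHS]big_seq; apply: eq_bigr => q qk.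
have subpq : {subset p :: q :: L <= window k}.
  by move=> x; rewrite !inE => /or3P[/eqP->|/eqP->|/subL].
rewrite /h (hval_wedge t natF0 sinj r phi n kw); first last.
- by move=> x /subpq; rewrite mem_window => /andP[].
- by move=> x /subpq; rewrite !mem_window; lia.
- by rewrite /= sL; lia.
rewrite mulrCA; congr (_ * (_ * _)); rewrite !Umid //= -/B -/u.
have alt := @adjalt_wedge F N phi N.
(* Moving [u p] and [u q] in front of [B] costs r and r + 1 exchanges, and one more restores their
   order: an even number in all. *)
have szw : size (B ++ u p :: u q :: map u L) = N.
  by rewrite size_cat /= size_map sL sB /N; lia.
rewrite (adjalt_move alt szw) -[u p :: B ++ _]/((u p :: B) ++ u q :: map u L).
rewrite (adjalt_move alt) /=; last first.
  by move: szw; rewrite /= !size_cat /=; lia.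
rewrite (alt [::] (u q)) /=; last first.
  by move: szw; rewrite /= !size_cat /=; lia.
by rewrite !mulrN mulrA -exprD addnS exprS mulN1r mulNr opprK addnn -mul2n exprM sqrrN !expr1n mul1r.
Qed.
End LagrangeTheorem.

(** * Truncated power series as polynomials *)

Lemma nth_rstrip s a : nth 0%N (rstrip s) a = nth 0%N s a.
Proof.
elim: s a => //= x s IH a; case: ifP => [/andP[/eqP -> /eqP e]|_].
  by rewrite nth_nil; case: a => //= a; rewrite -IH e nth_nil.
by case: a.
Qed.

Lemma size_rstrip s : (size (rstrip s) <= size s)%N.
Proof. by elim: s => //= x s IH; case: ifP => //= _; rewrite ltnS. Qed.

Lemma rstrip_eq s u : (forall a, nth 0%N s a = nth 0%N u a) -> rstrip s = rstrip u.
Proof.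
have nil0 l : (forall a, nth 0%N l a = 0%N) -> rstrip l = [::].
  elim: l => //= x l IH h; rewrite (IH (fun a => h a.+1)) eqxx andbT.
  by rewrite (h 0%N : x = 0%N).
elim: s u => [|x s IH] [|y u] h //.
- by rewrite [RHS]nil0 // => a; rewrite -h nth_nil.
- by rewrite [LHS]nil0 // => a; rewrite h nth_nil.
by rewrite /= (h 0%N : x = y) (IH u) // => a; exact: (h a.+1).
Qed.

Lemma rstrip_id s : rstrip (rstrip s) = rstrip s.
Proof. by apply: rstrip_eq => a; rewrite nth_rstrip. Qed.

Lemma cm_id m : cm (cm m) = cm m.
Proof. by rewrite /cm /= !rstrip_id. Qed.

Lemma lesubsP s u : reflect (size u = size s /\ forall a, (nth 0 u a <= nth 0 s a)%N)
  (u \in lesubs s).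
Proof.
elim: s u => [|x s IH] u.
  rewrite [lesubs _]/= inE; apply: (iffP eqP) => [->|[/size0nil]] //.
apply: (iffP flatten_mapP) => [[y + /mapP[r /IH[sr rs] ->]]|].
  by rewrite mem_iota => yx; split=> [|[|a]] //=; rewrite ?sr //; lia.
case: u => [[]//|y r] [/eqP]; rewrite eqSS => /eqP sr h; exists y.
  by have := h 0%N; rewrite mem_iota add0n ltnS.
by apply/mapP; exists r => //; apply/IH; split=> // a; exact: (h a.+1).
Qed.

Lemma uniq_lesubs s : uniq (lesubs s).
Proof.
elim: s => // x s IH.
apply: (@allpairs_uniq_dep _ (fun=> seq nat) _ cons) => [||]; first exact: iota_uniq.
  by move=> y _.
by move=> [p r] [p' r'] _ _ /= [-> ->].
Qed.

Lemma nth_subn_seq s u a : size u = size s ->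
  nth 0%N (subn_seq s u) a = (nth 0%N s a - nth 0%N u a)%N.
Proof.
move=> su; have [sa|sa] := ltnP a (size s).
  by rewrite (nth_map (0%N, 0%N)) ?size_zip ?su ?minnn // nth_zip.
by rewrite !nth_default ?size_map ?size_zip ?su ?minnn.
Qed.

Section Monomials.
Variable v : nat.
Implicit Types (k : 'X_{1..v + v}) (f g : ps).

(** The first v variables are y_1, ..., y_v, the last v are t_1, t_3, ..., t_(2v-1). Exponents
    beyond v are dropped, whence the predicate [small]. *)
Definition mnm_of (m : mono) : 'X_{1..v + v} :=
  [multinom match split i with inl j => nth 0%N m.1 j | inr j => nth 0%N m.2 j end | i < v + v].

Definition mono_of k : mono :=
  ([seq k (lshift v j) | j <- enum 'I_v], [seq k (rshift v j) | j <- enum 'I_v]).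

Definition small (m : mono) := (size m.1 <= v)%N && (size m.2 <= v)%N.

Lemma mnm_of_l m (j : 'I_v) : mnm_of m (lshift v j) = nth 0%N m.1 j.
Proof. by rewrite mnmE -[lshift v j]/(unsplit (inl j)) unsplitK. Qed.

Lemma mnm_of_r m (j : 'I_v) : mnm_of m (rshift v j) = nth 0%N m.2 j.
Proof. by rewrite mnmE -[rshift v j]/(unsplit (inr j)) unsplitK. Qed.

Lemma mnm_split_eq k1 k2 : (forall j : 'I_v, k1 (lshift v j) = k2 (lshift v j)) ->
  (forall j : 'I_v, k1 (rshift v j) = k2 (rshift v j)) -> k1 = k2.
Proof.
by move=> hl hr; apply/mnmP => i; rewrite -(splitK i); case: (split i).
Qed.

Lemma nth_mono_of1 k (j : 'I_v) : nth 0%N (mono_of k).1 j = k (lshift v j).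
Proof. by rewrite (nth_map j) ?size_enum_ord // nth_ord_enum. Qed.
Lemma nth_mono_of2 k (j : 'I_v) : nth 0%N (mono_of k).2 j = k (rshift v j).
Proof. by rewrite (nth_map j) ?size_enum_ord // nth_ord_enum. Qed.

Lemma mono_ofK k : mnm_of (mono_of k) = k.
Proof.
by apply: mnm_split_eq => j; rewrite ?mnm_of_l ?mnm_of_r ?nth_mono_of1 ?nth_mono_of2.
Qed.

Lemma cm_mono_of m : small m -> cm (mono_of (mnm_of m)) = cm m.
Proof.
case/andP => s1 s2; rewrite /cm; congr (_, _); apply: rstrip_eq => a.
  have [av|av] := ltnP a v; first by rewrite (nth_mono_of1 _ (Ordinal av)) mnm_of_l.
  rewrite [RHS]nth_default; last exact: leq_trans s1 av.
  by rewrite nth_default // size_map size_enum_ord.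
have [av|av] := ltnP a v; first by rewrite (nth_mono_of2 _ (Ordinal av)) mnm_of_r.
rewrite [RHS]nth_default; last exact: leq_trans s2 av.
by rewrite nth_default // size_map size_enum_ord.
Qed.

Definition mcoef f k : C := coef f (mono_of k).

Lemma coefE f m : small m -> coef f m = mcoef f (mnm_of m).
Proof. by move=> sm; rewrite /mcoef /coef cm_mono_of. Qed.

Lemma coef_cm f m : coef f (cm m) = coef f m.
Proof. by rewrite /coef cm_id. Qed.

Lemma mcoef_add f g k : mcoef (ps_add f g) k = mcoef f k + mcoef g k.
Proof. by rewrite /mcoef {1}/coef /ps_add !coef_cm. Qed.

Lemma mcoef_scale c f k : mcoef (ps_scale c f) k = c * mcoef f k.
Proof. by rewrite /mcoef {1}/coef /ps_scale coef_cm. Qed.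

Lemma mcoef0 k : mcoef ps0 k = 0. Proof. by []. Qed.

Lemma mnm_of_cm m : mnm_of (cm m) = mnm_of m.
Proof. by apply: mnm_split_eq => j; rewrite ?mnm_of_l ?mnm_of_r nth_rstrip. Qed.

Lemma mcoef_mono m k : small m -> mcoef (ps_mono m) k = (mnm_of m == k)%:R.
Proof.
move=> sm; rewrite /mcoef /coef /ps_mono cm_id.
have -> : (cm (mono_of k) == cm m) = (mnm_of m == k); last by case: eqP.
apply/eqP/eqP => [e|<-]; last by rewrite cm_mono_of.
by rewrite -mnm_of_cm -e mnm_of_cm mono_ofK.
Qed.

Lemma small_mono_of k : small (mono_of k).
Proof. by apply/andP; split; rewrite size_map size_enum_ord. Qed.

Lemma small_cm m : small m -> small (cm m).
Proof. by case/andP => s1 s2; rewrite /small !(leq_trans (size_rstrip _)). Qed.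

(** Divisors of a stripped monomial, enumerated as short lists, correspond to multinomials below k
    by padding with zeros. *)
Lemma mcoef_mul f g k :
  mcoef (ps_mul f g) k =
  \sum_(k1 : bmultinom (v + v) (mdeg k).+1 | (k1 <= k)%MM) mcoef f k1 * mcoef g (k - k1)%MM.
Proof.
rewrite /mcoef {1}/coef /ps_mul cm_id.
set m := cm (mono_of k).
have sm : small m by apply: small_cm; exact: small_mono_of.
have mk : mnm_of m = k by rewrite mnm_of_cm mono_ofK.
have [s1 s2] : (size m.1 <= v)%N /\ (size m.2 <= v)%N by apply/andP.
transitivity (\sum_(u <- lesubs m.1) \sum_(x <- lesubs m.2)
    mcoef f (mnm_of (u, x)) * mcoef g (k - mnm_of (u, x))%MM).
  apply: eq_big_seq => u /lesubsP[su ule]; apply: eq_big_seq => x /lesubsP[sx xle].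
  rewrite coefE; last by rewrite /small /= su sx s1 s2.
  congr (_ * _); rewrite coefE; last first.
    by rewrite /small /= /subn_seq !size_map !size_zip su sx !minnn s1 s2.
  congr (mcoef g _); rewrite -mk; apply: mnm_split_eq => j; rewrite mnmBE ?mnm_of_l ?mnm_of_r /=.
    by rewrite nth_subn_seq.
  by rewrite nth_subn_seq.
pose G (x : 'X_{1..v + v}) := mcoef f x * mcoef g (k - x)%MM.
transitivity (\sum_(x <- [seq mnm_of (u, x) | u <- lesubs m.1, x <- lesubs m.2]) G x).
  by rewrite big_allpairs_dep.
rewrite -[RHS]big_filter -[RHS](big_map (@bmnm _ _) xpredT G).
apply: perm_big; apply: uniq_perm.
- apply: allpairs_uniq; rewrite ?uniq_lesubs // => -[u x] [u' x'].
  move=> /allpairsP[[a b] [/= /lesubsP[sa _] /lesubsP[sb _] [-> ->]]].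
  move=> /allpairsP[[a' b'] [/= /lesubsP[sa' _] /lesubsP[sb' _] [-> ->]]] e.
  have [ea eb] : a = a' /\ b = b'; last by rewrite ea eb.
  split; apply: (@eq_from_nth _ 0%N); rewrite ?sa ?sb ?sa' ?sb' // => i im.
    have iv := leq_trans im s1.
    by have := congr1 (fun M : 'X_{1..v + v} => M (lshift v (Ordinal iv))) e; rewrite !mnm_of_l.
  have iv := leq_trans im s2.
  by have := congr1 (fun M : 'X_{1..v + v} => M (rshift v (Ordinal iv))) e; rewrite !mnm_of_r.
- rewrite map_inj_uniq; last exact: val_inj.
  by rewrite filter_uniq // index_enum_uniq.
move=> x; apply/allpairsP/mapP => [[[u y] [/= /lesubsP[su ule] /lesubsP[sy yle] ->]]|[b]].
  have le : (mnm_of (u, y) <= k)%MM.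
    rewrite -mk; apply/mnm_lepP => i; rewrite !mnmE; case: (split i) => j; exact: ule || exact: yle.
  have lt : (mdeg (mnm_of (u, y)) < (mdeg k).+1)%N.
    by rewrite ltnS !mdegE; apply: leq_sum => i _; exact: (mnm_lepP le).
  by exists (BMultinom lt) => //; rewrite mem_filter le mem_index_enum.
rewrite mem_filter => /andP[/mnm_lepP le _] ->.
(* Cut to the lengths of the stripped monomial, as [lesubs] demands; the entries dropped are 0
   because b <= k. *)
exists ([seq nth 0%N (mono_of b).1 a | a <- iota 0 (size m.1)],
        [seq nth 0%N (mono_of b).2 a | a <- iota 0 (size m.2)]).
have trunc_nth l1 l2 : (size l2 <= v)%N -> (forall a, nth 0 l1 a <= nth 0 l2 a)%N ->
    forall a, nth 0%N [seq nth 0%N l1 a | a <- iota 0 (size l2)] a = nth 0%N l1 a.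
  move=> sl l12 a; have [al|al] := ltnP a (size l2).
    by rewrite (nth_map 0%N) ?size_iota // nth_iota.
  by rewrite nth_default ?size_map ?size_iota //; have := l12 a; rewrite (nth_default _ al); lia.
have bk : (forall a, nth 0 (mono_of b).1 a <= nth 0 m.1 a)%N /\
          (forall a, nth 0 (mono_of b).2 a <= nth 0 m.2 a)%N.
  split=> a; have [av|av] := ltnP a v.
  - by rewrite (nth_mono_of1 b (Ordinal av)) -(mnm_of_l m (Ordinal av)) mk.
  - by rewrite nth_default // size_map size_enum_ord.
  - by rewrite (nth_mono_of2 b (Ordinal av)) -(mnm_of_r m (Ordinal av)) mk.
  - by rewrite nth_default // size_map size_enum_ord.
have [b1 b2] := bk.
have h1 := trunc_nth _ _ s1 b1; have h2 := trunc_nth _ _ s2 b2.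
split.
- by apply/lesubsP; rewrite size_map size_iota; split=> // a; rewrite h1.
- by apply/lesubsP; rewrite size_map size_iota; split=> // a; rewrite h2.
rewrite -[LHS]mono_ofK; apply: mnm_split_eq => j; rewrite ?mnm_of_l ?mnm_of_r /=.
  by rewrite h1.
by rewrite h2.
Qed.
End Monomials.

Section Weight.
Variable v : nat.
Implicit Types (k : 'X_{1..v + v}).

Definition mweight k : nat :=
  (\sum_(j < v) k (lshift v j) + \sum_(j < v) j.*2.+1 * k (rshift v j))%N.

Lemma mweightD k1 k2 : mweight (k1 + k2)%MM = (mweight k1 + mweight k2)%N.
Proof.
rewrite /mweight addnACA; congr (_ + _)%N; rewrite -big_split; apply: eq_bigr => j _.
  by rewrite mnmDE.
by rewrite mnmDE mulnDr.
Qed.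

Lemma mweight_sub k1 k : (k1 <= k)%MM -> mweight k = (mweight k1 + mweight (k - k1)%MM)%N.
Proof. by move=> le; rewrite -mweightD addmC submK. Qed.

Lemma sum_ord_widen n m (G : nat -> nat) : (n <= m)%N ->
  (forall a, (n <= a)%N -> G a = 0%N) -> (\sum_(a < n) G a = \sum_(a < m) G a)%N.
Proof.
move=> nm G0; rewrite -(big_mkord xpredT G) -[RHS](big_mkord xpredT G).
rewrite [RHS](big_cat_nat (leq0n _) nm) /= [X in (_ + X)%N]big_nat.
by rewrite [X in (_ + X)%N]big1 ?addn0 // => a /andP[/G0].
Qed.

Lemma wdeg_small m : small v m -> wdeg m = mweight (mnm_of v m).
Proof.
case/andP=> s1 s2; rewrite /wdeg /mweight; congr (_ + _)%N.
  rewrite sumnE (big_nth 0%N) big_mkord.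
  rewrite (@sum_ord_widen _ _ (nth 0%N m.1) s1) => [|a]; last exact: nth_default.
  by apply: eq_bigr => j _; rewrite mnm_of_l.
rewrite (@sum_ord_widen _ _ (fun a => a.*2.+1 * nth 0 m.2 a)%N s2) => [|a sa]; last first.
  by rewrite nth_default ?muln0.
by apply: eq_bigr => j _; rewrite mnm_of_r.
Qed.

Lemma wdeg_mono_of k : wdeg (cm (mono_of k)) = mweight k.
Proof.
by rewrite wdeg_small ?mnm_of_cm ?mono_ofK // small_cm // small_mono_of.
Qed.
End Weight.

(** * Truncated series represented in a fraction field *)

Section Representation.
Variables (v d : nat).
Notation M := {mpoly C[v + v]}.
Notation K := {fraction M}.
Implicit Types (f g : ps) (p q : M) (x y : K) (k : 'X_{1..v + v}).

(* Series in infinitely many variables are only seen through the monomials in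
   y_1, ..., y_v, t_1, t_3, ..., t_(2v-1) of weighted degree at most d. *)
Definition agree f p := forall k, (mweight k <= d)%N -> mcoef f k = p@_k.

Definition cst : C -> K := @tofrac M \o @mpolyC (v + v) C.
HB.instance Definition _ := GRing.RMorphism.copy cst (@tofrac M \o @mpolyC (v + v) C).

(** Not functional: terms of weight above d are free in the representative. Relations must therefore
    be proved exactly between chosen representatives. *)
Definition rep f x := exists2 p, agree f p & x = tofrac p.

Lemma rep_ext f g x : (forall k, (mweight k <= d)%N -> mcoef f k = mcoef g k) ->
  rep g x -> rep f x.
Proof. by move=> fg [p gp ->]; exists p => // k kd; rewrite fg // gp. Qed.

Lemma rep0 : rep ps0 0.
Proof. by exists 0; rewrite ?rmorph0 // => k _; rewrite mcoef0 mcoeff0. Qed.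

Lemma rep_add f g x y : rep f x -> rep g y -> rep (ps_add f g) (x + y).
Proof.
move=> [p fp ->] [q gq ->]; exists (p + q); last by rewrite rmorphD.
by move=> k kd; rewrite mcoef_add mcoeffD fp ?gq.
Qed.

Lemma rep_scale c f x : rep f x -> rep (ps_scale c f) (cst c * x).
Proof.
move=> [p fp ->]; exists (c%:MP * p); last by rewrite rmorphM.
by move=> k kd; rewrite mcoef_scale mcoeffCM fp.
Qed.

Lemma rep_opp f x : rep f x -> rep (ps_opp f) (- x).
Proof. by move=> /(rep_scale (-1)); rewrite rmorphN1 mulN1r. Qed.

(** The weight is additive, so a coefficient of weight at most d involves only such coefficients of
    the factors. *)
Lemma rep_mul f g x y : rep f x -> rep g y -> rep (ps_mul f g) (x * y).
Proof.
move=> [p fp ->] [q gq ->]; exists (p * q); last by rewrite rmorphM.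
move=> k kd; rewrite mcoef_mul; have := mcoeff_poly_mul_lin p q (ltnSn (mdeg k)).
move=> e; rewrite -[(p * q)@_k]/((mpoly_mul p q)@_k) e; apply: eq_bigr => k1 le.
by have := mweight_sub le => kE; rewrite fp ?gq //; lia.
Qed.

Lemma rep_mono m : small v m -> rep (ps_mono m) (tofrac 'X_[mnm_of v m]).
Proof.
move=> sm; exists 'X_[mnm_of v m] => // k _.
by rewrite mcoef_mono // mcoeffX.
Qed.

Lemma rep1 : rep ps1 1.
Proof.
have := @rep_mono ([::], [::]) isT; rewrite (_ : mnm_of v _ = 0%MM).
  by rewrite mpolyX0 rmorph1.
by apply: mnm_split_eq => j; rewrite ?mnm_of_l ?mnm_of_r mnm0E nth_nil.
Qed.

Lemma rep_sum (I : eqType) (s : seq I) (f : I -> ps) (x : I -> K) :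
  {in s, forall i, rep (f i) (x i)} ->
  rep (ps_sum [seq f i | i <- s]) (\sum_(i <- s) x i).
Proof.
elim: s => [|i s IH] h; first by rewrite big_nil; exact: rep0.
rewrite big_cons; apply: rep_add; first by apply: h; rewrite mem_head.
by apply: IH => j js; apply: h; rewrite inE js orbT.
Qed.

Lemma rep_prod (I : eqType) (s : seq I) (f : I -> ps) (x : I -> K) :
  {in s, forall i, rep (f i) (x i)} ->
  rep (ps_prod [seq f i | i <- s]) (\prod_(i <- s) x i).
Proof.
elim: s => [|i s IH] h; first by rewrite big_nil; exact: rep1.
rewrite big_cons; apply: rep_mul; first by apply: h; rewrite mem_head.
by apply: IH => j js; apply: h; rewrite inE js orbT.
Qed.

Lemma rep_exp f x e : rep f x -> rep (ps_exp f e) (x ^+ e).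
Proof.
move=> fx; elim: e => [|e IH]; first exact: rep1.
by rewrite exprS; apply: rep_mul.
Qed.

Lemma rep_eq0 f m : small v m -> (wdeg m <= d)%N -> rep f 0 -> coef f m = 0.
Proof.
move=> sm wm [p fp /esym/eqP]; rewrite tofrac_eq0 => /eqP p0.
by rewrite (coefE _ sm) fp ?p0 ?mcoeff0 // -wdeg_small.
Qed.

(** Indexed from 0: this is y_(a+1). Accordingly [xvar i] is y_(i+1) for i >= 0 and -y_(-i) for i <
    0. *)
Definition yvar (a : nat) : K :=
  if (a < v)%N then tofrac 'X_[mnm_of v (rcons (nseq a 0%N) 1%N, [::])] else 0.

Definition xvar (i : int) : K := if 0 <= i then yvar (absz i) else - yvar (absz i).-1.

Definition tvar (j : nat) : K :=
  if odd j && (j./2 < v)%N then tofrac 'X_[mnm_of v ([::], rcons (nseq j./2 0%N) 1%N)] else 0.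

Lemma mnm_of_Xn a e (i : 'I_(v + v)) : (a < v)%N ->
  mnm_of v (rcons (nseq a 0%N) e, [::]) i = (if i == a :> nat then e else 0)%N.
Proof.
move=> av; rewrite mnmE -{2}(splitK i); case: (split i) => j /=.
  rewrite nth_rcons size_nseq nth_nseq if_same; case: ltngtP => // ja.
rewrite nth_nil; case: eqP => // e1; exfalso; lia.
Qed.

Lemma rep_ypow a e : (a < v)%N -> rep (y_pow a.+1 e) (yvar a ^+ e).
Proof.
move=> av; rewrite /y_pow /yvar av /=.
have sm e' : small v (rcons (nseq a 0%N) e', [::]).
  by rewrite /small /= size_rcons size_nseq av.
have := rep_mono (sm e); rewrite -rmorphXn mpolyXn; congr (rep _ (tofrac 'X_[_])).
by apply/mnmP => i; rewrite mulmnE !mnm_of_Xn //; case: eqP; rewrite ?mul1n.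
Qed.

Lemma rep_sig_pow i e : i \in window v -> rep (sig_pow i e) (xvar i ^+ e).
Proof.
rewrite mem_window => iv; rewrite /sig_pow /xvar; case: ifP => i0.
  by apply: rep_ypow; lia.
have -> : absz i = (absz i).-1.+1 by lia.
rewrite [(- yvar _) ^+ e]exprNn; have <- : cst ((-1) ^+ e) = (-1) ^+ e by rewrite rmorphXn rmorphN1.
by apply: rep_scale; apply: rep_ypow; lia.
Qed.

Lemma xvar_refl i : xvar (- i - 1) = - xvar i.
Proof.
rewrite /xvar; have [i0|i0] := lerP 0 i.
  have -> : (0 <= - i - 1) = false by lia.
  by have -> : (absz (- i - 1)).-1 = absz i by lia.
have -> : (0 <= - i - 1) by lia.
by rewrite opprK; have -> : absz (- i - 1) = (absz i).-1 by lia.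
Qed.

Lemma tvar_even j : ~~ odd j -> tvar j = 0.
Proof. by rewrite /tvar => /negbTE ->. Qed.

(** A time t_j with j > 2v occurs in none of the monomials that are tested, so 0 represents it. *)
Lemma rep_tvar j : odd j -> rep (t_var j) (tvar j).
Proof.
move=> oj; rewrite /tvar oj /=; case: ltnP => jv.
  by apply: rep_mono; rewrite /small /= size_rcons size_nseq jv.
exists 0; last by rewrite rmorph0.
move=> k _; rewrite mcoeff0 /mcoef /coef /t_var /ps_mono cm_id.
case: eqP => // e; exfalso.
have := congr1 (fun m : mono => nth 0%N m.2 j./2) e; rewrite /= !nth_rstrip.
rewrite nth_rcons size_nseq ltnn eqxx nth_default //.
by rewrite size_map size_enum_ord.
Qed.
End Representation.

Section GenericPoint.
Variable v : nat.

Lemma natK0 k : k.+1%:R != 0 :> {fraction {mpoly C[v + v]}}.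
Proof.
rewrite -(rmorph_nat (@cst v)) fmorph_eq0.
exact: (negbT (@pnatr_eq0 (complex.complex Rdefinitions.R : numDomainType) k.+1)).
Qed.

Lemma xvar_inj : {in window v &, injective (@xvar v)}.
Proof.
have Xinj a b : (a < v)%N -> (b < v)%N ->
    mnm_of v (rcons (nseq a 0%N) 1%N, [::]) = mnm_of v (rcons (nseq b 0%N) 1%N, [::]) -> a = b.
  move=> av bv /mnmP /(_ (lshift v (Ordinal av))).
  by rewrite !mnm_of_Xn //= eqxx; case: eqP.
have yinj a b : (a < v)%N -> (b < v)%N -> yvar v a = yvar v b -> a = b.
  move=> av bv; rewrite /yvar av bv => /eqP; rewrite tofrac_eq => /eqP.
  move=> /(congr1 (fun p => p@_(mnm_of v (rcons (nseq a 0%N) 1%N, [::])))).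
  rewrite !mcoeffX eqxx; case: (eqVneq (mnm_of v (rcons (nseq b 0%N) 1%N, [::]))) => [e _|_].
    by apply/esym/Xinj.
  by move/eqP; rewrite oner_eq0.
have ynopp a b : (a < v)%N -> (b < v)%N -> yvar v a = - yvar v b -> False.
  move=> av bv; rewrite /yvar av bv -rmorphN => /eqP; rewrite tofrac_eq => /eqP.
  move=> /(congr1 (fun p => p@_(mnm_of v (rcons (nseq a 0%N) 1%N, [::])))).
  rewrite mcoeffN !mcoeffX eqxx.
  case: (mnm_of v (rcons (nseq b 0%N) 1%N, [::]) == _) => /eqP.
    rewrite -subr_eq0 opprK.
    by move/idPn; case; exact: (negbT (@pnatr_eq0 (complex.complex Rdefinitions.R : numDomainType) 2)).
  by rewrite oppr0 oner_eq0.
move=> i j; rewrite !mem_window => iv jv; rewrite /xvar.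
have [i0|i0] := lerP 0 i; have [j0|j0] := lerP 0 j.
- by move/yinj; lia.
- by move/ynopp; lia.
- by move/esym/ynopp; lia.
- by move/oppr_inj/yinj; lia.
Qed.
End GenericPoint.

(** Rows past the length of a partition are unitriangular, so the N x N Jacobi-Trudi determinant of
    the box agrees with the one of size l in [schur]. *)
Lemma det_unitri_pad (R : comNzRingType) l N (G : nat -> nat -> R) : (l <= N)%N ->
    (forall i j, (l <= i)%N -> (j < i)%N -> G i j = 0) ->
    (forall i, (l <= i)%N -> G i i = 1) ->
  \det (\matrix_(i < N, j < N) G i j) = \det (\matrix_(i < l, j < l) G i j).
Proof.
move=> /subnKC <- G0 G1; set r := (N - l)%N.
set A := \matrix_(i, j) _; rewrite -[A]submxK.
have -> : dlsubmx A = 0.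
  apply/matrixP => i j; rewrite !mxE /= G0 ?leq_addr //.
  by rewrite ltn_addr.
rewrite det_ublock; have -> : \det (drsubmx A) = 1.
  rewrite -det_tr det_trig; last first.
    by apply/is_trig_mxP => i j ij; rewrite !mxE /= G0 ?leq_addr // ltn_add2l.
  by apply: big1 => i _; rewrite !mxE /= G1 // leq_addr.
by rewrite mulr1; congr (\det _); apply/matrixP => i j; rewrite !mxE.
Qed.

Lemma size_hlist T k : size (hlist T k) = k.+1.
Proof. by elim: k => //= k IH; rewrite size_rcons IH. Qed.

(** * Homogeneity of Schur functions and truncation of tau *)

Section RepTau.
Variables (v d : nat).
Notation K := {fraction {mpoly C[v + v]}}.
Notation cst := (@cst v).
Notation rep := (@rep v d).
Notation xs := (@xvar v).
Notation ts := (@tvar v).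

Lemma rep_Tsub n W j : (W <= v)%N -> (forall i, i \notin window W -> n i = 0) ->
  rep (Tsub n W j) (shifted_time v xs ts n j).
Proof.
move=> Wv nW; rewrite /Tsub /shifted_time; apply: rep_add.
  case: ifP => [oj|/negbT ej]; first exact: rep_tvar.
  by rewrite tvar_even //; exact: rep0.
rewrite /powsum (big_window_sub _ Wv) => [|i _ /nW ->]; last by rewrite !mul0r.
apply: rep_sum => i iW.
have -> : (n i)%:~R / j%:R = cst ((n i)%:~R / j%:R) by rewrite fmorph_div rmorph_int rmorph_nat.
by apply/rep_scale/rep_sig_pow; move: iW; rewrite !mem_window; lia.
Qed.

Lemma rep_hlist T T' k i : (forall j, rep (T j) (T' j)) -> (i <= k)%N ->
  rep (nth ps0 (hlist T k) i) (fps_exp T' i).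
Proof.
move=> repT.
elim: k i => [|k IH] i.
  by rewrite leqn0 => /eqP->; exact: rep1.
rewrite leq_eqVlt => /orP[/eqP->|ik]; last first.
  by rewrite [hlist T k.+1]/(rcons _ _) nth_rcons size_hlist ik; exact: IH.
rewrite [hlist T k.+1]/(rcons _ _) nth_rcons size_hlist ltnn eqxx.
rewrite /fps_exp [explist T' k.+1]/(rcons _ _) nth_rcons size_explist ltnn eqxx.
have -> : k.+1%:R^-1 = cst (k.+1%:R^-1) by rewrite fmorphV rmorph_nat.
apply: rep_scale; apply: rep_sum => j; rewrite mem_iota => /andP[j0 jk].
rewrite -(rmorph_nat cst); apply: rep_scale; apply: rep_mul => //.
rewrite nth_explist; last by lia.
by apply: IH; lia.
Qed.

Lemma rep_hfun T T' z : (forall j, rep (T j) (T' j)) ->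
  rep (hfun T z) (hcoef (fps_exp T') z).
Proof.
move=> repT; rewrite /hfun /hcoef; case: ifP => _; first exact: rep0.
exact: rep_hlist.
Qed.

Lemma rep_schur T T' lam : (forall j, rep (T j) (T' j)) ->
  rep (schur T lam) (\det (\matrix_(i < size lam, j < size lam)
     hcoef (fps_exp T') ((nth 0%N lam i)%:Z - (i : nat)%:Z + (j : nat)%:Z))).
Proof.
move=> repT; rewrite /schur /determinant -big_enum /=; apply: rep_sum => s _.
have -> : (-1) ^+ s = cst ((-1) ^+ s) by rewrite rmorphXn rmorphN1.
apply: rep_scale; rewrite -big_enum /=; apply: rep_prod => i _.
by rewrite mxE; exact: rep_hfun.
Qed.

(** The degree is an integer so that the entries h_z with z < 0, which are 0, need no separate
    treatment in a Jacobi-Trudi product. *)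
Definition isobaric (e : int) (f : ps) :=
  forall k : 'X_{1..v + v}, mcoef f k != 0 -> (mweight k)%:Z = e.

Lemma isobaric0 e : isobaric e ps0. Proof. by move=> k; rewrite mcoef0 eqxx. Qed.

Lemma isobaric_add e f g : isobaric e f -> isobaric e g -> isobaric e (ps_add f g).
Proof.
move=> ef eg k; rewrite mcoef_add; have [f0|/ef //] := eqVneq (mcoef f k) 0.
by rewrite f0 add0r => /eg.
Qed.

Lemma isobaric_scale e c f : isobaric e f -> isobaric e (ps_scale c f).
Proof. by move=> ef k; rewrite mcoef_scale mulf_eq0 negb_or => /andP[_ /ef]. Qed.

Lemma isobaric_mul e e' f g : isobaric e f -> isobaric e' g -> isobaric (e + e') (ps_mul f g).
Proof.
move=> ef eg k; rewrite mcoef_mul => nz.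
have [k1 le] : exists2 k1 : 'X_{1..v + v}, (k1 <= k)%MM & mcoef f k1 * mcoef g (k - k1)%MM != 0.
  have [/existsP[k1 /andP[le nz1]]|] := boolP [exists k1 : bmultinom (v + v) (mdeg k).+1,
      (k1 <= k)%MM && (mcoef f k1 * mcoef g (k - k1)%MM != 0)].
    by exists k1.
  rewrite negb_exists => /forallP z; case/negP: nz; apply/eqP/big1 => k1 le.
  by have := z k1; rewrite le /= negbK => /eqP.
rewrite mulf_eq0 negb_or => /andP[/ef <- /eg <-].
by rewrite (mweight_sub le).
Qed.

Lemma isobaric_mono m : small v m -> isobaric (wdeg m) (ps_mono m).
Proof.
move=> sm k; rewrite mcoef_mono //; case: (eqVneq (mnm_of v m) k) => [<- _|]; last by rewrite eqxx.
by rewrite (wdeg_small sm).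
Qed.

Lemma isobaric_sum e (I : eqType) (s : seq I) (f : I -> ps) :
  {in s, forall i, isobaric e (f i)} -> isobaric e (ps_sum [seq f i | i <- s]).
Proof.
elim: s => [|i s IH] h; first exact: isobaric0.
apply: isobaric_add; first by apply: h; rewrite mem_head.
by apply: IH => j js; apply: h; rewrite inE js orbT.
Qed.

Lemma isobaric1 : isobaric 0 ps1.
Proof.
by have := @isobaric_mono ([::], [::]) isT; rewrite /wdeg /= big_ord0.
Qed.

Lemma isobaric_prod (I : Type) (s : seq I) (e : I -> int) (f : I -> ps) :
  (forall i, isobaric (e i) (f i)) -> isobaric (\sum_(i <- s) e i) (ps_prod [seq f i | i <- s]).
Proof.
move=> h; elim: s => [|i s IH]; first by rewrite big_nil; exact: isobaric1.
by rewrite big_cons; apply: isobaric_mul.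
Qed.

Lemma sumn_rcons_nseq0 a e : sumn (rcons (nseq a 0%N) e) = e.
Proof. by rewrite -cats1 sumn_cat sumn_nseq mul0n /= addn0. Qed.

Lemma isobaric_tvar (j : nat) : odd j -> isobaric j (t_var j).
Proof.
move=> oj; have [jv|jv] := ltnP j./2 v; last first.
  move=> k; have [p fp] := rep_tvar v (mweight k) oj.
  rewrite /tvar oj ltnNge jv /= => /esym/eqP; rewrite tofrac_eq0 => /eqP p0.
  by rewrite fp // p0 mcoeff0 eqxx.
have := @isobaric_mono ([::], rcons (nseq j./2 0%N) 1%N).
have -> : wdeg ([::], rcons (nseq j./2 0%N) 1%N) = j.
  rewrite /wdeg /= size_rcons size_nseq big_ord_recr /= nth_rcons size_nseq ltnn eqxx.
  rewrite muln1 big1 => [|i _]; last first.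
    by rewrite nth_rcons size_nseq ltn_ord nth_nseq ltn_ord muln0.
  by rewrite !add0n -add1n -[RHS]odd_double_half oj.
by apply; rewrite /small /= size_rcons size_nseq.
Qed.

Lemma isobaric_sig_pow i (j : nat) : i \in window v -> isobaric j (sig_pow i j).
Proof.
rewrite mem_window => iv.
have hy a : (a < v)%N -> isobaric j (y_pow a.+1 j).
  move=> av; have := @isobaric_mono (rcons (nseq a 0%N) j, [::]).
  rewrite /wdeg /= big_ord0 addn0 sumn_rcons_nseq0; apply.
  by rewrite /small /= size_rcons size_nseq av.
rewrite /sig_pow; case: ifP => i0; first by apply: hy; lia.
apply: isobaric_scale; have -> : absz i = (absz i).-1.+1 by lia.
by apply: hy; lia.
Qed.

Lemma isobaric_Tsub n W (j : nat) : (W <= v)%N -> isobaric j (Tsub n W j).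
Proof.
move=> Wv; apply: isobaric_add.
  by case: ifP => [oj|_]; [exact: isobaric_tvar|exact: isobaric0].
apply: isobaric_sum => i iW; apply/isobaric_scale/isobaric_sig_pow.
by move: iW; rewrite !mem_window; lia.
Qed.

Lemma isobaric_hlist T k (i : nat) : (forall j : nat, isobaric j (T j)) -> (i <= k)%N ->
  isobaric i (nth ps0 (hlist T k) i).
Proof.
move=> homT.
elim: k i => [|k IH] i.
  by rewrite leqn0 => /eqP->; exact: isobaric1.
rewrite leq_eqVlt => /orP[/eqP->|ik]; last first.
  by rewrite [hlist T k.+1]/(rcons _ _) nth_rcons size_hlist ik; exact: IH.
rewrite [hlist T k.+1]/(rcons _ _) nth_rcons size_hlist ltnn eqxx.
apply/isobaric_scale/isobaric_sum => j; rewrite mem_iota => /andP[j0 jk].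
apply: isobaric_scale.
have -> : k.+1%:Z = j%:Z + (k.+1 - j)%:Z by lia.
by apply: isobaric_mul => //; apply: IH; lia.
Qed.

Lemma isobaric_hfun T z : (forall j : nat, isobaric j (T j)) -> isobaric z (hfun T z).
Proof.
move=> homT; rewrite /hfun; case: ifP => z0; first exact: isobaric0.
have -> : z = absz z :> int by lia.
exact: isobaric_hlist.
Qed.

(** In each Leibniz term the degrees lambda_i - i + s(i) add up to |lambda|, because s permutes the
    indices. *)
Lemma isobaric_schur T lam : (forall j : nat, isobaric j (T j)) -> isobaric (sumn lam) (schur T lam).
Proof.
move=> homT; rewrite /schur; apply: isobaric_sum => s _; apply: isobaric_scale.
have -> : (sumn lam)%:Z = \sum_(i <- enum 'I_(size lam))
    ((nth 0%N lam i)%:Z - (i : nat)%:Z + (s i : nat)%:Z).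
  rewrite big_split sumrB /= !big_enum /=.
  rewrite [X in _ - _ + X](_ : _ = \sum_(i < size lam) (i : nat)%:Z); last first.
    by rewrite [RHS](reindex_inj (@perm_inj _ s)).
  rewrite subrK sumnE (big_nth 0%N) big_mkord.
  exact: (big_morph Posz PoszD erefl).
by apply: isobaric_prod => i; exact: isobaric_hfun.
Qed.

(** At a monomial of weight e <= d, [tau_sp] keeps the partitions of e. They all lie in the N x N
    box since e <= N, and by homogeneity the other partitions of the box do not contribute. *)
Lemma rep_tau_sp (pi : seq nat -> C) n W N : (W <= v)%N -> (d <= N)%N ->
    (forall i, i \notin window W -> n i = 0) ->
  rep (tau_sp pi n W) (tau_box N (cst \o pi) (hseries v xs ts n)).
Proof.
move=> Wv dN nW.
have repT j := rep_Tsub j Wv nW.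
apply: (@rep_ext v d _ (ps_sum [seq ps_scale (pi lam) (schur (Tsub n W) lam) | lam <- box N])).
  move=> k kd.
  have -> : mcoef (ps_sum [seq ps_scale (pi lam) (schur (Tsub n W) lam) | lam <- box N]) k =
      \sum_(lam <- box N) pi lam * mcoef (schur (Tsub n W) lam) k.
    elim: (box N) => [|lam s IH]; first by rewrite big_nil mcoef0.
    by rewrite big_cons -IH -mcoef_scale -mcoef_add.
  rewrite /mcoef {1}/coef /tau_sp cm_id wdeg_mono_of.
  under eq_bigr => lam _ do rewrite coef_cm.
  rewrite [RHS](bigID (fun lam => sumn lam == mweight k)) /=.
  have -> : \sum_(lam <- box N | sumn lam != mweight k)
      pi lam * mcoef (schur (Tsub n W) lam) k = 0.
    apply: big1 => lam ne; apply/eqP; rewrite mulf_eq0; apply/orP; right.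
    apply: contraNT ne => nz.
    by have := @isobaric_schur (Tsub n W) lam (fun j => @isobaric_Tsub n W j Wv) k nz; case=> ->.
  rewrite addr0 -[RHS]big_filter.
  have pe : perm_eq (partsn (mweight k)) [seq lam <- box N | sumn lam == mweight k].
    apply: uniq_perm; first exact: uniq_partsn.
      by rewrite filter_uniq // uniq_box.
    move=> lam; rewrite mem_partsn mem_filter mem_box andbC.
    case: eqP => //= e; case pl: (is_partition lam) => //=.
    have sl : (size lam <= sumn lam)%N.
      have /andP[_ al] := pl; elim: (lam) al => //= x l IH /andP[x0 /IH]; lia.
    have al : all (fun x => x <= sumn lam)%N lam.
      by apply/allP => x; elim: (lam) => //= y l IH; rewrite inE => /orP[/eqP->|/IH]; lia.
    have eN : (sumn lam <= N)%N by rewrite e (leq_trans kd).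
    rewrite (leq_trans sl eN) /=.
    by apply/esym/allP => x /(allP al) /= /leq_trans; exact.
  transitivity (\sum_(lam <- partsn (mweight k)) pi lam * mcoef (schur (Tsub n W) lam) k).
    by [].
  by rewrite [LHS](perm_big _ pe).
rewrite /tau_box; apply: rep_sum => lam bl; apply: rep_scale.
move: bl; rewrite mem_box => /and3P[pl sl _].
rewrite (@det_unitri_pad _ (size lam) N (fun i j =>
  hcoef (hseries v xs ts n) ((nth 0%N lam i)%:Z - i%:Z + j%:Z))) //.
- exact: rep_schur.
- by move=> i j li ji; rewrite /hcoef nth_default //; case: ifP => //; lia.
- move=> i li; rewrite /hcoef nth_default // sub0r addNr ltxx.
  exact: fps_exp0.
Qed.
End RepTau.

(** Frobenius coordinates satisfy a < |lambda| and b < l(lambda), so the window in [hfrac] contains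
    the support. *)
Lemma shiftn_supp n K lam (p : int) : finsupp_by n K ->
  p \notin window (K + sumn lam + size lam).+1 -> shiftn n lam p = 0.
Proof.
move=> supp; rewrite mem_window => pW; rewrite /shiftn supp; last by lia.
have fl : (frank lam <= size lam)%N by rewrite -[leqRHS](size_iota 0) count_size.
have nth_le i : (nth 0 lam i <= sumn lam)%N.
  by elim: (lam) i => [|x l IH] [|i] //=; [lia|have := IH i; lia].
have conj_le i : (conjp lam i <= size lam)%N by exact: count_size.
have -> : count (fun a => a == p) (frob_a lam) = 0%N.
  apply/eqP; rewrite -[_ == _]negbK -lt0n -has_count; apply/hasPn => a /mapP[j].
  rewrite mem_iota => jfr ->; have := nth_le j.
  by apply: contraL => /eqP e; apply/negP => le; lia.
have -> : count (fun b => - b - 1 == p) (frob_b lam) = 0%N; last by [].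
apply/eqP; rewrite -[_ == _]negbK -lt0n -has_count; apply/hasPn => b /mapP[j].
rewrite mem_iota => jfr ->; have := conj_le j.+1.
by apply: contraL => /eqP e; apply/negP => le; lia.
Qed.

(** * Representation of fractions *)

Section RepFrac.
Variables (v d : nat).
Notation K := {fraction {mpoly C[v + v]}}.
Notation cst := (@cst v).
Notation rep := (@rep v d).
Notation xs := (@xvar v).
Notation ts := (@tvar v).

Lemma rep_pref m W : (W <= v)%N -> (forall i, i \notin window W -> m i = 0) ->
  exists nu de, [/\ rep (pref_num m W) nu, rep (pref_den m W) de, de != 0 &
                    vpref v xs m = nu / de].
Proof.
move=> Wv mW; pose G (ij : int * int) := xs ij.1 - xs ij.2.
have sub i : i \in window W -> i \in window v by rewrite !mem_window; lia.
have repG ij : ij.1 \in window W -> ij.2 \in window W -> rep (sdiff ij.1 ij.2) (G ij).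
  move=> i1 i2; rewrite /sdiff /G; apply: rep_add; last apply: rep_opp.
    by rewrite -[xs _]expr1; apply/rep_sig_pow/sub.
  by rewrite -[xs _]expr1; apply/rep_sig_pow/sub.
pose prs := [seq (i, j) | i <- window W, j <- window W].
have prsP ij : ij \in prs -> (ij.1 \in window W) && (ij.2 \in window W).
  by case/allpairsP => -[i j] [/= iW jW ->]; rewrite iW jW.
pose e (ij : int * int) := m ij.1 * m ij.2.
exists (\prod_(ij <- [seq ij <- prs | (ij.1 < ij.2) && (0 < e ij)]) G ij ^+ absz (e ij)).
exists (\prod_(ij <- [seq ij <- prs | (ij.1 < ij.2) && (e ij < 0)]) G ij ^+ absz (e ij)).
split.
- apply: rep_prod => ij; rewrite mem_filter => /andP[_ /prsP/andP[i1 i2]].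
  by apply/rep_exp/repG.
- apply: rep_prod => ij; rewrite mem_filter => /andP[_ /prsP/andP[i1 i2]].
  by apply/rep_exp/repG.
- rewrite prodf_seq_neq0; apply/allP => ij; rewrite mem_filter => /andP[/andP[lt _] /prsP].
  case/andP => /sub i1 /sub i2; rewrite /= expf_neq0 // subr_eq0.
  by apply: contraTneq lt => /xvar_inj -> //; rewrite ltxx.
rewrite !big_filter -prodfV /vpref.
rewrite (big_window_sub _ Wv) => [|i _ /mW mi]; last first.
  by rewrite big1 // => j _; rewrite mi mul0r expr0z.
transitivity (\prod_(ij <- prs | ij.1 < ij.2) G ij ^ e ij).
  rewrite [RHS]big_mkcond big_allpairs_dep; apply: eq_bigr => i _ /=.
  rewrite -[RHS]big_mkcond /= big_mkcond [RHS]big_mkcond /=.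
  rewrite (big_window_sub _ Wv) // => j _ /mW mj.
  by rewrite mj mulr0 expr0z if_same.
rewrite [X in X * _]big_mkcondr [X in _ * X]big_mkcondr -big_split /=.
apply: eq_bigr => ij _; have [e0|e0|<-] := ltgtP 0 (e ij); last by rewrite mulr1 expr0z.
  by rewrite mulr1 -[in LHS](gtz0_abs e0).
by rewrite mul1r -[in LHS](opprK (e ij)) -(ltz0_abs e0) -exprnN.
Qed.

(** Numerator and denominator are matched separately up to weight d, and only the quotient of the
    representatives is taken in the field. *)
Definition fr_rep (x : Defs.frac) (val : K) := exists nu de,
  [/\ rep x.1 nu, rep x.2 de, de != 0 & val = nu / de].

Lemma fr_rep0 : fr_rep fr0 0.
Proof. by exists 0, 1; split; rewrite ?oner_eq0 ?mul0r //; [exact: rep0|exact: rep1]. Qed.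

Lemma fr_rep_add x y a b : fr_rep x a -> fr_rep y b -> fr_rep (fr_add x y) (a + b).
Proof.
move=> [p [q [xp xq q0 ->]]] [p' [q' [yp yq q0' ->]]].
exists (p * q' + p' * q), (q * q'); split.
- by apply: rep_add; apply: rep_mul.
- exact: rep_mul.
- by rewrite mulf_eq0 (negbTE q0) (negbTE q0').
by rewrite (addf_div _ _ q0 q0').
Qed.

Lemma fr_rep_mul x y a b : fr_rep x a -> fr_rep y b -> fr_rep (fr_mul x y) (a * b).
Proof.
move=> [p [q [xp xq q0 ->]]] [p' [q' [yp yq q0' ->]]].
exists (p * p'), (q * q'); split; [exact: rep_mul|exact: rep_mul| |by rewrite mulf_div].
by rewrite mulf_eq0 (negbTE q0) (negbTE q0').
Qed.

Lemma fr_rep_scale c x a : fr_rep x a -> fr_rep (fr_scale c x) (cst c * a).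
Proof.
move=> [p [q [xp xq q0 ->]]]; exists (cst c * p), q; split=> //; last by rewrite mulrA.
exact: rep_scale.
Qed.

Lemma fr_rep_sum (I : eqType) (s : seq I) (f : I -> Defs.frac) (a : I -> K) :
  {in s, forall i, fr_rep (f i) (a i)} ->
  fr_rep (fr_sum [seq f i | i <- s]) (\sum_(i <- s) a i).
Proof.
elim: s => [|i s IH] h; first by rewrite big_nil; exact: fr_rep0.
rewrite big_cons; apply: fr_rep_add; first by apply: h; rewrite mem_head.
by apply: IH => j js; apply: h; rewrite inE js orbT.
Qed.

Lemma fr_rep_eq0 x m : small v m -> (wdeg m <= d)%N -> fr_rep x 0 ->
  coef (ps_mul ps1 x.1) m = 0.
Proof.
move=> sm wm [p [q [xp _ q0 /esym/eqP]]]; rewrite mulf_eq0 invr_eq0 (negbTE q0) orbF.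
move=> /eqP p0; apply: (rep_eq0 sm wm); rewrite p0 in xp.
by have := rep_mul (rep1 v d) xp; rewrite mulr0.
Qed.

Lemma fr_rep_hfrac (pi : seq nat -> C) n S lam r k : finsupp_by n S ->
  ((S + sumn lam + size lam).+1 <= v)%N -> (d <= r + k)%N ->
  fr_rep (hfrac pi n S lam) (hval v xs ts r k (cst \o pi) n lam).
Proof.
move=> supp Wv dN; rewrite /hfrac /hval.
have mW i : i \notin window (S + sumn lam + size lam).+1 -> shiftn n lam i = 0.
  exact: shiftn_supp.
have [nu [de [rn rd d0 ->]]] := rep_pref Wv mW.
exists (nu * tau_box (r + k) (cst \o pi) (hseries v xs ts (shiftn n lam))), de.
split=> //; last by rewrite mulrAC.
by apply: rep_mul => //; exact: rep_tau_sp.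
Qed.
End RepFrac.

(** Both the number of variables and the weight bound may depend on the monomial tested. The
    numerator itself is 0, so the empty product is the witness. *)
Lemma loc_zero_of_rep (x : Defs.frac) :
  (forall m : mono, exists v, small v m /\ @fr_rep v (wdeg m) x 0) -> loc_zero x.
Proof.
move=> h; exists [::]; split=> // m; have [v [sm rx]] := h m.
exact: (fr_rep_eq0 sm (leqnn _) rx).
Qed.

Lemma leq_sum_mem (I : eqType) (s : seq I) (G : I -> nat) i : i \in s ->
  (G i <= \sum_(j <- s) G j)%N.
Proof. by move=> si; rewrite (big_rem _ si) leq_addr. Qed.

Lemma in_B_refl n : in_B n -> forall i, n (- i - 1) = - n i.
Proof.
move=> hB i; have [i0|i0] := lerP 0 i.
  have := hB (absz i).+1 isT.
  have -> : (absz i).+1%:Z - 1 = i by lia.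
  have -> : - (absz i).+1%:Z = - i - 1 by lia.
  by move=> ->; rewrite opprK.
have := hB (absz i); have -> : (absz i)%:Z - 1 = - i - 1 by lia.
have -> : - (absz i)%:Z = i by lia.
by apply; lia.
Qed.

Lemma sum_plucker_terms (F : comNzRingType) (h : seq nat -> F) I J :
  \sum_(x <- plucker_terms I J) (x.1.1)%:~R * (h x.1.2 * h x.2) =
  \sum_(j <- iota 0 (size J)) (-1) ^+ j.+1 *
     ((sgnL (rcons I (nth 0 J j)))%:~R * h (lamL (rcons I (nth 0 J j)))) *
     ((sgnL (rem_at j J))%:~R * h (lamL (rem_at j J))).
Proof.
rewrite /plucker_terms big_map; apply: eq_bigr => j _ /=.
by rewrite !rmorphM rmorphXn rmorphN1 /=; ring.
Qed.

(** * Transfer of the hypotheses to the fraction field, and conclusion *)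

Section RingMorphism.
Variables (F : fieldType) (cs : {rmorphism C -> F}) (pi : seq nat -> C).

Lemma rmorph_plucker_val I J : cs (plucker_val pi I J) =
  \sum_(x <- plucker_terms I J) (x.1.1)%:~R * ((cs \o pi) x.1.2 * (cs \o pi) x.2).
Proof.
rewrite rmorph_sum /=; apply: eq_bigr => x _.
by rewrite !rmorphM /= rmorph_int mulrA.
Qed.

Lemma rmorph_lagr_val k M : cs (lagr_val pi k M) =
  \sum_(lam <- box k) (lagr_coef k M lam)%:~R * (cs \o pi) lam.
Proof.
by rewrite rmorph_sum /=; apply: eq_bigr => lam _; rewrite rmorphM /= rmorph_int.
Qed.
End RingMorphism.

Theorem mainTheorem8 (pi : seq nat -> C) :
  in_LagrGr pi ->
  ~ ps_eq (tau_sp pi (fun _ => 0) 0) ps0 ->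
  forall (n : int -> int) (K : nat), finsupp_by n K -> in_B n ->
    (forall k N I J, plucker_index k N I J -> loc_zero (plucker_img pi n K I J)) /\
    (forall k M, (2 <= k)%N -> loc_zero (lagr_img pi n K k M)).
Proof.
move=> [_ pl lg] _ n K supp hB; split.
- move=> k N I J [k0 kN sI sJ /andP[rI rJ]]; apply: loc_zero_of_rep => m.
  set d := wdeg m.
  pose bnd (x : int * seq nat * seq nat) :=
    ((K + sumn x.1.2 + size x.1.2).+1 + (K + sumn x.2 + size x.2).+1)%N.
  (* Enough variables for the monomial, for the range of I and J, and for the window of every value
     that occurs. *)
  pose v := (size m.1 + size m.2 + k + N + \sum_(x <- plucker_terms I J) bnd x)%N.
  exists v; split; first by rewrite /small /v; lia.
  (* Here r = d, so that the box has side d + k >= d. *)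
  pose h := hval v (@xvar v) (@tvar v) d k (@cst v \o pi) n.
  have E : \sum_(x <- plucker_terms I J) @cst v (x.1.1)%:~R * (h x.1.2 * h x.2) = 0.
    under eq_bigr => x _ do rewrite rmorph_int.
    rewrite sum_plucker_terms.
    have inr (L : seq int) p : in_range k N L -> p \in L -> - k%:Z <= p /\ p \in window v.
      move=> /allP rL /rL; rewrite mem_window => /andP[p1 p2]; split=> //.
      by rewrite /v; lia.
    apply: (@hval_plucker _ v _ (@tvar v) (@natK0 v) (@xvar_inj v) d k) => //.
    - by rewrite /v; lia.
    - move=> I' J' sI' sJ' subI' subJ'.
      (* For N = d + k in a space of dimension 2N the admissible range is exactly [window N]. *)
      have idx : plucker_index (d + k) (d + k + (d + k)) I' J'.
        have rng L : {subset L <= window (d + k)} -> in_range (d + k) (d + k + (d + k)) L.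
          by move=> sub; apply/allP => p /sub; rewrite mem_window; lia.
        by split=> //; [lia|lia|rewrite !rng].
      by have := pl _ _ _ _ idx => /(congr1 (@cst v)); rewrite rmorph_plucker_val rmorph0 sum_plucker_terms.
    - by move=> p /(inr _ _ rI)[].
    - by move=> p /(inr _ _ rJ)[].
    - by move=> p /(inr _ _ rI)[].
    - by move=> p /(inr _ _ rJ)[].
  rewrite /plucker_img -E; apply: fr_rep_sum => x xT.
  have xv : (bnd x <= v)%N.
    by apply: leq_trans (leq_sum_mem bnd xT) _; rewrite /v leq_addl.
  apply/fr_rep_scale/fr_rep_mul; apply: fr_rep_hfrac => //; rewrite ?leq_addr //.
    by apply: leq_trans xv; rewrite leq_addr.
  by apply: leq_trans xv; rewrite leq_addl.
move=> k M k2; apply: loc_zero_of_rep => m; set d := wdeg m.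
pose bnd lam := ((K + sumn lam + size lam).+1)%N.
pose v := (size m.1 + size m.2 + k + \sum_(lam <- box k) bnd lam)%N.
exists v; split; first by rewrite /small /v; lia.
pose h := hval v (@xvar v) (@tvar v) d k (@cst v \o pi) n.
have E : \sum_(lam <- box k) @cst v (lagr_coef k M lam)%:~R * h lam = 0.
  under eq_bigr => lam _ do rewrite rmorph_int.
  (* The relations at d + k are turned into ordered-pair sums, carried to the shifted values at k,
     and turned back. *)
  apply: lagr_of_omega_sum => //; first exact: eqN_eq0 (@natK0 v).
  apply: (@hval_lagr_sum _ v _ (@tvar v) (@natK0 v) (@xvar_inj v)) => //.
  - exact: xvar_refl.
  - exact: tvar_even.
  - by rewrite /v; lia.
  - exact: in_B_refl.
  apply: omega_sum_of_lagr; first exact: eqN_eq0 (@natK0 v).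
    by lia.
  by move=> M'; rewrite -rmorph_lagr_val lg ?rmorph0 //; lia.
rewrite /lagr_img -E; apply: fr_rep_sum => lam bl.
apply/fr_rep_scale/fr_rep_hfrac => //; last by rewrite leq_addr.
by apply: leq_trans (leq_sum_mem bnd bl) _; rewrite /v leq_addl.
Qed.
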